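(* Let $0<\alpha<1$, $\beta>0$, $\alpha+1/\beta\ge 1$, let $L^A(0,1)$ be an Orlicz space with a Young function $A$, and let $M(0,1)$ be a Marcinkiewicz endpoint space with a fundamental function $\varphi$ satisfying $$\sup_{0<t<1}\varphi(t^{1/\beta})\,t^{\alpha-1}=\infty .$$ Let $X(0,1)$ be the largest r.i. space satisfying $H_\alpha^\beta\colon X(0,1)\to M(0,1)$, and let $B$ be a Young function such that the Orlicz space $L^B(0,1)$ has the same fundamental function, up to equivalence, as $X(0,1)$. Let $\widetilde A$ and $\widetilde B$ be the complementary Young functions to $A$ and $B$, respectively. Then $$H_\alpha^\beta\colon L^A(0,1)\to M(0,1)$$ holds if and only if there exist $C>0$ and a constant $c>0$ such that $$\int_1^t\frac{\widetilde A(s)}{s^{1/(1-\alpha)+1}}\,ds\le c\,\frac{\widetilde B(Ct)}{t^{1/(1-\alpha)}}\quad\text{for all } t\in(2,\infty).$$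
   Context: All spaces are over $I=(0,1)$ with Lebesgue measure. $\mathcal M(I)$ is the class of real-valued measurable functions on $I$, $\mathcal M^+(I)$ its nonnegative members. For $f\in\mathcal M(I)$, $f^*(t)=\inf\{\lambda>0:\ |\{x\in I: |f(x)|>\lambda\}|\le t\}$ is the nonincreasing rearrangement and $f^{**}(t)=\frac1t\int_0^t f^*(s)\,ds$. Operator: $(H_\alpha^\beta f)(t)=\int_{t^\beta}^1 f(s)\,s^{\alpha-1}\,ds$, $t\in(0,1)$. R.i. spaces: a rearrangement-invariant (r.i.) Banach function norm is a map $\rho\colon\mathcal M^+(I)\to[0,\infty]$ such that (P1) $\rho(f)=0$ iff $f=0$ a.e., $\rho(af)=a\rho(f)$ for $a\ge0$, $\rho(f+g)\le\rho(f)+\rho(g)$; (P2) $0\le f\le g$ a.e. implies $\rho(f)\le\rho(g)$; (P3) $0\le f_n\uparrow f$ a.e. implies $\rho(f_n)\uparrow\rho(f)$; (P4) $\rho(\chi_I)<\infty$; (P5) $\int_0^1 f\le C\rho(f)$ for a constant $C$ independent of $f$; (P6) $\rho(f)=\rho(f^* )$. The corresponding r.i. space is $\{f\in\mathcal M(I):\rho(|f|)<\infty\}$ with norm $\|f\|=\rho(|f|)$. Its fundamental function is $t\mapsto\rho(\chi_{(0,t)})$ for $t\in(0,1)$, with value $0$ at $t=0$. Two functions are equivalent if each is bounded by a positive constant multiple of the other. Marcinkiewicz endpoint space: for a concave fundamental function $\varphi$ (concave, nonnegative, nondecreasing, vanishing exactly at $0$, possibly discontinuous at $0$), $M_\varphi(0,1)$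 is the r.i. space with norm $\sup_{0<t<1}f^{**}(t)\varphi(t)$; its fundamental function is $\varphi$. Boundedness: $T\colon X\to Y$ means that there is $C>0$ with $\|Tf\|_Y\le C\|f\|_X$ for every $f\in X$. Largest: the largest r.i. space with a given property is an r.i. space that has the property and contains every r.i. space having the property. Spaces are identified up to equivalence of norms. Young functions: $A$ is a Young function if $A(t)=\int_0^t a(s)\,ds$, $t\ge 0$, where $a\colon[0,\infty)\to[0,\infty)$ is right-continuous and nondecreasing, $a(0)=0$, $a(s)>0$ for $s>0$ and $\lim_{s\to\infty}a(s)=\infty$. Its complementary function is the Young function $\widetilde A(t)=\sup_{s>0}(st-A(s))$. The Orlicz space $L^A(0,1)$ is equipped with the Luxemburg norm $\|f\|_{L^A}=\inf\{\lambda>0:\int_0^1A(|f(x)|/\lambda)\,dx\le1\}$; its fundamental function is $1/A^{-1}(1/t)$. *)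

(* Defs.v *)
From HB Require Import structures.
From mathcomp Require Import all_boot all_order all_algebra.
From mathcomp Require Import all_classical all_reals all_analysis.
Set Implicit Arguments.
Unset Strict Implicit.
Unset Printing Implicit Defensive.
Import Order.TTheory GRing.Theory Num.Theory.
Import numFieldNormedType.Exports.
Local Open Scope classical_set_scope.
Local Open Scope ring_scope.

(* Functions on (0,1) are functions on R of which only the values on (0,1) are
   relevant. *)
Definition I01 (R : realType) : set R := `]0%R, 1%R[%classic.
Arguments I01 : clear implicits.

Definition measI (R : realType) (f : R -> R) : Prop := measurable_fun (I01 R) f.

Definition measI_pos (R : realType) (f : R -> R) : Prop :=
  measI f /\ forall x, I01 R x -> 0 <= f x.

Definition aeI (R : realType) (P : R -> Prop) : Prop :=
  {ae (@lebesgue_measure R), forall x, I01 R x -> P x}.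

(* For measurable [f] and 0 < t < 1 the set is nonempty, because f is
   real-valued and (0,1) has finite measure, and it is bounded below by 0. *)
Definition rearr (R : realType) (f : R -> R) (t : R) : R :=
  inf [set l : R | 0 < l /\
    (lebesgue_measure [set x | I01 R x /\ (l < `|f x|)%R] <= t%:E)%E].

(* Extended-valued: it is +oo when f is not integrable on (0,1). *)
Definition rearr_avg (R : realType) (f : R -> R) (t : R) : \bar R :=
  (t^-1%:E *
   \int[@lebesgue_measure R]_(s in `]0%R, t[%classic) (rearr f s)%:E)%E.

Record ri_norm (R : realType) (rho : (R -> R) -> \bar R) : Prop := RiNorm {
  ri_ge0 : forall f, measI_pos f -> (0 <= rho f)%E ;
  ri_eq0 : forall f, measI_pos f -> (rho f = 0%E <-> aeI (fun x => f x = 0)) ;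
  ri_homo : forall (a : R) f, 0 <= a -> measI_pos f ->
    rho (fun x => a * f x) = (a%:E * rho f)%E ;
  ri_triangle : forall f g, measI_pos f -> measI_pos g ->
    (rho (fun x => f x + g x)%R <= rho f + rho g)%E ;
  ri_lattice : forall f g, measI_pos f -> measI_pos g ->
    aeI (fun x => f x <= g x) -> (rho f <= rho g)%E ;
  ri_fatou : forall (f_ : nat -> R -> R) f,
    (forall n, measI_pos (f_ n)) -> measI_pos f ->
    aeI (fun x => nondecreasing_seq (fun n => f_ n x) /\
                  f_ n x @[n --> \oo] --> f x) ->
    nondecreasing_seq (fun n => rho (f_ n)) /\
    rho (f_ n) @[n --> \oo] --> rho f ;
  ri_fin1 : (rho (\1_(I01 R)) < +oo)%E ;
  ri_L1 : exists2 C : R, 0 < C & forall f, measI_pos f ->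
    (\int[@lebesgue_measure R]_(x in I01 R) (f x)%:E <= C%:E * rho f)%E ;
  ri_rearr : forall f, measI_pos f -> rho f = rho (rearr f) }.

Definition space_norm (R : realType) (rho : (R -> R) -> \bar R) (f : R -> R)
  : \bar R := rho (fun x => `|f x|).

Definition ri_space (R : realType) (rho : (R -> R) -> \bar R) : set (R -> R) :=
  [set f | measI f /\ (space_norm rho f < +oo)%E].

(* Meaningful on [0,1). *)
Definition fundamental_function (R : realType) (rho : (R -> R) -> \bar R)
  (t : R) : \bar R :=
  if t == 0 then 0%E else rho (\1_(`]0%R, t[%classic : set R)).

Definition equivalent_on (R : realType) (D : set R) (f g : R -> \bar R) : Prop :=
  (exists2 c : R, 0 < c & forall t, D t -> (f t <= c%:E * g t)%E) /\
  (exists2 c : R, 0 < c & forall t, D t -> (g t <= c%:E * f t)%E).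

Definition bounded_op (R : realType) (T : (R -> R) -> (R -> R))
    (rhoX rhoY : (R -> R) -> \bar R) : Prop :=
  exists2 C : R, 0 < C & forall f, ri_space rhoX f ->
    (space_norm rhoY (T f) <= C%:E * space_norm rhoX f)%E.

Definition largest_ri (R : realType) (P : ((R -> R) -> \bar R) -> Prop)
    (rho : (R -> R) -> \bar R) : Prop :=
  [/\ ri_norm rho, P rho &
      forall sigma, ri_norm sigma -> P sigma ->
        ri_space sigma `<=` ri_space rho].

(* The integral converges for t in (0,1) as soon as f is integrable on (0,1),
   in particular for f in any r.i. space. *)
Definition Hop (R : realType) (alpha beta : R) (f : R -> R) (t : R) : R :=
  \int[@lebesgue_measure R]_(s in [set` `]t `^ beta, 1%R[%R])
    (f s * s `^ (alpha - 1)).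

(* Concavity on [0,1) is convexity of the opposite function; a jump at 0 is
   allowed. *)
Definition concave_fundamental (R : realType) (phi : R -> R) : Prop :=
  let D := `[0%R, 1%R[%classic : set R in
  [/\ @convex_function R R^o D (fun t => - phi t),
      forall t, D t -> 0 <= phi t,
      forall s t, D s -> D t -> s <= t -> phi s <= phi t &
      forall t, D t -> (phi t = 0 <-> t = 0)].

Definition marcinkiewicz_norm (R : realType) (phi : R -> R) (f : R -> R)
  : \bar R :=
  ereal_sup [set (rearr_avg f t * (phi t)%:E)%E | t in I01 R].

(* Only the values of A on [0,oo) are relevant. *)
Definition young_function (R : realType) (A : R -> R) : Prop :=
  exists a : R -> R,
    [/\ forall s : R, 0 <= s -> a x @[x --> s^'+] --> a s,
        forall s t : R, 0 <= s -> s <= t -> a s <= a t,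
        a 0 = 0 /\ (forall s : R, 0 < s -> 0 < a s),
        a s @[s --> +oo] --> +oo &
        forall t : R, 0 <= t ->
          (A t)%:E =
          (\int[@lebesgue_measure R]_(s in `[0%R, t]%classic) (a s)%:E)%E].

(* For t >= 0 the set is bounded above when A is a Young function. *)
Definition complementary (R : realType) (A : R -> R) (t : R) : R :=
  sup [set s * t - A s | s in [set s : R | 0 < s]].

Definition luxemburg_norm (R : realType) (A : R -> R) (f : R -> R) : \bar R :=
  ereal_inf [set l%:E | l in [set l : R | 0 < l /\
    (\int[@lebesgue_measure R]_(x in I01 R) (A (`|f x| / l))%:E <= 1)%E]].

(* Main.v *)
Require Import Defs.
From mathcomp Require Import all_boot all_order all_algebra.
From mathcomp Require Import all_classical all_reals all_analysis.
From mathcomp Require Import measurable_realfun.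
From mathcomp Require Import ring lra.
Set Implicit Arguments.
Unset Strict Implicit.
Unset Printing Implicit Defensive.
Import Order.TTheory GRing.Theory Num.Theory.
Import numFieldNormedType.Exports.
Local Open Scope classical_set_scope.
Local Open Scope ring_scope.

(** Write [p = 1 / (1 - alpha)], [psi tau = phi (tau `^ (1 / beta))] and
[K tau r = r `^ (alpha - 1) * min 1 ((r / tau) `^ (1 / beta))]. Averaging [H f] over
[(0, tau `^ (1 / beta))] and exchanging the order of integration gives the integral of [f * K tau]
(average_Hop). For nonnegative [f] the function [H f] is nonincreasing, hence its own rearrangement
almost everywhere, and the Marcinkiewicz norm of [H f] is therefore the supremum over [tau] of
[psi tau] times the integral of [f * K tau] (marcinkiewicz_Hop_ge, marcinkiewicz_Hop_le). The whole
proof tests this family of kernels against different spaces.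

The largest domain. Let [theta] be the least nonincreasing majorant of
[sigma |-> psi sigma * sigma `^ (alpha - 1)]. Since [alpha + 1 / beta >= 1], each [psi sigma * K sigma]
lies below [theta] (psi_hardy_kernel_le_theta), so by the Hardy-Littlewood inequality the operator is
bounded on the Lorentz space with weight [theta], which is rearrangement invariant (ri_norm_lorentz).
The fundamental function of that space is at most a multiple of [t * theta t] (integral_theta_le).
As [X] contains it, and inclusion of rearrangement-invariant spaces bounds norms of indicators
(ri_embedding_indic), the fundamental function of [X] is at most a multiple of [t * theta t].
Testing the operator on indicators of intervals ending at [sigma] gives the converse
(bounded_op_fundamental_ge). Hence [t * theta t] is the fundamental function of [X], and of [L^B],
up to constants, which means that [theta t] is comparable to the inverse of the complement of [B]
at [1 / t] (complementary_fundamental_ge, complementary_fundamental_le).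

The Orlicz space. The operator is bounded from [L^A] exactly when, for one constant [C], the
integrals over (0,1) of the complement of [A] at [psi tau * K tau / C] are all at most [1]: the Young
inequality gives one direction (modular_bounded), and the functions for which the Young inequality is
an equality give the other (bounded_modular). The kernel [K sigma s] is at most
[max sigma s `^ (alpha - 1)], and comparable to it for [s >= sigma / 2], so what has to be bounded is
the integral over [(tau, 1)] of the complement of [A] at [T * (tau / s) `^ (1 - alpha)], with [T]
comparable to [theta tau]. The substitution [u = T * (tau / s) `^ (1 - alpha)] turns it into
[p * tau * T `^ p] times the integral of the complement of [A] against [u `^ (- p - 1)] over an
interval ending at [T] (hardy_substitution). As [1 / tau] is comparable to the complement of [B] at a multiple of [theta tau], the modular bound becomes
the integral condition at [t = T] (hardy_integral_condition, modular_of_integral_condition). Every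
[t > 2] is reached up to a factor [2], because [theta] is unbounded and at most doubles when its
argument is halved. *)

(** * Tonelli and the layer-cake formula *)

Lemma tonelli_on d1 d2 (T1 : measurableType d1) (T2 : measurableType d2)
  (R : realType) (m1 : {sigma_finite_measure set T1 -> \bar R})
  (m2 : {sigma_finite_measure set T2 -> \bar R})
  (D : set T1) (E : set T2) (f : T1 -> T2 -> R) :
  measurable D -> measurable E ->
  measurable_fun (D `*` E) (fun p : T1 * T2 => f p.1 p.2) ->
  (forall x y, D x -> E y -> 0 <= f x y) ->
  (\int[m1]_(x in D) \int[m2]_(y in E) (f x y)%:E =
   \int[m2]_(y in E) \int[m1]_(x in D) (f x y)%:E)%E.
Proof.
move=> mD mE mf f0.
pose g : T1 * T2 -> \bar R := (fun p => (f p.1 p.2)%:E) \_ (D `*` E).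
have mg : measurable_fun setT g.
  by apply/(measurable_restrictT _ (measurableX mD mE)); apply/measurable_EFinP.
have g0 z : (0 <= g z)%E.
  rewrite /g patchE; case: ifPn => // /set_mem [Dz Ez]; by rewrite lee_fin f0.
rewrite [LHS]integral_mkcond [RHS]integral_mkcond.
transitivity (\int[m1]_x \int[m2]_y g (x, y))%E;
  [|rewrite fubini_tonelli//]; apply: eq_integral => x _; rewrite patchE.
- case: ifPn => Dx.
    rewrite [LHS]integral_mkcond; apply: eq_integral => y _.
    by rewrite /g !patchE in_setX /= Dx.
  by rewrite integral0_eq // => y _; rewrite /g patchE in_setX /= (negbTE Dx).
- case: ifPn => Dx.
    rewrite [RHS]integral_mkcond; apply: eq_integral => y _.
    by rewrite /g !patchE in_setX /= Dx andbT.
  by rewrite integral0_eq // => y _; rewrite /g patchE in_setX /= (negbTE Dx) andbF.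
Qed.

Lemma measurable_fst_comp d1 d2 d3 (T1 : measurableType d1) (T2 : measurableType d2)
  (T3 : measurableType d3) (D : set T1) (E : set T2) (h : T1 -> T3) :
  measurable D -> measurable_fun D h -> measurable E ->
  measurable_fun (D `*` E) (fun p : T1 * T2 => h p.1).
Proof.
move=> mD mh mE; apply: (measurable_comp mD) => //.
- by move=> _ [p [Dp _] <-].
- exact: measurable_funS measurable_fst.
Qed.

Lemma measurable_snd_comp d1 d2 d3 (T1 : measurableType d1) (T2 : measurableType d2)
  (T3 : measurableType d3) (D : set T1) (E : set T2) (h : T2 -> T3) :
  measurable D -> measurable E -> measurable_fun E h ->
  measurable_fun (D `*` E) (fun p : T1 * T2 => h p.2).
Proof.
move=> mD mE mh; apply: (measurable_comp mE) => //.
- by move=> _ [p [_ Ep] <-].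
- exact: measurable_funS measurable_snd.
Qed.

(** Reduces inequalities between weighted integrals to inequalities on superlevel sets; according to the
case, the weight or the function is put in the place of [h]. *)
Lemma layer_cake (R : realType) (D : set R) (w h : R -> R) :
  measurable D -> measurable_fun D w -> measurable_fun D h ->
  (forall x, D x -> 0 <= w x) -> (forall x, D x -> 0 <= h x) ->
  (\int[@lebesgue_measure R]_(x in D) (w x * h x)%:E =
   \int[@lebesgue_measure R]_(l in `]0%R, +oo[%classic)
     \int[@lebesgue_measure R]_(x in D `&` [set x | (l < h x)%R]) (w x)%:E)%E.
Proof.
move=> mD mw mh w0 h0.
pose f (x l : R) := if l < h x then w x else 0.
transitivity (\int[@lebesgue_measure R]_(x in D)
   \int[@lebesgue_measure R]_(l in `]0%R, +oo[%classic) (f x l)%:E)%E.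
  apply: eq_integral => x /set_mem Dx.
  transitivity (\int[@lebesgue_measure R]_(l in `]0%R, h x[%classic) (w x)%:E)%E.
    rewrite integral_cst //= lebesgue_measure_itv/= lte_fin.
    case: ltP => hx; first by rewrite oppr0 adde0.
    by rewrite (le_anti (introT andP (conj hx (h0 x Dx)))) mulr0 mule0.
  rewrite integral_mkcond [RHS]integral_mkcond; apply: eq_integral => l _.
  rewrite !patchE /f !mem_setE !in_itv/= andbT.
  by case: ltP => //= _; case: ltP.
rewrite tonelli_on //.
- apply: eq_integral => l /set_mem; rewrite /= in_itv/= andbT => l0.
  rewrite integral_mkcondr; apply: eq_integral => x /set_mem Dx.
  rewrite patchE /f; case: ifPn => hx; first by rewrite mem_set.
  by rewrite memNset// => /= hx'; rewrite hx' in hx.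
- apply: measurable_fun_if => //.
  + exact: measurableX.
  + apply: measurable_fun_ltr; first exact: measurable_funS measurable_snd.
    exact: measurable_fst_comp.
  + apply: measurable_funS (measurable_fst_comp mD mw (measurable_itv `]0%R, +oo[)) => //.
    exact: measurableX.
- by move=> x y Dx _; rewrite /f; case: ifP => // _; exact: w0.
Qed.

(** * The distribution function and the nonincreasing rearrangement *)

Section rearrangement.
Context {R : realType}.
Implicit Types f g : R -> R.
Local Notation mu := (@lebesgue_measure R).
Local Notation I := (I01 R).

Definition superlevel f (l : R) : set R := I `&` [set x | l < f x].
(** Real valued, since superlevel sets are subsets of the unit interval. *)
Definition distr f (l : R) : R := fine (mu (superlevel f l)).

Lemma measurable_I01 : measurable I.
Proof. exact: measurable_itv. Qed.

Lemma lebesgue_I01 : mu I = 1%E.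
Proof. by rewrite /I01 lebesgue_measure_itv/= lte_fin ltr01 oppr0 adde0. Qed.

Lemma measurable_superlevel f l : measI f -> measurable (superlevel f l).
Proof.
move=> mf.
have : measurable_fun I (fun x => l < f x) by exact: measurable_fun_ltr.
by move=> /(_ measurable_I01 [set true]); apply.
Qed.

Lemma measI_pos_norm f : measI_pos f -> forall x, I x -> `|f x| = f x.
Proof. by move=> [_ f0] x Ix; rewrite ger0_norm// f0. Qed.

Lemma lebesgue_superlevel f l : measI f -> mu (superlevel f l) = (distr f l)%:E.
Proof.
move=> mf; rewrite fineK//; rewrite ge0_fin_numE//.
apply: (@le_lt_trans _ _ (mu I)); last by rewrite lebesgue_I01 ltry.
apply: le_measure; rewrite ?inE; first exact: measurable_superlevel.
- exact: measurable_I01.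
- exact: subIsetl.
Qed.

Lemma distr_ge0 f l : 0 <= distr f l.
Proof. by rewrite fine_ge0. Qed.

Lemma distr_le1 f l : measI f -> distr f l <= 1.
Proof.
move=> mf; rewrite -lee_fin -lebesgue_superlevel// -lebesgue_I01.
apply: le_measure; rewrite ?inE; [exact: measurable_superlevel|exact: measurable_I01|].
exact: subIsetl.
Qed.

Lemma le_distr f l l' : measI f -> l <= l' -> distr f l' <= distr f l.
Proof.
move=> mf ll'; rewrite -lee_fin -!lebesgue_superlevel//.
apply: le_measure; rewrite ?inE; [exact: measurable_superlevel..|].
by move=> x [Ix /= lx]; split => //=; exact: le_lt_trans lx.
Qed.

(** Continuity from below of the measure: the sets [f > l + 1/(n+1)] increase to [f > l]. *)
Lemma distr_right_continuous f (l s : R) : measI f -> s < distr f l ->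
  exists2 l', l < l' & s < distr f l'.
Proof.
move=> mf sl.
pose F (n : nat) := superlevel f (l + n.+1%:R^-1).
have FE : \bigcup_n F n = superlevel f l.
  apply/seteqP; split => x /=.
    by move=> [n _ [Ix /= nx]]; split => //=; apply: le_lt_trans nx; rewrite lerDl.
  move=> [Ix /= lx].
  have d0 : 0 < f x - l by rewrite subr_gt0.
  have [n /= nd] := ltr_add_invr d0.
  by exists n => //; split => //=; move: nd; rewrite add0r ltrBrDl.
have mF n : measurable (F n) by exact: measurable_superlevel.
have : (mu \o F) x @[x --> \oo] --> mu (\bigcup_n F n).
  apply: nondecreasing_cvg_mu => //.
  - by rewrite FE; exact: measurable_superlevel.
  - move=> m n mn; rewrite subsetEset => x [Ix /= mx]; split => //=.
    apply: le_lt_trans mx; rewrite lerD2l lef_pV2 ?posrE//.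
    by rewrite ler_nat ltnS.
rewrite FE lebesgue_superlevel// => cF.
have /cF [n _ /(_ n (leqnn n)) /=] : nbhs (distr f l)%:E [set y | (s%:E < y)%E].
  by apply: open_nbhs_nbhs; split => /=; [exact: open_ereal_gt_ereal|rewrite lte_fin].
rewrite lebesgue_superlevel// lte_fin => sn.
by exists (l + n.+1%:R^-1) => //; rewrite ltrDl.
Qed.

(** Continuity from above of the measure, as the sets [f > n] decrease to the empty set. Thus the set
whose infimum defines the rearrangement is nonempty. *)
Lemma distr_small f (s : R) : measI f -> 0 < s -> exists2 l, 0 < l & distr f l <= s.
Proof.
move=> mf s0.
pose F (n : nat) := superlevel f (n.+1%:R).
have mF n : measurable (F n) by exact: measurable_superlevel.
have FE : \bigcap_n F n = set0.
  apply/seteqP; split => x //= /(_ _ Logic.I).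
  pose n := Num.truncn (f x).
  move=> /(_ n) [_ /=]; rewrite ltNge => /negP; apply.
  by rewrite ltW// truncnS_gt.
have F0 : (mu (F 0%N) < +oo)%E by rewrite /F lebesgue_superlevel// ltry.
have mI : measurable (\bigcap_n F n) by rewrite FE.
have nF : {homo F : n m / (n <= m)%N >-> (m <= n)%O}.
  move=> m n mn; rewrite subsetEset => x [Ix /= mx]; split => //=.
  by apply: le_lt_trans mx; rewrite ler_nat ltnS.
have := @nonincreasing_cvg_mu _ _ _ mu F F0 mF mI nF.
rewrite FE measure0 => cF.
have /cF [n _ /(_ n (leqnn n)) /=] : nbhs (0%:E : \bar R) [set y | (y < s%:E)%E].
  by apply: open_nbhs_nbhs; split => /=; [exact: open_ereal_lt_ereal|rewrite lte_fin].
rewrite lebesgue_superlevel// lte_fin => /ltW sn.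
by exists n.+1%:R.
Qed.

Lemma rearrE f s : measI_pos f ->
  rearr f s = inf [set l | 0 < l /\ distr f l <= s].
Proof.
move=> fp; congr inf; apply/seteqP.
have E (l : R) : [set x | I x /\ l < `|f x|] = superlevel f l.
  apply/seteqP; split => x /= [Ix]; rewrite (measI_pos_norm fp)//;
  by split => //; rewrite ?(measI_pos_norm fp).
have mf := proj1 fp.
by split => l /= []; rewrite E (lebesgue_superlevel l mf) lee_fin.
Qed.

Lemma rearr_ge0 f s : 0 <= rearr f s.
Proof.
rewrite /rearr; set S := (X in inf X).
have [S0|/nonemptyPn ->] := pselect (S !=set0); last by rewrite inf0.
by apply: lb_le_inf => // l [/ltW].
Qed.

(** The rearrangement and the distribution function are generalized inverses of each other. Through this
equivalence every property of rearrangements is read off from the distribution function. *)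
Lemma lt_rearr f (l s : R) : measI_pos f -> 0 < s -> 0 <= l ->
  (l < rearr f s) = (s < distr f l).
Proof.
move=> fp s0 l0; have mf := proj1 fp; rewrite rearrE//.
set S := (X in inf X).
apply/idP/idP => [|sl].
  apply: contraTT; rewrite -!leNgt => ds.
  apply/ler_addgt0Pr => e e0; apply: ge_inf; first by exists 0 => x [/ltW].
  split; first by rewrite ltr_wpDl.
  by apply: le_trans ds; apply: le_distr => //; rewrite lerDl ltW.
have [l' ll' sl'] := distr_right_continuous mf sl.
apply: (lt_le_trans ll'); apply: lb_le_inf.
  by have [k k0 ks] := distr_small mf s0; exists k.
move=> k [k0 ks]; rewrite leNgt; apply/negP => /ltW kl'.
by have := lt_le_trans sl' (le_trans (le_distr mf kl') ks); rewrite ltxx.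
Qed.

End rearrangement.

(** * Comparison of integrals and monotone functions *)

Section monotone_functions.
Context {R : realType}.
Local Notation mu := (@lebesgue_measure R).

(** The integral of a nonnegative function is a supremum over the simple functions below it, hence it is
monotone on arbitrary functions. *)
Lemma le_integral_ge0 d (T : measurableType d) (m : {measure set T -> \bar R})
    (D : set T) (f g : T -> \bar R) :
  (forall x, D x -> 0 <= f x)%E -> (forall x, D x -> f x <= g x)%E ->
  (\int[m]_(x in D) f x <= \int[m]_(x in D) g x)%E.
Proof.
move=> f0 fg; rewrite integral_mkcond [leRHS]integral_mkcond.
have f0' x : (0 <= (f \_ D) x)%E.
  by rewrite patchE; case: ifPn => // /set_mem/f0.
have fg' x : ((f \_ D) x <= (g \_ D) x)%E.
  by rewrite !patchE; case: ifPn => // /set_mem/fg.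
rewrite !ge0_integralTE//; last by move=> x; exact: le_trans (fg' x).
apply: ereal_sup_le => _ [h /= hf <-]; exists h => //= x.
exact: le_trans (hf x) (fg' x).
Qed.

Lemma nonincreasing_on_measurable (D : set R) (f : R -> R) :
  is_interval D -> (forall x y, D x -> D y -> x <= y -> f y <= f x) ->
  measurable_fun D f.
Proof.
move=> iD nif; apply: (measurability (@RGenCInfty.G R)) => [|/= _ [_] [r] -> <-].
  exact: RGenCInfty.measurableE.
apply: is_interval_measurable => s t/=.
move=> [Ds]; rewrite !in_itv/= !andbT => fs [Dt ft] u /andP[su ut].
have Du : D u by apply: (iD s t) => //; rewrite su.
by split => //; rewrite in_itv/= andbT (le_trans ft)// nif.
Qed.

Lemma is_interval_I01 : is_interval (I01 R).
Proof. exact: interval_is_interval. Qed.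

End monotone_functions.

(** * Equimeasurability and the Hardy-Littlewood inequality *)

Section equimeasurability.
Context {R : realType}.
Implicit Types f g w : R -> R.
Local Notation mu := (@lebesgue_measure R).
Local Notation I := (I01 R).

Lemma I01P (x : R) : I x <-> 0 < x /\ x < 1.
Proof. by rewrite /I01/= in_itv/=; split => [/andP[]|[-> ->]]. Qed.

Lemma rearr_nonincreasing f (s t : R) : measI_pos f -> 0 < s -> s <= t ->
  rearr f t <= rearr f s.
Proof.
move=> fp s0 st; rewrite leNgt; apply/negP => h.
have r0 := rearr_ge0 f s.
move: (h); rewrite lt_rearr// ?(lt_le_trans s0)// => td.
by move: (le_lt_trans st td); rewrite -lt_rearr// ltxx.
Qed.

Lemma measI_pos_rearr f : measI_pos f -> measI_pos (rearr f).
Proof.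
move=> fp; split; last by move=> x _; exact: rearr_ge0.
apply: nonincreasing_on_measurable; first exact: is_interval_I01.
by move=> x y /I01P[x0 _] _; exact: rearr_nonincreasing.
Qed.

Lemma superlevel_rearr f (l : R) : measI_pos f -> 0 <= l ->
  superlevel (rearr f) l = `]0, distr f l[%classic.
Proof.
move=> fp l0; apply/seteqP; split => x /=.
  by move=> [/I01P[x0 x1]/=]; rewrite lt_rearr// in_itv/= x0.
rewrite in_itv/= => /andP[x0 xd]; split; last by rewrite /= lt_rearr.
by apply/I01P; split => //; apply: lt_le_trans xd _; exact: distr_le1 (proj1 fp).
Qed.

Lemma lebesgue_itv0 (t : R) : 0 <= t -> mu `]0, t[%classic = t%:E.
Proof.
move=> t0; rewrite lebesgue_measure_itv/= lte_fin; case: ltP => [_|t0'].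
  by rewrite oppr0 adde0.
by congr EFin; apply/le_anti; rewrite t0 t0'.
Qed.

Lemma distr_rearr f (l : R) : measI_pos f -> 0 <= l ->
  distr (rearr f) l = distr f l.
Proof.
move=> fp l0; rewrite {1}/distr superlevel_rearr// lebesgue_itv0//.
exact: distr_ge0.
Qed.

Lemma eq_rearr f g : measI_pos f -> measI_pos g ->
  (forall l, 0 < l -> distr f l = distr g l) -> rearr f = rearr g.
Proof.
move=> fp gp E; apply/funext => s; rewrite !rearrE//; congr inf.
by apply/seteqP; split => l [l0]; rewrite ?E// => h; split => //; rewrite E.
Qed.

Lemma le_distr_ae f g (l : R) : measI f -> measI g ->
  aeI (fun x => f x <= g x) -> distr f l <= distr g l.
Proof.
move=> mf mg [N [mN N0 sN]]; rewrite -lee_fin -!lebesgue_superlevel//.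
have mg' := measurable_superlevel l mg.
rewrite -(@measureU0 _ _ _ mu _ _ mg' mN N0); apply: le_measure; rewrite ?inE.
- exact: measurable_superlevel.
- exact: measurableU.
- move=> x [Ix /= lf]; have [xN|xN] := pselect (N x); [by right|left].
  split => //=; apply: lt_le_trans lf _; apply: contrapT => fg; apply: xN.
  by apply: sN => /= /(_ Ix).
Qed.

Lemma le_rearr f g (s : R) : measI_pos f -> measI_pos g ->
  aeI (fun x => f x <= g x) -> 0 < s -> rearr f s <= rearr g s.
Proof.
move=> fp gp fg s0; rewrite leNgt; apply/negP => h; have r0 := rearr_ge0 g s.
move: (h); rewrite lt_rearr// => td.
have := lt_le_trans td (le_distr_ae (rearr g s) (proj1 fp) (proj1 gp) fg).
by rewrite -lt_rearr// ltxx.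
Qed.

Lemma le_lebesgue (A B : set R) : measurable A -> measurable B -> A `<=` B ->
  (mu A <= mu B)%E.
Proof. by move=> mA mB AB; apply: le_measure; rewrite ?inE. Qed.

(** Bathtub principle: a nonincreasing weight has its largest integral, among sets of given measure, on
the initial segment. By the layer-cake formula it suffices to treat the superlevel sets of [w], which
are themselves initial segments. *)
Lemma initial_segment_integral w (E : set R) : measurable E -> E `<=` I ->
  (forall x, I x -> 0 <= w x) ->
  (forall x y, I x -> I y -> x <= y -> w y <= w x) ->
  (\int[mu]_(x in E) (w x)%:E <= \int[mu]_(x in `]0%R, fine (mu E)[%classic) (w x)%:E)%E.
Proof.
move=> mE EI w0 niw.
have mw : measI w by apply: nonincreasing_on_measurable => //; exact: is_interval_I01.
have E1 : (mu E <= 1)%E.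
  by rewrite -(@lebesgue_I01 R); apply: le_measure; rewrite ?inE//; exact: measurable_I01.
have Efin : (mu E = (fine (mu E))%:E)%E.
  by rewrite fineK// ge0_fin_numE// (le_lt_trans E1)// ltry.
set t := fine (mu E) in Efin *.
have t0 : 0 <= t by rewrite fine_ge0.
have t1 : t <= 1 by rewrite -lee_fin -Efin.
have sub : `]0, t[%classic `<=` I.
  by move=> x /=; rewrite in_itv/= => /andP[x0 xt]; apply/I01P; split => //; exact: lt_le_trans xt t1.
have mt : measurable (`]0, t[%classic : set R) by exact: measurable_itv.
under eq_integral do rewrite -[w _]mul1r.
under [leRHS]eq_integral do rewrite -[w _]mul1r.
have c1 D : measurable D -> measurable_fun D (fun=> 1 : R) by move=> *; exact: measurable_cst.
rewrite (@layer_cake R E (fun=> 1)) ?(@layer_cake R `]0, t[%classic (fun=> 1))//.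
all: try by move=> x /EI /w0.
all: try by move=> x /sub /w0.
all: try by apply: measurable_funS mw => //; exact: measurable_I01.
apply: le_integral_ge0 => y _; first by apply: integral_ge0.
have mJ : measurable (superlevel w y) by exact: measurable_superlevel.
have inter A : A `<=` I -> A `&` [set x | y < w x] = A `&` superlevel w y.
  by move=> AI; apply/seteqP; split => x [Ax] => [|[_]] h; do ?split => //; exact: AI.
rewrite (inter _ EI) (inter _ sub) !integral_cst ?mul1e//; [|exact: measurableI..].
(* both sets are initial segments, so one of them contains the other *)
have [tJ|] := pselect (`]0, t[%classic `<=` superlevel w y).
  rewrite (setIidl tJ); apply: (@le_trans _ _ (mu E)).
    by apply: le_lebesgue => //; exact: measurableI.
  by rewrite Efin -(lebesgue_itv0 t0).
move/existsNP => [x /not_implyP [/= xt xJ]].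
apply: le_lebesgue; [exact: measurableI..|].
move=> z [Ez Jz]; split => //=; have [Iz /= yz] := Jz.
have Ix := sub _ xt.
rewrite in_itv/=; have /I01P [-> _] := Iz; rewrite /=.
move: xt; rewrite in_itv/= => /andP[_]; apply: le_lt_trans.
rewrite leNgt; apply/negP => /ltW xz; apply: xJ; split => //=.
exact: lt_le_trans yz (niw _ _ Ix Iz xz).
Qed.

(** The layer-cake formula in [f] reduces this to superlevel sets of [f], whose rearrangements are the
initial segments of the same measure. *)
Lemma hardy_littlewood w f : measI_pos f ->
  (forall x, I x -> 0 <= w x) ->
  (forall x y, I x -> I y -> x <= y -> w y <= w x) ->
  (\int[mu]_(x in I) (w x * f x)%:E <= \int[mu]_(x in I) (w x * rearr f x)%:E)%E.
Proof.
move=> fp w0 niw; have [mf f0] := fp; have [mr r0] := measI_pos_rearr fp.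
have mw : measI w by apply: nonincreasing_on_measurable => //; exact: is_interval_I01.
rewrite layer_cake//; last exact: measurable_I01.
rewrite layer_cake//; last exact: measurable_I01.
apply: le_integral_ge0 => l; rewrite /= in_itv/= andbT => l0.
  by apply: integral_ge0 => x [/w0].
rewrite -!/(superlevel _ _) (superlevel_rearr fp (ltW l0)) /distr.
apply: initial_segment_integral => //; last exact: subIsetl.
exact: measurable_superlevel.
Qed.

(** Integrals of [(f - c)^+] depend only on the distribution function, hence are preserved by
rearrangement. They replace, in the proof of the triangle inequality, a supremum of integrals of [f]
over sets of given measure, which would require choosing such sets. *)
Lemma integral_excess f (c : R) : measI f -> 0 <= c ->
  (\int[mu]_(x in I) (Num.max (f x - c) 0)%:E =
   \int[mu]_(l in `]0%R, +oo[%classic) (distr f (c + l))%:E)%E.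
Proof.
move=> mf c0.
under eq_integral do rewrite -[Num.max _ _]mul1r.
have mI : measurable I by exact: measurable_I01.
rewrite (@layer_cake R I (fun=> 1))//; first last.
- by move=> x _; rewrite le_max lexx orbT.
- apply: measurable_maxr => //; apply: measurable_funB => //.
apply: eq_integral => l /set_mem /=; rewrite in_itv/= andbT => l0.
have -> : I `&` [set x | l < Num.max (f x - c) 0] = superlevel f (c + l).
  apply/seteqP; split => x [Ix] /=; rewrite lt_max ltrBrDl => h; split => //=.
    by case/orP: h => //; rewrite ltNge ltW.
  by rewrite h.
rewrite (integral_cst mu (measurable_superlevel (c + l) mf)) mul1e; exact: lebesgue_superlevel.
Qed.

Lemma integral_excess_rearr f (c : R) : measI_pos f -> 0 <= c ->
  (\int[mu]_(x in I) (Num.max (rearr f x - c) 0)%:E =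
   \int[mu]_(x in I) (Num.max (f x - c) 0)%:E)%E.
Proof.
move=> fp c0; rewrite !integral_excess//; [|exact: (proj1 fp)|exact: (proj1 (measI_pos_rearr fp))].
apply: eq_integral => l /set_mem /=; rewrite in_itv/= andbT => l0.
by rewrite distr_rearr// addr_ge0// ltW.
Qed.

End equimeasurability.

(** * Subadditivity of the Lorentz functional *)

Section lorentz.
Context {R : realType}.
Implicit Types f g w : R -> R.
Local Notation mu := (@lebesgue_measure R).
Local Notation I := (I01 R).

Definition nonincr_weight w :=
  (forall x, I x -> 0 <= w x) /\ (forall x y, I x -> I y -> x <= y -> w y <= w x).

Lemma measI_weight w : nonincr_weight w -> measI w.
Proof.
by move=> [_ niw]; apply: nonincreasing_on_measurable => //; exact: is_interval_I01.
Qed.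

Lemma nonincr_weight_rearr f : measI_pos f -> nonincr_weight (rearr f).
Proof.
move=> fp; split => [x _|x y /I01P[x0 _] _ xy]; first exact: rearr_ge0.
exact: rearr_nonincreasing.
Qed.

Lemma measI_posD f g : measI_pos f -> measI_pos g -> measI_pos (fun x => f x + g x).
Proof.
move=> [mf f0] [mg g0]; split; first exact: measurable_funD.
by move=> x Ix; rewrite addr_ge0 ?f0 ?g0.
Qed.

Lemma measI_pos_excess f (c : R) : measI f -> measI_pos (fun x => Num.max (f x - c) 0).
Proof.
move=> mf; split; last by move=> x _; rewrite le_max lexx orbT.
by apply: measurable_maxr => //; apply: measurable_funB.
Qed.

(** Together with segment_integral_eq this says that the integral of the rearrangement over an initial
segment is the minimum over [c] of the right-hand side, which is subadditive in [(f, c)] jointly. *)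
Lemma segment_integral_le f (J : set R) (c : R) : measI_pos f -> 0 <= c ->
  measurable J -> J `<=` I ->
  (\int[mu]_(x in J) (rearr f x)%:E <=
   c%:E * mu J + \int[mu]_(x in I) (Num.max (f x - c) 0)%:E)%E.
Proof.
move=> fp c0 mJ JI; have mI : measurable I by exact: measurable_I01.
have mr := proj1 (measI_pos_rearr fp); have [me e0] := measI_pos_excess c mr.
rewrite -(integral_excess_rearr fp c0) -(integral_cst mu mJ c%:E).
apply: (@le_trans _ _ (\int[mu]_(x in J) c%:E + \int[mu]_(x in J) (Num.max (rearr f x - c) 0)%:E)%E).
  rewrite -ge0_integralD//.
  - apply: le_integral_ge0 => x Jx; first by rewrite lee_fin rearr_ge0.
    by rewrite -EFinD lee_fin -lerBlDl le_max lexx.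
  - by move=> x /JI/e0; rewrite lee_fin.
  - by apply/measurable_EFinP; exact: measurable_funS me.
apply: leeD => //; apply: ge0_subset_integral => //.
exact/measurable_EFinP.
Qed.

(** The minimum is attained at any level separating the values of the rearrangement inside [J] from those
outside. *)
Lemma segment_integral_eq f (J : set R) : measI_pos f ->
  measurable J -> J `<=` I -> (forall x y, J x -> I y -> y <= x -> J y) ->
  J !=set0 -> exists2 c : R, 0 <= c &
  (\int[mu]_(x in J) (rearr f x)%:E =
   c%:E * mu J + \int[mu]_(x in I) (Num.max (f x - c) 0)%:E)%E.
Proof.
move=> fp mJ JI Jdown [x0 Jx0]; have mI : measurable I by exact: measurable_I01.
have [r0 nir] := nonincr_weight_rearr fp.
pose S := [set rearr f y | y in I `\` J].
have ubS x : J x -> ubound S (rearr f x).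
  move=> Jx _ [y [Iy Jy] <-]; apply: nir => //; first exact: JI.
  rewrite leNgt; apply/negP => /ltW yx; apply: Jy; exact: Jdown yx.
(* when J is all of I the set S is empty and the level 0, which is the default value of sup, works *)
have [c c0 [cJ cIJ]] : exists2 c : R, 0 <= c &
   (forall x, J x -> c <= rearr f x) /\ (forall x, I x -> ~ J x -> rearr f x <= c).
  exists (sup S).
    have [[z [y Iy yz]]|/nonemptyPn ->] := pselect (S !=set0); last by rewrite sup0.
    apply: (le_trans (rearr_ge0 f y)); apply: ub_le_sup; last by exists y.
    by exists (rearr f x0); exact: ubS.
  split => [x Jx|x Ix nJx].
    have [S0|/nonemptyPn ->] := pselect (S !=set0); last by rewrite sup0 rearr_ge0.
    by apply: ge_sup => //; exact: ubS.
  by apply: ub_le_sup; [exists (rearr f x0); exact: ubS|exists x].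
exists c => //; rewrite -(integral_excess_rearr fp c0) -(integral_cst mu mJ c%:E).
have mr := proj1 (measI_pos_rearr fp); have [me e0] := measI_pos_excess c mr.
have -> : (\int[mu]_(x in I) (Num.max (rearr f x - c) 0)%:E =
  \int[mu]_(x in J) (Num.max (rearr f x - c) 0)%:E)%E.
  rewrite integral_mkcond [RHS]integral_mkcond; apply: eq_integral => x _.
  rewrite !patchE; case: ifPn => [/set_mem Ix|Ix]; case: ifPn => // Jx.
    congr EFin; apply/max_idPr; rewrite subr_le0; apply: cIJ => //.
    by move=> /mem_set; rewrite (negbTE Jx).
  by case/negP: Ix; apply/mem_set; apply: JI; exact/set_mem.
rewrite -ge0_integralD//.
- apply: eq_integral => x /set_mem/cJ cx.
  by rewrite -EFinD (max_idPl _) ?subr_ge0// addrC subrK.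
- by move=> x /JI/e0; rewrite lee_fin.
- by apply/measurable_EFinP; exact: measurable_funS me.
Qed.

(** Apply segment_integral_le to [f + g] at the sum of the two optimal levels, and use
[(x + y - c - d)^+ <= (x - c)^+ + (y - d)^+]. *)
Lemma segment_integral_triangle f g (J : set R) : measI_pos f -> measI_pos g ->
  measurable J -> J `<=` I -> (forall x y, J x -> I y -> y <= x -> J y) ->
  (\int[mu]_(x in J) (rearr (fun x => f x + g x) x)%:E <=
   \int[mu]_(x in J) (rearr f x + rearr g x)%:E)%E.
Proof.
move=> fp gp mJ JI Jdown.
have [J0|/nonemptyPn ->] := pselect (J !=set0); last by rewrite !integral_set0.
have [c c0 fE] := segment_integral_eq fp mJ JI Jdown J0.
have [d d0 gE] := segment_integral_eq gp mJ JI Jdown J0.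
have fgp := measI_posD fp gp.
have mI : measurable I by exact: measurable_I01.
have [mf' f0'] := measI_pos_excess c (proj1 fp).
have [mg' g0'] := measI_pos_excess d (proj1 gp).
apply: (le_trans (segment_integral_le fgp (addr_ge0 c0 d0) mJ JI)).
under [leRHS]eq_integral do rewrite EFinD.
rewrite ge0_integralD//; first last.
- by apply/measurable_EFinP; exact: measurable_funS (proj1 (measI_pos_rearr gp)).
- by move=> x _; rewrite lee_fin rearr_ge0.
- by apply/measurable_EFinP; exact: measurable_funS (proj1 (measI_pos_rearr fp)).
- by move=> x _; rewrite lee_fin rearr_ge0.
rewrite fE gE addeACA EFinD ge0_muleDl ?lee_fin//.
apply: leeD => //; rewrite -ge0_integralD//; first last.
- exact/measurable_EFinP.
- exact/measurable_EFinP.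
apply: le_integral_ge0 => x Ix; first by rewrite lee_fin le_max lexx orbT.
rewrite -EFinD lee_fin ge_max; apply/andP; split; last by rewrite addr_ge0 ?f0' ?g0'.
rewrite opprD addrACA lerD// le_max lexx//.
Qed.

Definition lorentz w f : \bar R := (\int[mu]_(x in I) (w x * rearr f x)%:E)%E.

(** By the layer-cake formula in the weight, the functional is an average of integrals of the
rearrangement over superlevel sets of [w]; these are initial segments because [w] is nonincreasing. *)
Lemma lorentz_triangle w f g : nonincr_weight w -> measI_pos f -> measI_pos g ->
  (lorentz w (fun x => f x + g x)%R <= lorentz w f + lorentz w g)%E.
Proof.
move=> hw fp gp; have [w0 niw] := hw; have mw := measI_weight hw.
have mI : measurable I by exact: measurable_I01.
have [[mf f0] [mg g0]] := (measI_pos_rearr fp, measI_pos_rearr gp).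
have [mfg fg0] := measI_pos_rearr (measI_posD fp gp).
have [msum sum0] := measI_posD (measI_pos_rearr fp) (measI_pos_rearr gp).
rewrite /lorentz -ge0_integralD//; first last.
- by apply/measurable_EFinP; exact: measurable_funM.
- by move=> x Ix; rewrite lee_fin mulr_ge0 ?w0 ?g0.
- by apply/measurable_EFinP; exact: measurable_funM.
- by move=> x Ix; rewrite lee_fin mulr_ge0 ?w0 ?f0.
under [leLHS]eq_integral do rewrite mulrC.
under [leRHS]eq_integral do rewrite -EFinD -mulrDr mulrC.
rewrite layer_cake// [leRHS]layer_cake//.
apply: le_integral_ge0 => y _.
  by apply: integral_ge0 => x [/fg0].
apply: segment_integral_triangle => //.
- exact: measurable_superlevel.
- move=> x z [Ix /= yx] Iz zx; split => //=; exact: lt_le_trans yx (niw _ _ Iz Ix zx).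
Qed.

End lorentz.

(** * Rearrangement-invariant norms of Lorentz type *)

Section lorentz_norm.
Context {R : realType}.
Implicit Types f g w : R -> R.
Local Notation mu := (@lebesgue_measure R).
Local Notation I := (I01 R).

Lemma cvg_nondecreasing_approx (u : nat -> R) (L : R) :
  nondecreasing_seq u -> (forall n, u n <= L) -> (forall l, l < L -> exists n, l < u n) ->
  u n @[n --> \oo] --> L.
Proof.
move=> ndu uL appr; apply/cvgrPdist_le => e e0.
have [N lN] := appr (L - e) (ltac:(by rewrite ltrBlDr ltrDl)).
exists N => // n /= Nn; rewrite ger0_norm ?subr_ge0//.
by rewrite lerBlDl -lerBlDr; apply: le_trans (ltW lN) _; exact: ndu.
Qed.

Lemma eq_ge0_lt (x y : R) : 0 <= x -> 0 <= y ->
  (forall l, 0 <= l -> (l < x) = (l < y)) -> x = y.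
Proof.
move=> x0 y0 E; apply/le_anti/andP; split; rewrite leNgt; apply/negP => h.
  by move: (h); rewrite E// ltxx.
by move: (h); rewrite -E// ltxx.
Qed.

Lemma rearr_bounded f (c s : R) : measI_pos f -> aeI (fun x => f x <= c) ->
  0 <= c -> 0 < s -> rearr f s <= c.
Proof.
move=> fp fc c0 s0; rewrite leNgt; apply/negP; rewrite lt_rearr//.
have mc : measI (fun=> c : R) by exact: measurable_cst.
move=> /lt_le_trans /(_ (le_distr_ae c (proj1 fp) mc fc)).
suff -> : distr (fun=> c) c = 0 by rewrite ltNge ltW.
rewrite /distr (_ : superlevel _ _ = set0) ?measure0//.
by apply/seteqP; split => x //= [_ /=]; rewrite ltxx.
Qed.

Lemma aeI_all (P : R -> Prop) : (forall x, I x -> P x) -> aeI P.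
Proof. by move=> h; apply: aeW => x; exact: h. Qed.

Lemma aeI_imp (P Q : R -> Prop) : (forall x, I x -> P x -> Q x) -> aeI P -> aeI Q.
Proof.
move=> PQ; apply: negligibleS => x /= nQ h; apply: nQ => Ix.
by apply: PQ => //; exact: h.
Qed.

Lemma measI_posZ f (a : R) : 0 <= a -> measI_pos f -> measI_pos (fun x => a * f x).
Proof.
by move=> a0 [mf f0]; split; [exact: measurable_funM|move=> x /f0; exact: mulr_ge0].
Qed.

Lemma rearrZ f (a s : R) : 0 <= a -> measI_pos f -> 0 < s ->
  rearr (fun x => a * f x) s = a * rearr f s.
Proof.
rewrite le_eqVlt => /orP[/eqP <-|a0] fp s0.
  rewrite mul0r; apply/le_anti; rewrite rearr_ge0 andbT.
  apply: rearr_bounded => //; first exact: measI_posZ.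
  by apply: aeI_all => x _; rewrite mul0r.
have afp := measI_posZ (ltW a0) fp.
apply: eq_ge0_lt; first exact: rearr_ge0.
  by rewrite mulr_ge0 ?rearr_ge0// ltW.
move=> l l0; rewrite -ltr_pdivrMl// !lt_rearr ?mulr_ge0 ?invr_ge0 ?(ltW a0)//.
congr (_ < fine (mu _)); apply/seteqP; split => x [Ix] /=.
  by rewrite -ltr_pdivrMl.
by move=> h; split => //=; rewrite -ltr_pdivrMl.
Qed.

Lemma rearr_idem f : measI_pos f -> rearr (rearr f) = rearr f.
Proof.
move=> fp; apply: eq_rearr => //; first exact: measI_pos_rearr.
by move=> l /ltW; exact: distr_rearr.
Qed.

(** If [f x > l] then [f_ n x > l] for some [n]: outside a null set the superlevel sets of [f_ n] exhaust
that of [f]. *)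
Lemma distr_fatou (f_ : nat -> R -> R) f (l s : R) :
  (forall n, measI_pos (f_ n)) -> measI_pos f ->
  aeI (fun x => nondecreasing_seq (fun n => f_ n x) /\ f_ n x @[n --> \oo] --> f x) ->
  s < distr f l -> exists n, s < distr (f_ n) l.
Proof.
move=> fnp fp [N [mN N0 sN]] sl.
have good x : I x -> ~ N x ->
    nondecreasing_seq (fun n => f_ n x) /\ f_ n x @[n --> \oo] --> f x.
  move=> Ix nN; apply: contrapT => h; apply: nN; apply: sN => /= /(_ Ix); exact: h.
pose E n := superlevel (f_ n) l `\` N.
have mE n : measurable (E n).
  by apply: measurableD => //; exact: measurable_superlevel (proj1 (fnp n)).
have mUE : measurable (\bigcup_n E n) by exact: bigcup_measurable.
have ndE : {homo E : n m / (n <= m)%N >-> (n <= m)%O}.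
  move=> m n mn; rewrite subsetEset => x [[Ix /= lx] nN]; split => //; split => //=.
  by apply: lt_le_trans lx _; apply: (good x Ix nN).1.
have cE := @nondecreasing_cvg_mu _ _ _ mu E mE mUE ndE.
have sUE : (s%:E < mu (\bigcup_n E n))%E.
  apply: (@lt_le_trans _ _ (distr f l)%:E); first by rewrite lte_fin.
  rewrite -(lebesgue_superlevel l (proj1 fp)) -(@measureU0 _ _ _ mu _ _ mUE mN N0).
  apply: le_lebesgue; [exact: measurable_superlevel (proj1 fp)|exact: measurableU|].
  move=> x [Ix /= lx]; have [xN|xN] := pselect (N x); [by right|left].
  have [_ cf] := good x Ix xN.
  have [n _ /(_ n (leqnn n)) /= nl] := cvgr_gt _ cf _ lx.
  by exists n => //; split => //; split.
have /cE [n _ /(_ n (leqnn n)) /= nl] :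
    nbhs (mu (\bigcup_n E n)) [set y | (s%:E < y)%E].
  by apply: open_nbhs_nbhs; split => //=; exact: open_ereal_gt_ereal.
exists n; rewrite -lte_fin -(lebesgue_superlevel l (proj1 (fnp n))).
apply: lt_le_trans nl _; apply: le_lebesgue => //; last exact: subDsetl.
exact: measurable_superlevel (proj1 (fnp n)).
Qed.

Lemma rearr_fatou (f_ : nat -> R -> R) f (s : R) :
  (forall n, measI_pos (f_ n)) -> measI_pos f ->
  aeI (fun x => nondecreasing_seq (fun n => f_ n x) /\ f_ n x @[n --> \oo] --> f x) ->
  0 < s ->
  nondecreasing_seq (fun n => rearr (f_ n) s) /\
  rearr (f_ n) s @[n --> \oo] --> rearr f s.
Proof.
move=> fnp fp h s0.
have nd : nondecreasing_seq (fun n => rearr (f_ n) s).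
  move=> m n mn; apply: le_rearr => //.
  by apply: aeI_imp h => x _ [ndx _]; exact: ndx.
split => //; apply: cvg_nondecreasing_approx => //.
  move=> n; apply: le_rearr => //; apply: aeI_imp h => x _ [ndx cx].
  have -> : f x = limn (fun n => f_ n x) by apply/esym/cvg_lim.
  by apply: nondecreasing_cvgn_le => //; apply/cvg_ex; exists (f x).
move=> l; have [l0|l0] := leP 0 l; last first.
  by move=> _; exists 0%N; apply: lt_le_trans l0 _; exact: rearr_ge0.
rewrite lt_rearr// => /(distr_fatou fnp fp h)[n sn]; exists n.
by rewrite lt_rearr.
Qed.

Lemma lorentz_ge0 w f : nonincr_weight w -> (0 <= lorentz w f)%E.
Proof.
by move=> [w0 _]; apply: integral_ge0 => x Ix; rewrite lee_fin mulr_ge0 ?w0 ?rearr_ge0.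
Qed.

Lemma le_lorentz w f g : nonincr_weight w -> measI_pos f -> measI_pos g ->
  aeI (fun x => f x <= g x) -> (lorentz w f <= lorentz w g)%E.
Proof.
move=> [w0 _] fp gp fg; apply: le_integral_ge0 => x Ix.
  by rewrite lee_fin mulr_ge0 ?w0 ?rearr_ge0.
have /I01P[x0 _] := Ix.
by rewrite lee_fin ler_wpM2l ?w0//; exact: le_rearr.
Qed.

Lemma lorentz_L1 w (c : R) f : nonincr_weight w -> 0 < c ->
  (forall x, I x -> c <= w x) -> measI_pos f ->
  (\int[mu]_(x in I) (f x)%:E <= c^-1%:E * lorentz w f)%E.
Proof.
move=> hw c0 cw fp; have mI : measurable I by exact: measurable_I01.
have mr := proj1 (measI_pos_rearr fp); have mw := measI_weight hw.
have h1 : nonincr_weight (fun=> 1 : R) by split.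
under eq_integral do rewrite -[f _]mul1r.
apply: (le_trans (hardy_littlewood fp h1.1 h1.2)).
rewrite /lorentz -ge0_integralZl_EFin//; first last.
- by rewrite invr_ge0 ltW.
- by apply/measurable_EFinP; exact: measurable_funM.
- by move=> x Ix; rewrite lee_fin mulr_ge0 ?rearr_ge0// hw.1.
apply: le_integral_ge0 => x Ix; first by rewrite mul1r lee_fin rearr_ge0.
rewrite -EFinM lee_fin mulrA ler_wpM2r ?rearr_ge0//.
by rewrite ler_pdivlMl// mulr1 cw.
Qed.

(** The lower bound on [w] gives the embedding into the integrable functions, the integrability of [w]
the finiteness on the unit interval. *)
Lemma ri_norm_lorentz w (c : R) : nonincr_weight w -> 0 < c ->
  (forall x, I x -> c <= w x) -> (\int[mu]_(x in I) (w x)%:E < +oo)%E ->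
  ri_norm (lorentz w).
Proof.
move=> hw c0 cw wfin; have [w0 niw] := hw; have mw := measI_weight hw.
have mI : measurable I by exact: measurable_I01.
split.
- by move=> f _; exact: lorentz_ge0.
- move=> f fp; split => [f0|f0].
    have : (\int[mu]_(x in I) `|(f x)%:E| = 0)%E.
      apply/le_anti; apply/andP; split; last exact: integral_ge0.
      have := lorentz_L1 hw c0 cw fp; rewrite f0 mule0; apply: le_trans.
      apply: le_integral_ge0 => x Ix; first exact: abse_ge0.
      by rewrite /= ger0_norm// fp.2.
    have mf : measurable_fun I (EFin \o f) by apply/measurable_EFinP; exact: fp.1.
    move=> /(ae_eq_integral_abs mu mI mf).1; apply: filterS => x h Ix.
    by have /= := h Ix; case.
  apply: integral0_eq => x /I01P[x0 _].
  suff -> : rearr f x = 0 by rewrite mulr0.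
  apply/le_anti; rewrite rearr_ge0 andbT; apply: rearr_bounded => //.
  by apply: aeI_imp f0 => y _ ->.
- move=> a f a0 fp; rewrite /lorentz -ge0_integralZl_EFin//; first last.
  - by apply/measurable_EFinP; apply: measurable_funM => //; exact: (proj1 (measI_pos_rearr fp)).
  - by move=> x Ix; rewrite lee_fin mulr_ge0 ?rearr_ge0 ?w0.
  apply: eq_integral => x /set_mem /I01P[x0 _].
  by rewrite rearrZ// -EFinM mulrCA.
- by move=> f g fp gp; exact: lorentz_triangle.
- by move=> f g fp gp; exact: le_lorentz.
- move=> f_ f fnp fp h; split.
    move=> m n mn; apply: le_lorentz => //.
    by apply: aeI_imp h => x _ [ndx _]; exact: ndx.
  pose g' n (x : R) := (w x * rearr (f_ n) x)%:E.
  have mg' n : measurable_fun I (g' n).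
    by apply/measurable_EFinP; apply: measurable_funM => //; exact: (proj1 (measI_pos_rearr (fnp n))).
  have g'0 n x : I x -> (0 <= g' n x)%E.
    by move=> Ix; rewrite lee_fin mulr_ge0 ?rearr_ge0 ?w0.
  have ndg' x : I x -> {homo g'^~ x : n m / (n <= m)%N >-> (n <= m)%E}.
    move=> Ix n m nm; have /I01P[x0 _] := Ix.
    by rewrite lee_fin ler_wpM2l ?w0//; exact: (rearr_fatou fnp fp h x0).1.
  have := @cvg_monotone_convergence _ _ _ mu I mI g' mg' g'0 ndg'.
  suff -> : (\int[mu]_(x in I) (fun x => limn (g'^~ x)) x)%E = lorentz w f by [].
  apply: eq_integral => x /set_mem /I01P[x0 _].
  apply: cvg_lim => //; apply: cvg_EFin; first exact: nearW.
  apply: cvgMl_tmp; exact: (rearr_fatou fnp fp h x0).2.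
- apply: le_lt_trans wfin; apply: le_integral_ge0 => x Ix.
    by rewrite lee_fin mulr_ge0 ?rearr_ge0 ?w0.
  rewrite lee_fin ler_piMr ?w0//; have /I01P[x0 _] := Ix; apply: rearr_bounded => //.
    by split => //; exact: measurable_indic.
  by apply: aeI_all => y _; rewrite indicE; case: (_ \in _).
- by exists c^-1; [rewrite invr_gt0|move=> f; exact: lorentz_L1].
- by move=> f fp; rewrite /lorentz rearr_idem.
Qed.

End lorentz_norm.

(** * The Hardy operator on integrable functions *)

Section hardy_operator.
Context {R : realType}.
Implicit Types f g w : R -> R.
Local Notation mu := (@lebesgue_measure R).
Local Notation I := (I01 R).

Lemma ge0_ler_powR_neg (a b c : R) : 0 < a -> a <= b -> c <= 0 -> b `^ c <= a `^ c.
Proof.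
move=> a0 ab c0; rewrite -(opprK c) !(powRN _ (- c)).
rewrite lef_pV2 ?posrE ?powR_gt0//; last exact: lt_le_trans ab.
by apply: ge0_ler_powR; rewrite ?nnegrE ?oppr_ge0// ltW// (lt_le_trans a0).
Qed.

Context (alpha beta : R).
Context (alpha_gt0 : 0 < alpha) (alpha_lt1 : alpha < 1) (beta_gt0 : 0 < beta).
Local Notation H := (Hop alpha beta).

Definition in_L1 f := (\int[mu]_(x in I) (`|f x|)%:E < +oo)%E.

Lemma powR_I01 (x c : R) : 0 < c -> I x -> I (x `^ c).
Proof.
move=> c0 /I01P[x0 x1]; apply/I01P; split; first exact: powR_gt0.
have : x `^ c < 1 `^ c by apply: gt0_ltr_powR => //; rewrite ?nnegrE ?ler01// ltW.
by rewrite powR1.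
Qed.

Lemma powRVK (x c : R) : 0 < c -> 0 <= x -> (x `^ c) `^ (1 / c) = x.
Proof. by move=> c0 x0; rewrite -powRrM mulrC mul1r mulVf ?gt_eqF// powRr1. Qed.

Lemma powRKV (x c : R) : 0 < c -> 0 <= x -> (x `^ (1 / c)) `^ c = x.
Proof. by move=> c0 x0; rewrite -powRrM mul1r mulVf ?gt_eqF// powRr1. Qed.

Lemma sub_I01 (a : R) : 0 <= a -> `]a, 1[%classic `<=` I.
Proof.
move=> a0 x /=; rewrite in_itv/= => /andP[ax x1]; apply/I01P; split => //.
exact: le_lt_trans ax.
Qed.

Lemma measI_kernel f : measI f -> measI (fun s => f s * s `^ (alpha - 1)).
Proof.
move=> mf; apply: measurable_funM => //.
by apply: measurable_funTS; exact: measurable_powR.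
Qed.

(** Away from the origin the power weight is bounded, so that integrability of [f] suffices. *)
Lemma Hop_integrable f (a : R) : measI f -> in_L1 f -> 0 < a ->
  mu.-integrable `]a, 1[%classic (EFin \o (fun s => f s * s `^ (alpha - 1))).
Proof.
move=> mf f1 a0; have mI : measurable I by exact: measurable_I01.
have sub := sub_I01 (ltW a0).
apply/integrableP; split.
  apply/measurable_EFinP; exact: measurable_funS (measI_kernel mf).
apply: (@le_lt_trans _ _ ((a `^ (alpha - 1))%:E * \int[mu]_(x in I) (`|f x|)%:E)%E).
  rewrite -ge0_integralZl_EFin ?powR_ge0//; last first.
    by apply/measurable_EFinP; exact: measurableT_comp.
  apply: (@le_trans _ _ (\int[mu]_(x in `]a, 1%R[%classic) ((a `^ (alpha - 1))%:E * (`|f x|)%:E))%E).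
    apply: le_integral_ge0 => x; rewrite /= in_itv/= => /andP[ax _]; first by rewrite lee_fin.
    rewrite -EFinM lee_fin normrM mulrC ler_wpM2r// ger0_norm ?powR_ge0//.
    by apply: ge0_ler_powR_neg => //; rewrite ?subr_le0 ltW.
  apply: ge0_subset_integral => //.
  - apply: emeasurable_funM => //; apply/measurable_EFinP; exact: measurableT_comp.
  - by move=> x _; rewrite -EFinM lee_fin mulr_ge0// powR_ge0.
by rewrite lte_mul_pinfty ?lee_fin ?powR_ge0.
Qed.

(** The operator is defined by a real-valued integral; this transfers it to the extended reals, where
Tonelli and monotonicity apply. *)
Lemma HopE f (x : R) : measI f -> in_L1 f -> I x ->
  ((H f x)%:E = \int[mu]_(s in `](x `^ beta)%R, 1%R[%classic) (f s * s `^ (alpha - 1))%:E)%E.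
Proof.
move=> mf f1 Ix; rewrite /Hop /Rintegral fineK//.
have /I01P[a0 _] := powR_I01 beta_gt0 Ix.
exact: integrable_fin_num (Hop_integrable mf f1 a0).
Qed.

Lemma Hop_ge0 f (x : R) : measI_pos f -> I x -> 0 <= H f x.
Proof.
move=> fp Ix; apply: fine_ge0; apply: integral_ge0 => s /= hs.
rewrite lee_fin mulr_ge0 ?powR_ge0//; apply: fp.2; apply: sub_I01 hs.
exact: powR_ge0.
Qed.

Lemma in_L1_ge0 f : measI_pos f -> in_L1 f <-> (\int[mu]_(x in I) (f x)%:E < +oo)%E.
Proof.
move=> [mf f0]; rewrite /in_L1; under eq_integral => x /set_mem/f0 fx do rewrite ger0_norm//.
by [].
Qed.

Lemma Hop_nonincreasing f (x y : R) : measI_pos f -> in_L1 f -> I x -> I y ->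
  x <= y -> H f y <= H f x.
Proof.
move=> fp f1 Ix Iy xy; have mf := proj1 fp.
rewrite -lee_fin (HopE mf f1 Iy) (HopE mf f1 Ix).
have mI : measurable I by exact: measurable_I01.
have sub := sub_I01 (powR_ge0 x beta).
apply: ge0_subset_integral => //.
- by apply/measurable_EFinP; exact: measurable_funS (measI_kernel mf).
- by move=> s /sub Is; rewrite lee_fin mulr_ge0 ?powR_ge0// fp.2.
- move=> s; rewrite /= !in_itv/= => /andP[ys ->]; rewrite andbT.
  apply: le_lt_trans ys; apply: ge0_ler_powR => //; rewrite ?nnegrE ltW//.
    by case/I01P: Ix.
  by case/I01P: Iy.
Qed.

Lemma measI_pos_Hop f : measI_pos f -> in_L1 f -> measI_pos (H f).
Proof.
move=> fp f1; split; last by move=> x; exact: Hop_ge0.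
apply: nonincreasing_on_measurable; first exact: is_interval_I01.
by move=> x y Ix Iy; exact: Hop_nonincreasing.
Qed.

Lemma HopB f g (x : R) : measI f -> measI g -> in_L1 f -> in_L1 g -> I x ->
  H (fun x => f x - g x) x = H f x - H g x.
Proof.
move=> mf mg f1 g1 Ix; have /I01P[a0 _] := powR_I01 beta_gt0 Ix.
rewrite /Hop -RintegralB//; [|exact: Hop_integrable..].
by apply: eq_Rintegral => s _; rewrite mulrBl.
Qed.

Definition pospart f (x : R) := Num.max (f x) 0.

Lemma measI_pospart f : measI f -> measI_pos (pospart f).
Proof.
move=> mf; split; last by move=> x _; rewrite le_max lexx orbT.
exact: measurable_maxr.
Qed.

Lemma in_L1_le f g : measI g -> (forall x, I x -> `|f x| <= `|g x|) -> in_L1 g -> in_L1 f.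
Proof.
by move=> mg fg; apply: le_lt_trans; apply: le_integral_ge0 => x Ix; rewrite lee_fin ?fg.
Qed.

(** Both parts of [f] have a measurable, because monotone, image; this gives measurability of [H f] and
the pointwise bound by the image of the absolute value. *)
Lemma Hop_norm f : measI f -> in_L1 f ->
  measI_pos (fun x => `|H f x|) /\
  (forall x, I x -> `|H f x| <= H (fun x => `|f x|) x).
Proof.
move=> mf f1.
pose g x := pospart f x; pose h x := pospart (fun x => - f x) x.
have mNf : measI (fun x => - f x) by exact: measurableT_comp.
have gp : measI_pos g := measI_pospart mf.
have hp : measI_pos h := measI_pospart mNf.
have g1 : in_L1 g.
  apply: in_L1_le mf _ f1 => x Ix; rewrite /g /pospart.
  by case: (leP (f x) 0) => // _; rewrite normr0.
have h1 : in_L1 h.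
  apply: in_L1_le mf _ f1 => x Ix; rewrite /h /pospart.
  by case: (leP (- f x) 0) => // _; rewrite ?normrN// normr0.
have fE : f = fun x => g x - h x.
  apply/funext => x; rewrite /g /h /pospart.
  by case: (leP (f x) 0) => fx; case: (leP (- f x) 0) => fx'; lra.
have nE : (fun x => `|f x|) = fun x => g x - (- h x).
  apply/funext => x; rewrite /g /h /pospart.
  by case: (leP (f x) 0) => fx; case: (leP (- f x) 0) => fx';
    rewrite ?(ler0_norm fx) ?(gtr0_norm fx); lra.
have HE x : I x -> H f x = H g x - H h x.
  by move=> Ix; rewrite {1}fE HopB//; [exact: gp.1|exact: hp.1].
have mHg := measI_pos_Hop gp g1; have mHh := measI_pos_Hop hp h1.
split.
  split; last by [].
  apply: measurableT_comp => //; apply: (eq_measurable_fun (fun x => H g x - H h x)).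
    by move=> x /set_mem/HE.
  apply: measurable_funB; [exact: mHg.1|exact: mHh.1].
move=> x Ix; rewrite HE// nE HopB//; last 3 first.
- exact: gp.1.
- by apply: measurableT_comp => //; exact: hp.1.
- by apply: in_L1_le hp.1 _ h1 => y _; rewrite normrN.
have -> : H (fun x => - h x) x = - H h x.
  have -> : (fun x => - h x) = fun x => 0 - h x by apply/funext => y; rewrite sub0r.
  have z1 : in_L1 (fun=> 0 : R).
    by rewrite /in_L1 integral0_eq// => y _; rewrite normr0.
  have mz : measI (fun=> 0 : R) by exact: measurable_cst.
  rewrite (HopB mz hp.1 z1 h1 Ix) [X in X - _](_ : _ = 0) ?sub0r//.
  by rewrite /Hop /Rintegral integral0_eq// => y _; rewrite mul0r.
rewrite opprK; have := mHg.2 x Ix; have := mHh.2 x Ix => a b.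
by rewrite ler_norml; lra.
Qed.

End hardy_operator.

(** * The Marcinkiewicz norm of a Hardy transform *)

Section hardy_marcinkiewicz.
Context {R : realType}.
Implicit Types f g w : R -> R.
Local Notation mu := (@lebesgue_measure R).
Local Notation I := (I01 R).
Context (alpha beta : R).
Context (alpha_gt0 : 0 < alpha) (alpha_lt1 : alpha < 1) (beta_gt0 : 0 < beta).
Local Notation H := (Hop alpha beta).

(** The kernel that represents averages of [H f] over [(0, tau `^ (1 / beta))]. With this parametrization by
[tau] rather than by the right end of the interval, the kernel changes its behaviour at [r = tau]. *)
Definition hardy_kernel (tau r : R) : R :=
  r `^ (alpha - 1) * Num.min 1 ((r / tau) `^ (1 / beta)).

Lemma hardy_kernel_ge0 tau r : 0 <= hardy_kernel tau r.
Proof. by rewrite mulr_ge0 ?powR_ge0// le_min ler01 powR_ge0. Qed.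

Lemma measI_hardy_kernel (tau : R) : measI (hardy_kernel tau).
Proof.
apply: measurable_funM; first by apply: measurable_funTS; exact: measurable_powR.
apply: measurable_minr => //.
apply: (measurableT_comp (f := fun x : R => x `^ (1 / beta))); first exact: measurable_powR.
exact: measurable_funM.
Qed.

Lemma hardy_kernelE (tau r : R) : 0 < tau -> 0 < r ->
  tau `^ (1 / beta) * hardy_kernel tau r = r `^ (alpha - 1) * Num.min (tau `^ (1 / beta)) (r `^ (1 / beta)).
Proof.
move=> tau0 r0; rewrite /hardy_kernel mulrCA; congr (_ * _).
rewrite minr_pMr ?powR_ge0// mulr1 -powRM ?(ltW tau0) ?divr_ge0 ?(ltW r0) ?(ltW tau0)//.
by rewrite [tau * _]mulrC divfK// gt_eqF.
Qed.

(** Tonelli: the point [s] contributes to [H f x] exactly when [x < s `^ (1 / beta)]. *)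
Lemma integral_Hop f (t : R) : measI_pos f -> in_L1 f -> I t ->
  (\int[mu]_(x in `]0%R, t[%classic) (H f x)%:E =
   \int[mu]_(r in I) (f r * (r `^ (alpha - 1) * Num.min t (r `^ (1 / beta))))%:E)%E.
Proof.
move=> fp f1 It; have mI : measurable I by exact: measurable_I01.
have /I01P[t0 t1] := It; have [mf f0] := fp.
pose F (x s : R) := if x `^ beta < s then f s * s `^ (alpha - 1) else 0.
have sub : `]0, t[%classic `<=` I.
  by move=> x /=; rewrite in_itv/= => /andP[x0 xt]; apply/I01P; split => //; exact: lt_trans t1.
transitivity (\int[mu]_(x in `]0%R, t[%classic) \int[mu]_(s in I) (F x s)%:E)%E.
  apply: eq_integral => x /set_mem /sub Ix; rewrite (HopE alpha_lt1 beta_gt0 mf f1 Ix).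
  rewrite integral_mkcond [RHS]integral_mkcond; apply: eq_integral => s _.
  rewrite !patchE /F.
  case: ifPn => [/set_mem|] hs.
    rewrite mem_set; last by apply: sub_I01 hs; exact: powR_ge0.
    by move: hs; rewrite /= in_itv/= => /andP[-> _].
  case: ifPn => // /set_mem /I01P[s0 s1]; case: ifPn => // xs.
  by case/negP: hs; apply/mem_set; rewrite /= in_itv/= xs.
rewrite tonelli_on//.
- apply: eq_integral => s /set_mem Is; have /I01P[s0 s1] := Is.
  set m : R := Num.min t (s `^ (1 / beta)).
  have m0 : 0 <= m by rewrite le_min ltW// powR_ge0.
  transitivity (\int[mu]_(x in `]0%R, m[%classic) (f s * s `^ (alpha - 1))%:E)%E; last first.
    transitivity ((f s * s `^ (alpha - 1))%:E * mu `]0%R, m[%classic)%E.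
      by rewrite -integral_cst.
    by rewrite lebesgue_itv0// -EFinM mulrA.
  rewrite integral_mkcond [RHS]integral_mkcond; apply: eq_integral => x _.
  rewrite !patchE !mem_setE !in_itv/= lt_min.
  case: (ltP 0 x) => x0 //=; case: (ltP x t) => xt //=.
  have xs : (x `^ beta < s) = (x < s `^ (1 / beta)).
    apply/idP/idP => h.
      rewrite -(powRVK beta_gt0 (ltW x0)).
      by apply: gt0_ltr_powR => //; rewrite ?nnegrE ?powR_ge0 ?(ltW s0)// divr_gt0.
    rewrite -[ltRHS](powRKV beta_gt0 (ltW s0)).
    by apply: gt0_ltr_powR => //; rewrite ?nnegrE ?powR_ge0 ?(ltW x0).
  by rewrite /F xs; case: ifP.
- rewrite /F; apply: measurable_fun_if => //.
  + exact: measurableX.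
  + apply: measurable_fun_ltr; last exact: measurable_funS measurable_snd.
    apply: (@measurable_fst_comp _ _ _ _ _ _ _ _ (fun x : R => x `^ beta)) => //.
    by apply: measurable_funTS; exact: measurable_powR.
  + apply: (@measurable_funS _ _ _ _ (`]0, t[%classic `*` I)) => //.
    exact: measurableX.
    have mk := measI_kernel alpha mf.
    exact: (measurable_snd_comp (h := fun s : R => f s * s `^ (alpha - 1))).
- by move=> x s _ Is; rewrite /F; case: ifP => // _; rewrite mulr_ge0 ?powR_ge0 ?f0.
Qed.

Lemma rearr_le_nonincreasing f (s : R) : measI_pos f ->
  (forall x y, I x -> I y -> x <= y -> f y <= f x) -> I s -> rearr f s <= f s.
Proof.
move=> fp nif Is; have /I01P[s0 s1] := Is.
rewrite leNgt; apply/negP; rewrite lt_rearr ?fp.2// ltNge => /negP; apply.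
rewrite -lee_fin -lebesgue_superlevel; last exact: fp.1.
rewrite -(lebesgue_itv0 (ltW s0)); apply: le_lebesgue => //.
  apply: measurable_superlevel; exact: fp.1.
move=> x [Ix /= xs]; rewrite in_itv/=; have /I01P[-> _] := Ix; rewrite /=.
by rewrite ltNge; apply/negP => /(nif _ _ Is Ix); rewrite leNgt xs.
Qed.

Lemma integral_rearr_ge f (t : R) : measI_pos f -> I t ->
  (\int[mu]_(x in `]0%R, t[%classic) (f x)%:E <=
   \int[mu]_(x in `]0%R, t[%classic) (rearr f x)%:E)%E.
Proof.
move=> fp /I01P[t0 t1].
pose w (x : R) : R := if x < t then 1 else 0.
have wp : nonincr_weight w.
  split=> [x _|x y _ _ xy]; rewrite /w; first by case: ifP.
  by case: (ltP y t) => yt; case: (ltP x t) => // tx; move: (le_lt_trans (le_trans tx xy) yt); rewrite ltxx.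
have E g : (\int[mu]_(x in `]0%R, t[%classic) (g x)%:E = \int[mu]_(x in I) (w x * g x)%:E)%E.
  rewrite integral_mkcond [RHS]integral_mkcond; apply: eq_integral => x _.
  rewrite !patchE /I01 !mem_setE !in_itv/= /w.
  case: (ltP 0 x) => x0 //=; case: (ltP x t) => xt //=.
    by rewrite (lt_trans xt t1) mul1r.
  by rewrite mul0r if_same.
by rewrite !E; apply: hardy_littlewood; [|exact: wp.1|exact: wp.2].
Qed.

Context (phi : R -> R) (phi_ge0 : forall t, I t -> 0 <= phi t).
Local Notation M := (marcinkiewicz_norm phi).
Definition psi (tau : R) := phi (tau `^ (1 / beta)).

Lemma average_Hop f (tau : R) : measI_pos f -> in_L1 f -> I tau ->
  (((tau `^ (1 / beta))^-1)%:E * \int[mu]_(x in `]0%R, (tau `^ (1 / beta))%R[%classic) (H f x)%:E =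
   \int[mu]_(r in I) (f r * hardy_kernel tau r)%:E)%E.
Proof.
move=> fp f1 Itau; have mI : measurable I by exact: measurable_I01.
have b0 : 0 < 1 / beta by rewrite divr_gt0.
have It := powR_I01 b0 Itau; have /I01P[t0 t1] := It; have /I01P[tau0 _] := Itau.
rewrite (integral_Hop fp f1 It) -ge0_integralZl_EFin//; first last.
- by rewrite invr_ge0 ltW.
- apply/measurable_EFinP; apply: measurable_funM; first exact: fp.1.
  apply: measurable_funM; first by apply: measurable_funTS; exact: measurable_powR.
  by apply: measurable_minr => //; apply: measurable_funTS; exact: measurable_powR.
- move=> r Ir; rewrite lee_fin mulr_ge0 ?fp.2//.
  by rewrite mulr_ge0 ?powR_ge0// le_min !powR_ge0.
apply: eq_integral => r /set_mem /I01P[r0 r1]; rewrite -EFinM; congr EFin.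
by rewrite -hardy_kernelE// mulrCA mulKf// gt_eqF.
Qed.

Lemma marcinkiewicz_Hop_ge f (tau : R) : measI_pos f -> in_L1 f -> I tau ->
  ((psi tau)%:E * \int[mu]_(r in I) (f r * hardy_kernel tau r)%:E <=
   M (fun x => `|H f x|%R))%E.
Proof.
move=> fp f1 Itau; have b0 : 0 < 1 / beta by rewrite divr_gt0.
have It := powR_I01 b0 Itau; have /I01P[t0 t1] := It.
have Hp := measI_pos_Hop alpha_lt1 beta_gt0 fp f1.
rewrite -average_Hop//; set t := tau `^ _ in It t0 t1 *.
apply: (@le_trans _ _ (rearr_avg (fun x => `|H f x|%R) t * (phi t)%:E)%E); last first.
  by apply: ereal_sup_ubound; exists t.
rewrite muleC /psi -/t; apply: lee_wpmul2r; first by rewrite lee_fin phi_ge0.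
rewrite /rearr_avg; apply: lee_wpmul2l; first by rewrite lee_fin invr_ge0 ltW.
apply: (le_trans (integral_rearr_ge Hp It)); rewrite le_eqVlt; apply/orP; left; apply/eqP.
apply: eq_integral => x _; congr EFin.
rewrite (_ : rearr (fun x => `|H f x|) = rearr (H f))//; apply: eq_rearr => //.
  split; last by [].
  by apply: measurableT_comp => //; exact: Hp.1.
move=> l l0; rewrite /distr; congr (fine (mu _)).
by apply/seteqP; split => y [Iy /= h]; split => //=; move: h;
  rewrite ger0_norm// Hp.2.
Qed.

(** Passing to the absolute value of [f] makes the majorant nonincreasing, so that it dominates its own
rearrangement. *)
Lemma marcinkiewicz_Hop_le f (D : R) : measI f -> in_L1 f ->
  (forall tau, I tau ->
    (psi tau)%:E * \int[mu]_(r in I) (`|f r| * hardy_kernel tau r)%:E <= D%:E)%E ->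
  (M (fun x => `|H f x|%R) <= D%:E)%E.
Proof.
move=> mf f1 hD; have [nHp nH] := Hop_norm alpha_lt1 beta_gt0 mf f1.
have fp : measI_pos (fun x => `|f x|) by split => //; exact: measurableT_comp.
have nf1 : in_L1 (fun x => `|f x|).
  by rewrite /in_L1; under eq_integral do rewrite normr_id.
have Hp := measI_pos_Hop alpha_lt1 beta_gt0 fp nf1.
apply: ge_ereal_sup => _ [t It <-]; have Itau := powR_I01 beta_gt0 It.
have /I01P[t0 t1] := It.
apply: le_trans (hD _ Itau); rewrite -average_Hop// /psi powRVK ?(ltW t0)//.
rewrite muleC; apply: lee_wpmul2l; first by rewrite lee_fin phi_ge0.
rewrite /rearr_avg; apply: lee_wpmul2l; first by rewrite lee_fin invr_ge0 ltW.
apply: le_integral_ge0 => x /=; rewrite in_itv/= => /andP[x0 xt]; first by rewrite lee_fin rearr_ge0.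
have Ix : I x by apply/I01P; split => //; exact: lt_trans t1.
rewrite lee_fin; apply: (@le_trans _ _ (rearr (H (fun x => `|f x|)) x)).
  by apply: le_rearr => //; apply: aeI_all.
exact: (rearr_le_nonincreasing Hp (fun y z Iy Iz yz =>
  Hop_nonincreasing alpha_lt1 beta_gt0 fp nf1 Iy Iz yz) Ix).
Qed.

End hardy_marcinkiewicz.

(** * Integrals of powers *)

Section power_integral.
Context {R : realType}.
Local Notation mu := (@lebesgue_measure R).

Lemma powR_continuous_at (a x : R) : 0 < x -> y `^ a @[y --> x] --> x `^ a.
Proof.
move=> x0; apply: (@differentiable_continuous _ _ _ x (fun y : R => y `^ a)); apply/derivable1_diffP.
by apply: derivable_powR; rewrite in_itv/= x0.
Qed.

Lemma powR_derivable_LR (a e t : R) : 0 < e -> e < t ->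
  derivable_oo_LRcontinuous (fun x : R => x `^ a) e t.
Proof.
move=> e0 et; split.
- move=> x; rewrite in_itv/= => /andP[ex _]; apply: derivable_powR.
  by rewrite in_itv/= (lt_trans e0 ex).
- by apply: cvg_at_right_filter; exact: (@powR_continuous_at a e e0).
- by apply: cvg_at_left_filter; exact: (@powR_continuous_at a t (lt_trans e0 et)).
Qed.

Lemma integral_powR_le (a e t : R) : 0 < a -> 0 < e -> e < t ->
  (\int[mu]_(s in `[e, t]%classic) (s `^ (a - 1))%:E <= (t `^ a / a)%:E)%E.
Proof.
move=> a0 e0 et.
rewrite (@continuous_FTC2 _ _ (fun x => a^-1 * x `^ a))//.
- rewrite -EFinB lee_fin mulrC gerBl//.
  by rewrite mulr_ge0 ?powR_ge0// invr_ge0 ltW.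
- apply: continuous_in_subspaceT => x /set_mem; rewrite /= in_itv/= => /andP[ex _].
  by apply: powR_continuous_at; exact: lt_le_trans ex.
- have [d l r] := powR_derivable_LR a e0 et; split.
  + by move=> x /d dx; exact: derivableZ.
  + exact: cvgMl_tmp.
  + exact: cvgMl_tmp.
- move=> x; rewrite in_itv/= => /andP[ex _]; have x0 := lt_trans e0 ex.
  rewrite derive1E; apply: derive_val.
  have := is_deriveZ (a^-1) (is_derive1_powR a x0).
  by rewrite /GRing.scale/= mulKf// gt_eqF.
Qed.

Lemma integral_powR0_le (a t : R) : 0 < a -> 0 < t ->
  (\int[mu]_(s in `]0%R, t[%classic) (s `^ (a - 1))%:E <= (t `^ a / a)%:E)%E.
Proof.
move=> a0 t0.
pose F (n : nat) : set R := `[t / n.+2%:R, t]%classic.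
have tn n : 0 < t / n.+2%:R by rewrite divr_gt0.
have mp (D : set R) : measurable_fun D (fun s : R => (s `^ (a - 1))%:E).
  by apply: measurable_funTS; apply/measurable_EFinP; exact: measurable_powR.
have ndF : {homo F : n m / (n <= m)%N >-> (n <= m)%O}.
  move=> n m nm; rewrite subsetEset => x; rewrite /F /= !in_itv/= => /andP[h ->].
  by rewrite andbT (le_trans _ h)// ler_pM2l// lef_pV2 ?posrE// ler_nat.
have mF n : measurable (F n) by exact: measurable_itv.
have := @ge0_nondecreasing_set_cvg_integral _ (measurableTypeR R) R F (fun s : R => (s `^ (a - 1))%:E) mu
  ndF mF (fun n => mp _) (fun n x _ => ltac:(by rewrite lee_fin powR_ge0)).
move=> cF; apply: (@le_trans _ _ (\int[mu]_(x in \bigcup_i F i) (x `^ (a - 1))%:E)%E).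
  apply: ge0_subset_integral => //.
  - by apply: bigcup_measurable => n _; exact: mF.
  - exact: mp.
  - by move=> x _; rewrite lee_fin powR_ge0.
  move=> x; rewrite /= in_itv/= => /andP[x0 xt].
  have [n /= nx] := ltr_add_invr (divr_gt0 x0 t0); rewrite add0r in nx.
  exists n => //; rewrite /F /= in_itv/= (ltW xt) andbT.
  rewrite ler_pdivrMr// mulrC -ler_pdivrMr// -[t / x]invf_div invf_ple ?posrE// ?divr_gt0//.
  apply: ltW; apply: le_lt_trans nx; rewrite lef_pV2 ?posrE// ler_nat//.
have := cvg_lim (@ereal_hausdorff R) cF => <-.
apply: lime_le; first by apply/cvg_ex; eexists; exact: cF.
apply: nearW => n; apply: integral_powR_le => //.
by rewrite ltr_pdivrMr// ltr_pMr// ltr1n.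
Qed.

End power_integral.

(** * The weight of the optimal domain *)

Section weight.
Context {R : realType}.
Local Notation mu := (@lebesgue_measure R).
Local Notation I := (I01 R).
Context (alpha beta : R).
Context (alpha_gt0 : 0 < alpha) (alpha_lt1 : alpha < 1) (beta_gt0 : 0 < beta)
  (alpha_beta : 1 <= alpha + 1 / beta).
Context (phi : R -> R) (fund_phi : concave_fundamental phi).
Local Notation psi := (psi beta phi).
Local Notation K := (hardy_kernel alpha beta).

Lemma ler_powR_base (c x y : R) : 0 <= c -> 0 <= x -> x <= y -> x `^ c <= y `^ c.
Proof. by move=> c0 x0 xy; apply: ge0_ler_powR; rewrite ?nnegrE// (le_trans x0). Qed.

Let invbeta_ge0 : 0 <= 1 / beta. Proof. by rewrite divr_ge0// ltW. Qed.

Lemma I01_half : I (1 / 2 : R).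
Proof. by apply/I01P; split; lra. Qed.

Lemma mem_I01_itv0 (t : R) : I t -> `[0, 1[%classic t.
Proof. by move=> /I01P[t0 t1]; rewrite /= in_itv/= ltW. Qed.

Lemma fund_ge0 (t : R) : I t -> 0 <= phi t.
Proof. by move=> /mem_I01_itv0 It; case: fund_phi => _ h _ _; exact: h. Qed.

Lemma fund_gt0 (t : R) : I t -> 0 < phi t.
Proof.
move=> It; rewrite lt_neqAle fund_ge0// andbT eq_sym; apply/eqP.
have /I01P[t0 _] := It; have := mem_I01_itv0 It; case: fund_phi => _ _ _ h /h[p _] /p t00.
by move: t0; rewrite t00 ltxx.
Qed.

Lemma fund_nondecreasing (s t : R) : I s -> I t -> s <= t -> phi s <= phi t.
Proof.
by move=> /mem_I01_itv0 Is /mem_I01_itv0 It; case: fund_phi => _ _ h _; exact: h.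
Qed.

(** Concavity on [(0, t)] with [phi 0 >= 0] gives [phi t / t] at most [phi (1/2) / (1/2)] for [t >= 1/2]. *)
Lemma fund_bounded (t : R) : I t -> phi t <= 2 * phi (1 / 2).
Proof.
move=> It; have /I01P[t0 t1] := It; have h0 := fund_ge0 I01_half.
have [th|th] := leP t (1 / 2).
  by have := fund_nondecreasing It I01_half th; lra.
have [cvx ge0 _ _] := fund_phi.
have l01 : 0 <= (2 * t)^-1 <= 1.
  by apply/andP; split; [rewrite invr_ge0; lra|rewrite invf_le1; lra].
have d0 : (`[0, 1[%classic : set R) 0 by rewrite /= in_itv/= lexx ltr01.
have := cvx (Itv01 (andP l01).1 (andP l01).2) t 0 (mem_set (mem_I01_itv0 It)) (mem_set d0).
rewrite !convRE/=.
have -> : conv (Itv01 (andP l01).1 (andP l01).2) (t : convex_lmodType R^o) 0 = 1 / 2.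
  transitivity ((2 * t)^-1 * t + (1 - (2 * t)^-1) * 0); first by [].
  by rewrite mulr0 addr0 invfM -mulrA mulVf ?gt_eqF// mulr1 div1r.
have f0 := ge0 0 d0.
have : 0 <= (1 - (2 * t)^-1) * phi 0 by rewrite mulr_ge0// subr_ge0; case/andP: l01.
set a := phi 0 in f0 *; set b := phi t; set c := phi (1 / 2); set l := _^-1.
rewrite /unstable.onem => h1 h2.
have h3 : l * b <= c by lra.
have l0 : 0 < l by rewrite invr_gt0; lra.
rewrite -(ler_pM2l l0); apply: (le_trans h3).
have h : 1 <= l * 2 by rewrite /l invfM mulrAC mulVf ?pnatr_eq0// mul1r invf_ge1 ?ltW.
by rewrite mulrA ler_peMl.
Qed.

Let bI (tau : R) : I tau -> I (tau `^ (1 / beta)).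
Proof. by apply: powR_I01; rewrite divr_gt0. Qed.

Lemma psi_gt0 (tau : R) : I tau -> 0 < psi tau.
Proof. by move=> /bI; exact: fund_gt0. Qed.

Lemma psi_ge0 (tau : R) : I tau -> 0 <= psi tau.
Proof. by move=> /psi_gt0/ltW. Qed.

Lemma psi_bounded (tau : R) : I tau -> psi tau <= 2 * phi (1 / 2).
Proof. by move=> /bI; exact: fund_bounded. Qed.

Lemma psi_nondecreasing (s t : R) : I s -> I t -> s <= t -> psi s <= psi t.
Proof.
move=> Is It st; apply: fund_nondecreasing; [exact: bI..|].
have /I01P[s0 _] := Is; have /I01P[t0 _] := It.
by apply: ler_powR_base => //; exact: ltW.
Qed.

(** The least nonincreasing majorant of the function whose supremum is taken. It is a weight for which the
Lorentz functional is a norm, and [t * theta t] turns out to be the fundamental function of the largest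
domain, up to constants. *)
Definition theta (tau : R) : R :=
  sup [set psi sigma * sigma `^ (alpha - 1) | sigma in `[tau, 1[%classic].

Lemma I01_ge (tau sigma : R) : I tau -> `[tau, 1[%classic sigma -> I sigma.
Proof.
move=> /I01P[t0 _]; rewrite /= in_itv/= => /andP[ts s1]; apply/I01P; split => //.
exact: lt_le_trans ts.
Qed.

Lemma theta_bound (tau sigma : R) : I tau -> `[tau, 1[%classic sigma ->
  psi sigma * sigma `^ (alpha - 1) <= 2 * phi (1 / 2) * tau `^ (alpha - 1).
Proof.
move=> It hs; have Is := I01_ge It hs; have /I01P[t0 _] := It.
apply: ler_pM; rewrite ?powR_ge0 ?psi_bounded ?psi_ge0//.
move: hs; rewrite /= in_itv/= => /andP[ts _].
by apply: ge0_ler_powR_neg => //; rewrite subr_le0 ltW.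
Qed.

Lemma theta_ub (tau sigma : R) : I tau -> I sigma -> tau <= sigma ->
  psi sigma * sigma `^ (alpha - 1) <= theta tau.
Proof.
move=> It Is ts; have /I01P[_ s1] := Is; apply: ub_le_sup; last first.
  by exists sigma => //; rewrite /= in_itv/= ts.
by exists (2 * phi (1 / 2) * tau `^ (alpha - 1)) => _ [z hz <-]; exact: theta_bound.
Qed.

Let itv_refl (tau : R) : I tau -> `[tau, 1[%classic tau.
Proof. by move=> /I01P[_ t1]; rewrite /= in_itv/= lexx. Qed.

Lemma theta_le (tau c : R) : I tau ->
  (forall sigma, I sigma -> tau <= sigma -> psi sigma * sigma `^ (alpha - 1) <= c) ->
  theta tau <= c.
Proof.
move=> It h; apply: ge_sup.
  by exists (psi tau * tau `^ (alpha - 1)); exists tau => //; exact: itv_refl.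
move=> _ [s hs <-]; apply: h; first exact: I01_ge hs.
by move: hs; rewrite /= in_itv/= => /andP[].
Qed.

Lemma theta_gt0 (tau : R) : I tau -> 0 < theta tau.
Proof.
move=> It; apply: lt_le_trans (theta_ub It It (lexx _)).
by rewrite mulr_gt0 ?psi_gt0// powR_gt0//; case/I01P: It.
Qed.

Lemma theta_nonincreasing (s t : R) : I s -> I t -> s <= t -> theta t <= theta s.
Proof.
move=> Is It st; apply: theta_le => // z Iz tz; apply: theta_ub => //.
exact: le_trans tz.
Qed.

Lemma nonincr_weight_theta : nonincr_weight theta.
Proof.
by split=> [x /theta_gt0/ltW//|x y Ix Iy]; exact: theta_nonincreasing.
Qed.

Lemma theta_le_powR (tau : R) : I tau -> theta tau <= 2 * phi (1 / 2) * tau `^ (alpha - 1).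
Proof.
move=> It; apply: theta_le => // s Is ts; apply: theta_bound => //.
by rewrite /= in_itv/= ts; case/I01P: Is.
Qed.

Lemma theta_ge_half (tau : R) : I tau -> psi (1 / 2) <= theta tau.
Proof.
move=> It; have key z : I z -> 1 <= z `^ (alpha - 1).
  move=> /I01P[z0 z1]; have := @ge0_ler_powR_neg _ z 1 (alpha - 1) z0 (ltW z1).
  by rewrite powR1; apply; rewrite subr_le0 ltW.
have [th|th] := leP tau (1 / 2).
  apply: le_trans (theta_ub It I01_half th).
  by apply: ler_peMr; [apply: psi_ge0|apply: key]; exact: I01_half.
apply: le_trans (theta_ub It It (lexx _)).
apply: (@le_trans _ _ (psi tau)); first exact: psi_nondecreasing I01_half It (ltW th).
by apply: ler_peMr; [exact: psi_ge0|exact: key].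
Qed.

Lemma mul_powRB1 (s : R) : 0 < s -> s * s `^ (alpha - 1) = s `^ alpha.
Proof. by move=> s0; apply: mulr_powRB1 => //; exact: ltW. Qed.

(** With the monotonicity of [theta] this says that [theta] at most doubles when its argument is halved.
For [sigma] in [(s, t)] one uses that [psi] and [sigma `^ alpha] are nondecreasing. *)
Lemma mul_theta_nondecreasing (s t : R) : I s -> I t -> s <= t ->
  s * theta s <= t * theta t.
Proof.
move=> Is It st; have /I01P[s0 s1] := Is; have /I01P[t0 t1] := It.
rewrite -ler_pdivlMl//; apply: theta_le => // z Iz sz; have /I01P[z0 z1] := Iz.
rewrite ler_pdivlMl//.
have [zt|tz] := leP z t; last first.
  apply: ler_pM => //; rewrite ?(ltW s0) ?mulr_ge0 ?psi_ge0 ?powR_ge0//.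
  exact: theta_ub It Iz (ltW tz).
apply: (@le_trans _ _ (t * (psi t * t `^ (alpha - 1)))); last first.
  by rewrite ler_pM2l// theta_ub.
rewrite !(mulrCA _ (psi _)); apply: ler_pM => //.
- by rewrite ltW// psi_gt0.
- by rewrite mulr_ge0 ?powR_ge0// ltW.
- exact: psi_nondecreasing.
- apply: (@le_trans _ _ (z * z `^ (alpha - 1))); first by rewrite ler_wpM2r ?powR_ge0.
  by rewrite !mul_powRB1//; apply: ler_powR_base => //; exact: ltW.
Qed.

Lemma hardy_kernel_le_powR (sigma s : R) : K sigma s <= s `^ (alpha - 1).
Proof. by rewrite /hardy_kernel ler_piMr ?powR_ge0// ge_min lexx. Qed.

Lemma hardy_kernel_eq_powR (sigma s : R) : 0 < sigma -> sigma <= s ->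
  K sigma s = s `^ (alpha - 1).
Proof.
move=> s0 ss; rewrite /hardy_kernel (min_idPl _) ?mulr1//.
rewrite -[leLHS](_ : 1 `^ (1 / beta) = _); last by rewrite powR1.
by apply: ler_powR_base => //; rewrite ler_pdivlMr ?mul1r.
Qed.

(** To the left of [sigma] the kernel is a multiple of [s `^ (alpha - 1 + 1 / beta)], which is nondecreasing by
the assumption on the exponents. *)
Lemma hardy_kernel_le (sigma s : R) : 0 < s -> s <= sigma ->
  K sigma s <= sigma `^ (alpha - 1).
Proof.
move=> s0 ss; have sg0 := lt_le_trans s0 ss.
apply: (@le_trans _ _ (s `^ (alpha - 1) * (s / sigma) `^ (1 / beta))).
  by rewrite /hardy_kernel ler_wpM2l ?powR_ge0// ge_min lexx orbT.
have q0 : 0 <= s / sigma by rewrite divr_ge0// ltW.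
have sE : s = sigma * (s / sigma) by rewrite mulrC divfK// gt_eqF.
rewrite {1}sE powRM ?(ltW sg0)// -mulrA ler_piMr ?powR_ge0// -powRD; last first.
  by apply/implyP => _; rewrite gt_eqF// divr_gt0.
rewrite -[leRHS](powRr0 (s / sigma)).
apply: ger_powR; first by rewrite divr_gt0//= ler_pdivrMr// mul1r.
by move: alpha_beta; set b := 1 / beta => ?; lra.
Qed.

Lemma hardy_kernel_ge (sigma s : R) : 0 < sigma -> sigma / 2 <= s -> s <= sigma ->
  2^-1 `^ (1 / beta) * sigma `^ (alpha - 1) <= K sigma s.
Proof.
move=> sg0 hs ss; have s0 : 0 < s by lra.
rewrite mulrC /hardy_kernel; apply: ler_pM; rewrite ?powR_ge0//.
  by apply: ge0_ler_powR_neg => //; rewrite subr_le0 ltW.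
have p0 (a b : R) : 0 <= a -> a <= b -> a `^ (1 / beta) <= b `^ (1 / beta).
  by move=> a0 ab; exact: ler_powR_base.
rewrite le_min; apply/andP; split.
  by have := p0 2^-1 1; rewrite powR1; apply; lra.
by apply: p0; [lra|rewrite ler_pdivlMr// mulrC].
Qed.

(** Left of [sigma] the kernel is at most [sigma `^ (alpha - 1)], and [sigma] competes in the supremum
defining [theta s]; right of [sigma] the point [s] itself does, as [psi] is nondecreasing. *)
Lemma psi_hardy_kernel_le_theta (sigma s : R) : I sigma -> I s ->
  psi sigma * K sigma s <= theta s.
Proof.
move=> Isg Is; have /I01P[s0 _] := Is.
have [ss|ss] := leP s sigma.
  apply: le_trans (theta_ub Is Isg ss).
  by rewrite ler_wpM2l ?hardy_kernel_le// ltW// psi_gt0.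
apply: le_trans (theta_ub Is Is (lexx _)).
apply: ler_pM; rewrite ?hardy_kernel_ge0 ?hardy_kernel_le_powR ?psi_ge0//.
exact: psi_nondecreasing (ltW ss).
Qed.

(** For [s < t] split the supremum defining [theta s] at [t]: the points beyond [t] contribute at most
[theta t], those before it at most [psi t * s `^ (alpha - 1)], which is integrable near the origin. *)
Lemma integral_theta_le (t : R) : I t ->
  (\int[mu]_(s in `]0%R, t[%classic) (theta s)%:E <= ((1 + alpha^-1) * (t * theta t))%:E)%E.
Proof.
move=> It; have /I01P[t0 t1] := It; have pt := psi_gt0 It; have tht := theta_gt0 It.
apply: (@le_trans _ _ (\int[mu]_(s in `]0%R, t[%classic) ((theta t)%:E + (psi t)%:E * (s `^ (alpha - 1))%:E))%E).
  apply: le_integral_ge0 => s; rewrite /= in_itv/= => /andP[s0 st].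
    by rewrite lee_fin ltW// theta_gt0//; apply/I01P; split => //; exact: lt_trans t1.
  have Is : I s by apply/I01P; split => //; exact: lt_trans t1.
  rewrite -EFinM -EFinD lee_fin; apply: theta_le => // z Iz sz.
  have [zt|tz] := leP z t; last first.
    by rewrite (le_trans (theta_ub It Iz (ltW tz)))// lerDl mulr_ge0 ?powR_ge0// ltW.
  rewrite -[leLHS]add0r; apply: lerD; first exact: ltW.
  apply: ler_pM; rewrite ?powR_ge0 ?psi_nondecreasing ?psi_ge0//.
  by apply: ge0_ler_powR_neg => //; rewrite subr_le0 ltW.
have mp : measurable_fun `]0, t[%classic (fun s : R => (s `^ (alpha - 1))%:E).
  by apply: measurable_funTS; apply/measurable_EFinP; exact: measurable_powR.
rewrite ge0_integralD//; first last.
- by apply: emeasurable_funM.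
- by move=> x _; rewrite -EFinM lee_fin mulr_ge0 ?powR_ge0// ltW.
- by move=> x _; rewrite lee_fin ltW.
rewrite ge0_integralZl_EFin//; first last.
- exact: ltW.
- by move=> x _; rewrite lee_fin powR_ge0.
apply: (@le_trans _ _ ((theta t)%:E * t%:E + (psi t)%:E * (t `^ alpha / alpha)%:E)%E).
  apply: leeD; last by apply: lee_wpmul2l; [rewrite lee_fin ltW|exact: integral_powR0_le].
  by rewrite -(lebesgue_itv0 (ltW t0)) -integral_cst.
rewrite -!EFinM -EFinD lee_fin.
have h : psi t * t `^ alpha <= t * theta t.
  by rewrite -mul_powRB1// mulrCA ler_pM2l// theta_ub.
have : (psi t * t `^ alpha) * alpha^-1 <= (t * theta t) * alpha^-1.
  by rewrite ler_wpM2r// invr_ge0 ltW.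
rewrite mulrDl mul1r mulrA [theta t * t]mulrC [alpha^-1 * _]mulrC; lra.
Qed.

Lemma integral_theta_lty : (\int[mu]_(s in I) (theta s)%:E < +oo)%E.
Proof.
have mI : measurable I by exact: measurable_I01.
apply: (@le_lt_trans _ _ (\int[mu]_(s in I) ((2 * phi (1 / 2))%:E * (s `^ (alpha - 1))%:E))%E).
  apply: le_integral_ge0 => s Is; first by rewrite lee_fin ltW// theta_gt0.
  by rewrite -EFinM lee_fin theta_le_powR.
rewrite ge0_integralZl_EFin//; first last.
- by rewrite mulr_ge0// (fund_ge0 I01_half).
- by apply: measurable_funTS; apply/measurable_EFinP; exact: measurable_powR.
- by move=> x _; rewrite lee_fin powR_ge0.
rewrite lte_mul_pinfty ?lee_fin//.
  by rewrite mulr_ge0// (fund_ge0 I01_half).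
apply: le_lt_trans (ltry (1 `^ alpha / alpha)); exact: integral_powR0_le.
Qed.

Lemma theta_unbounded (N : R) :
  ereal_sup [set (phi (t `^ (1 / beta)) * t `^ (alpha - 1))%:E | t in I] = +oo%E ->
  exists2 tau, I tau & forall s, I s -> s <= tau -> N <= theta s.
Proof.
move=> supE; have : (N%:E < ereal_sup [set (phi (t `^ (1 / beta)) * t `^ (alpha - 1))%:E | t in I])%E.
  by rewrite supE ltry.
move=> /ereal_sup_gt [_ [t It <-]]; rewrite lte_fin => Nt.
exists t => // s Is st; apply: (le_trans (ltW Nt)); exact: theta_ub.
Qed.

End weight.

(** * Embeddings of rearrangement-invariant spaces, tested on indicators *)

Section ri_spaces.
Context {R : realType}.
Local Notation mu := (@lebesgue_measure R).
Local Notation I := (I01 R).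
Implicit Types f g : R -> R.
Implicit Types rho sigma : (R -> R) -> \bar R.

Lemma ri_mono rho f g : ri_norm rho -> measI_pos f -> measI_pos g ->
  (forall x, I x -> f x <= g x) -> (rho f <= rho g)%E.
Proof. by move=> hr fp gp fg; apply: (ri_lattice hr) => //; exact: aeI_all. Qed.

Lemma ri_eq_on rho f g : ri_norm rho -> measI_pos f -> measI_pos g ->
  (forall x, I x -> f x = g x) -> rho f = rho g.
Proof.
by move=> hr fp gp fg; apply/le_anti/andP; split; apply: ri_mono => // x /fg ->.
Qed.

Lemma measI_pos_indic (A : set R) : measurable A -> measI_pos (\1_A : R -> R).
Proof. by move=> mA; split => //; exact: measurable_indic. Qed.

Lemma ri_indic_fin rho (A : set R) : ri_norm rho -> measurable A ->
  (rho (\1_A) < +oo)%E.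
Proof.
move=> hr mA; apply: le_lt_trans (ri_fin1 hr).
apply: (ri_mono hr); [exact: measI_pos_indic| |].
  by apply: measI_pos_indic; exact: measurable_I01.
by move=> x Ix; rewrite !indicE (mem_set Ix); case: (_ \in _).
Qed.

(** Indicators of intervals of equal length are equimeasurable. *)
Lemma ri_indic_shift rho (a s : R) : ri_norm rho -> 0 < a -> a <= s -> s <= 1 ->
  rho (\1_(`]s - a, s[%classic : set R)) = rho (\1_(`]0, a[%classic : set R)).
Proof.
move=> hr a0 a_s s1.
have p1 := measI_pos_indic (measurable_itv `]s - a, s[ : measurable (`]s - a, s[%classic : set R)).
have p2 := measI_pos_indic (measurable_itv `]0, a[ : measurable (`]0, a[%classic : set R)).
rewrite (ri_rearr hr p1) (ri_rearr hr p2); congr rho; apply: eq_rearr => // l l0.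
have [l1|l1] := ltP l 1; last first.
  have E (A : set R) : superlevel (\1_A) l = set0.
    apply/seteqP; split => x //= -[_ /=]; rewrite indicE ltNge.
    by case: (_ \in _) => /=; rewrite ?l1// ltW.
  by rewrite /distr !E.
have E (A : set R) : A `<=` I -> superlevel (\1_A) l = A.
  move=> AI; apply/seteqP; split => x /=.
    move=> [_ /=]; rewrite indicE; have [/set_mem//|_] := boolP (_ \in _).
    by rewrite ltNge ltW.
  by move=> Ax; split; [exact: AI|rewrite /= indicE (mem_set Ax)].
rewrite /distr !E; first last.
- by move=> x /=; rewrite in_itv/= => /andP[h1 h2]; apply/I01P; split; lra.
- by move=> x /=; rewrite in_itv/= => /andP[h1 h2]; apply/I01P; split; lra.
rewrite !lebesgue_measure_itv/= !lte_fin a0 ltrBlDr ltrDl a0 oppr0 adde0.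
by rewrite -EFinD/= opprB addrC subrK.
Qed.

Lemma ri_norm_sum rho (F : nat -> R -> R) (n : nat) : ri_norm rho ->
  (forall k, measI_pos (F k)) ->
  measI_pos (fun x => \sum_(k < n) F k x) /\
  (rho (fun x => \sum_(k < n) F k x)%R <= \sum_(k < n) rho (F k))%E.
Proof.
move=> hr Fp; elim: n => [|n [mS IH]].
  have z : measI_pos (fun x : R => \sum_(k < 0) F k x).
    split; last by move=> x _; rewrite big_ord0.
    by under eq_fun do rewrite big_ord0; exact: measurable_cst.
  split => //; rewrite big_ord0 le_eqVlt; apply/orP; left; apply/eqP.
  by apply/(ri_eq0 hr z); apply: aeI_all => x _; rewrite big_ord0.
have E : (fun x => \sum_(k < n.+1) F k x) = fun x => \sum_(k < n) F k x + F n x.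
  by apply/funext => x; rewrite big_ord_recr.
rewrite E; split; first exact: measI_posD.
by rewrite big_ord_recr/=; apply: (le_trans (ri_triangle hr mS (Fp n))); exact: leeD.
Qed.

Lemma sum_geometric_half_le (n : nat) : \sum_(k < n) (2^-1 : R) ^+ k <= 2.
Proof.
have -> : \sum_(k < n) (2^-1 : R) ^+ k = 2 - 2 * 2^-1 ^+ n.
  elim: n => [|n IH]; first by rewrite big_ord0 expr0 mulr1 subrr.
  by rewrite big_ord_recr/= IH exprS; field.
by rewrite gerBl mulr_ge0// exprn_ge0.
Qed.

Definition chi (t : R) : R -> R := \1_(`]0, t[%classic : set R).

Lemma measI_pos_chi t : measI_pos (chi t).
Proof. exact: measI_pos_indic (measurable_itv `]0, t[). Qed.

Lemma ri_norm_abs rho (f : R -> R) : ri_norm rho -> measI_pos f ->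
  space_norm rho f = rho f.
Proof.
move=> hr fp; apply: (ri_eq_on hr) => //; last exact: measI_pos_norm.
by split => //; apply: measurableT_comp => //; exact: fp.1.
Qed.

(** An inclusion of spaces is bounded on indicators of initial segments. Otherwise there are indicators
whose norms have ratio at least [4 ^+ n]; their sum, normalized so that the norms in the smaller space
are [2^-1 ^+ n], lies in the smaller space but has norm at least [2 ^+ n] in the larger one for all [n]. *)
Lemma ri_embedding_indic rho sigma : ri_norm rho -> ri_norm sigma ->
  ri_space sigma `<=` ri_space rho ->
  exists2 C : R, 0 < C & forall t, I t ->
    (rho (chi t) <= C%:E * sigma (chi t))%E.
Proof.
move=> hr hs sub; apply: contrapT => /forall2NP nC.
have chip t : measI_pos (chi t) := measI_pos_chi t.
have [C1 C10 hC1] := ri_L1 hs.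
have pick_t (n : nat) : {t : R | I t /\ ((4 ^+ n)%:E * sigma (chi t) < rho (chi t))%E}.
  apply: cid; have [|] := nC (4 ^+ n); first by rewrite exprn_gt0.
  move=> /existsNP[t /not_implyP[It]] /negP; rewrite -ltNge => h.
  by exists t.
pose t n := sval (pick_t n).
have It n : I (t n) by case: (svalP (pick_t n)).
have ht n : ((4 ^+ n)%:E * sigma (chi (t n)) < rho (chi (t n)))%E.
  by case: (svalP (pick_t n)).
pose s n := fine (sigma (chi (t n))).
have sE n : sigma (chi (t n)) = (s n)%:E.
  rewrite fineK// ge0_fin_numE ?(ri_ge0 hs)//; exact: ri_indic_fin (measurable_itv _).
have ts n : t n <= C1 * s n.
  rewrite -lee_fin EFinM -sE; apply: le_trans (hC1 _ (chip _)).
  have /I01P[t0 t1] := It n.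
  rewrite -(lebesgue_itv0 (ltW t0)) integral_indic//; last exact: measurable_I01.
  rewrite setIidl// => x /=; rewrite in_itv/= => /andP[x0 xt].
  by apply/I01P; split => //; exact: lt_trans t1.
have s0 n : 0 < s n.
  have /I01P[t0 _] := It n; rewrite -(pmulr_rgt0 _ C10).
  exact: lt_le_trans t0 (ts n).
pose r := fine (rho (\1_I)).
have rE : rho (\1_I) = r%:E.
  rewrite fineK// ge0_fin_numE ?(ri_fin1 hr)//.
  by apply: (ri_ge0 hr); apply: measI_pos_indic; exact: measurable_I01.
have sr n : 4 ^+ n * s n <= r.
  rewrite -lee_fin EFinM -sE -rE; apply: (le_trans (ltW (ht n))).
  apply: (ri_mono hr) => //; first by apply: measI_pos_indic; exact: measurable_I01.
  by move=> x Ix; rewrite /chi !indicE (mem_set Ix); case: (_ \in _).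
(* normalized so that F k has sigma-norm 2^-1 ^+ k; its rho-norm is then at least 2 ^+ k *)
pose F k x := (2^-1 ^+ k / s k) * chi (t k) x.
have c0 k : 0 <= 2^-1 ^+ k / s k by rewrite divr_ge0 ?exprn_ge0// ltW.
have Fp k : measI_pos (F k) by exact: measI_posZ.
pose f_ n x := \sum_(k < n) F k x.
have fp n : measI_pos (f_ n) := (ri_norm_sum n hr Fp).1.
have F0 k x : 0 <= F k x by rewrite mulr_ge0// /chi indicE.
have ndf x : nondecreasing_seq (fun n => f_ n x).
  by apply/nondecreasing_seqP => n; rewrite /f_ big_ord_recr/= lerDl.
(* the supports shrink to the origin, so the series is a finite sum at each point *)
have cf x : I x -> cvgn (fun n => f_ n x).
  move=> /I01P[x0 x1].
  have [N hN] : exists N : nat, forall k, (N <= k)%N -> t k <= x.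
    pose N := (Num.truncn (C1 * r / x)).+1.
    exists N => k Nk; apply: (le_trans (ts k)).
    have k4 : C1 * r / x <= 4 ^+ k.
      apply: (@le_trans _ _ k%:R).
        by apply: ltW; apply: (lt_le_trans (truncnS_gt _)); rewrite ler_nat.
      rewrite -natrX ler_nat; apply: ltnW; exact: ltn_expl.
    have k40 : (0 : R) < 4 ^+ k by rewrite exprn_gt0.
    have h : C1 * s k * 4 ^+ k <= x * 4 ^+ k.
      rewrite -mulrA [s k * _]mulrC; apply: (@le_trans _ _ (C1 * r)).
        by rewrite ler_pM2l.
      by rewrite [leRHS]mulrC -ler_pdivrMr.
    by rewrite ler_pM2r in h.
  apply/cvg_ex; exists (f_ N x); apply: cvg_near_cst.
  exists N => // n /= Nn; apply/le_anti/andP; split; last exact: ndf.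
  rewrite -(subnKC Nn) /f_; elim: (n - N)%N => [|m IH]; first by rewrite addn0.
  rewrite addnS big_ord_recr/= -[leRHS]addr0; apply: lerD => //.
  rewrite /F /chi indicE memNset ?mulr0//= in_itv/= => /andP[_].
  by rewrite ltNge hN// leq_addr.
pose f x := limn (fun n => f_ n x).
have cff x : I x -> f_ n x @[n --> \oo] --> f x by move=> /cf.
have fpos : measI_pos f.
  split.
    apply: (measurable_fun_cvg (h := f_)) => //.
      by move=> n; exact: (fp n).1.
  move=> x Ix; apply: limr_ge; first exact: cf.
  by apply: nearW => n; apply: sumr_ge0.
have hfatou : aeI (fun x => nondecreasing_seq (fun n => f_ n x) /\ f_ n x @[n --> \oo] --> f x).
  by apply: aeI_all => x Ix; split => //; exact: cff.
have sf : (sigma f <= 2%:E)%E.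
  have [_ cs] := ri_fatou hs fp fpos hfatou.
  rewrite -(cvg_lim (@ereal_hausdorff R) cs); apply: lime_le.
    by apply/cvg_ex; exists (sigma f).
  apply: nearW => n; apply: (le_trans (ri_norm_sum n hs Fp).2).
  apply: (@le_trans _ _ (\sum_(k < n) (2^-1 ^+ k)%:E)%E); last first.
    by rewrite sumEFin lee_fin sum_geometric_half_le.
  apply: lee_sum => k _; rewrite (ri_homo hs)// sE -EFinM lee_fin.
  by rewrite divfK// gt_eqF.
have rf k : ((2 ^+ k)%:E <= rho f)%E.
  apply: (@le_trans _ _ (rho (F k))).
    rewrite (ri_homo hr)//; apply: (@le_trans _ _ ((2^-1 ^+ k / s k)%:E * ((4 ^+ k)%:E * sigma (chi (t k))))%E).
      rewrite sE -!EFinM lee_fin.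
      have -> : 2^-1 ^+ k / s k * (4 ^+ k * s k) = 2^-1 ^+ k * 4 ^+ k.
        by rewrite mulrACA mulVf ?mulr1// gt_eqF.
      by rewrite -exprMn (_ : 2^-1 * 4 = 2)//; field.
    by apply: lee_wpmul2l; [rewrite lee_fin|exact: ltW].
  apply: (ri_mono hr) => // x Ix; apply: (@le_trans _ _ (f_ k.+1 x)).
    by rewrite /f_ big_ord_recr/= lerDr; apply: sumr_ge0.
  by apply: nondecreasing_cvgn_le => //; exact: cf.
have [_] : ri_space rho f.
  by apply: sub; split; [exact: fpos.1|rewrite ri_norm_abs// (le_lt_trans sf)// ltry].
rewrite ri_norm_abs// => rfin.
have rf0 := ri_ge0 hr fpos.
have rhoE : rho f = (fine (rho f))%:E by rewrite fineK// ge0_fin_numE.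
have := rf (Num.truncn (fine (rho f))).+1; rewrite rhoE lee_fin leNgt => /negP; apply.
apply: (lt_le_trans (truncnS_gt _)); rewrite -natrX ler_nat; apply: ltnW; exact: ltn_expl.
Qed.

End ri_spaces.

(** * The fundamental function of the largest domain *)

Section largest_space.
Context {R : realType}.
Local Notation mu := (@lebesgue_measure R).
Local Notation I := (I01 R).
Context (alpha beta : R).
Context (alpha_gt0 : 0 < alpha) (alpha_lt1 : alpha < 1) (beta_gt0 : 0 < beta)
  (alpha_beta : 1 <= alpha + 1 / beta).
Context (phi : R -> R) (fund_phi : concave_fundamental phi).
Local Notation psi := (psi beta phi).
Local Notation K := (hardy_kernel alpha beta).
Local Notation theta := (theta alpha beta phi).
Local Notation H := (Hop alpha beta).
Local Notation M := (marcinkiewicz_norm phi).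

Let phi_ge0 t : I t -> 0 <= phi t. Proof. exact: fund_ge0. Qed.

Lemma in_L1_ri rho (f : R -> R) : ri_norm rho -> ri_space rho f -> in_L1 f.
Proof.
move=> hr [mf ff]; have [C C0 hC] := ri_L1 hr.
have fp : measI_pos (fun x => `|f x|) by split => //; exact: measurableT_comp.
apply: le_lt_trans (hC _ fp) _; apply: lte_mul_pinfty => //; first by rewrite lee_fin ltW.
Qed.

(** Test on the indicator of [(sigma - t / 2, sigma)]: it lies in [(sigma / 2, sigma)], where the kernel
[K sigma] is comparable to [sigma `^ (alpha - 1)], and rearrangement invariance moves it to the origin. *)
Lemma bounded_op_indic rho : ri_norm rho -> bounded_op H rho M ->
  exists2 C : R, 0 < C & forall t sigma, I t -> I sigma -> t <= sigma ->
    ((psi sigma * sigma `^ (alpha - 1) * t)%:E <= C%:E * rho (chi t))%E.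
Proof.
move=> hr [C C0 hC].
pose k : R := 2^-1 `^ (1 / beta).
have k0 : 0 < k by rewrite powR_gt0.
exists (2 / k * C) => [|t sigma It Is ts].
  by rewrite mulr_gt0// divr_gt0.
have /I01P[t0 t1] := It; have /I01P[s0 s1] := Is.
have psi0 : 0 <= psi sigma by exact: psi_ge0 Is.
pose E : set R := `]sigma - t / 2, sigma[%classic.
have mE : measurable E by exact: measurable_itv.
have muE : mu E = (t / 2)%:E.
  rewrite /E lebesgue_measure_itv/= lte_fin ltrBlDr ltrDl divr_gt0// -EFinD.
  by congr EFin; ring.
have EI : E `<=` I.
  by move=> x; rewrite /E /= in_itv/= => /andP[h1 h2]; apply/I01P; split; lra.
have fp : measI_pos (\1_E : R -> R) := measI_pos_indic mE.
have fX : ri_space rho (\1_E).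
  by split; [exact: fp.1|rewrite (ri_norm_abs hr fp) ri_indic_fin].
have f1 := in_L1_ri hr fX.
have := hC _ fX; rewrite (ri_norm_abs hr fp) /space_norm.
have -> : rho (\1_E) = rho (chi (t / 2)) by apply: ri_indic_shift => //; lra.
move=> hM; have := marcinkiewicz_Hop_ge alpha_lt1 beta_gt0 phi_ge0 fp f1 Is.
move=> /le_trans /(_ hM) hI.
have h1 : (rho (chi (t / 2)) <= rho (chi t))%E.
  apply: (ri_mono hr) => [||x Ix]; [exact: measI_pos_chi..|].
  rewrite /chi !indicE; have [/set_mem|//] := boolP (x \in _).
  rewrite /= in_itv/= => /andP[x0 xt]; rewrite mem_set//= in_itv/= x0/=; lra.
have h2 : ((k * sigma `^ (alpha - 1) * (t / 2))%:E <=
    \int[mu]_(r in I) ((\1_E : R -> R) r * K sigma r)%:E)%E.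
  apply: (@le_trans _ _ (\int[mu]_(r in E) (k * sigma `^ (alpha - 1))%:E)%E).
    rewrite integral_cst// EFinM; apply: lee_wpmul2l.
      by rewrite lee_fin mulr_ge0 ?powR_ge0.
    by rewrite -muE.
  rewrite -[E](setIidr EI) integral_mkcondr; apply: le_integral_ge0 => x Ix.
    by rewrite patchE; case: ifP; rewrite // lee_fin mulr_ge0 ?powR_ge0.
  rewrite patchE indicE (setIidr EI); case: ifPn => [/set_mem|_]; last by rewrite mul0r.
  rewrite /E /= in_itv/= => /andP[a1 a2]; rewrite mul1r lee_fin.
  by apply: hardy_kernel_ge => //; lra.
have h3 : ((psi sigma)%:E * (k * sigma `^ (alpha - 1) * (t / 2))%:E <= C%:E * rho (chi t))%E.
  apply: (@le_trans _ _ ((psi sigma)%:E * \int[mu]_(r in I) ((\1_E : R -> R) r * K sigma r)%:E)%E).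
    by apply: lee_wpmul2l; rewrite ?lee_fin.
  apply: (le_trans hI); apply: lee_wpmul2l => //; by rewrite lee_fin ltW.
have -> : psi sigma * sigma `^ (alpha - 1) * t =
    2 / k * (psi sigma * (k * sigma `^ (alpha - 1) * (t / 2))) by field; rewrite gt_eqF.
rewrite !(EFinM (2 / k)) -muleA; apply: lee_wpmul2l; first by rewrite lee_fin divr_ge0// ltW.
by rewrite EFinM.
Qed.

Lemma bounded_op_fundamental_ge rho : ri_norm rho -> bounded_op H rho M ->
  exists2 C : R, 0 < C & forall t, I t -> ((t * theta t)%:E <= C%:E * rho (chi t))%E.
Proof.
move=> hr /(bounded_op_indic hr)[C C0 hC]; exists C => // t It.
have /I01P[t0 t1] := It; have cp := measI_pos_chi t.
have rE : rho (chi t) = (fine (rho (chi t)))%:E.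
  rewrite fineK// ge0_fin_numE ?(ri_ge0 hr)//; exact: ri_indic_fin (measurable_itv _).
rewrite rE -EFinM lee_fin -ler_pdivlMl//; apply: theta_le => // s Is ts.
rewrite ler_pdivlMl// mulrC.
by have := hC t s It Is ts; rewrite rE -EFinM lee_fin.
Qed.

Lemma ri_norm_lorentz_theta : ri_norm (lorentz theta).
Proof.
apply: (@ri_norm_lorentz R theta (psi (1 / 2))).
- exact: nonincr_weight_theta.
- by apply: psi_gt0 => //; exact: I01_half.
- by move=> x Ix; exact: theta_ge_half.
- exact: integral_theta_lty.
Qed.

(** All the functions [psi tau * K tau] lie below the nonincreasing weight [theta], so the
Hardy-Littlewood inequality bounds all the test integrals at once. *)
Lemma bounded_op_lorentz : bounded_op H (lorentz theta) M.
Proof.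
have hw : nonincr_weight theta by exact: nonincr_weight_theta.
have hL := ri_norm_lorentz_theta.
exists 1 => // f fX; rewrite mul1e; have [mf ff] := fX.
have f1 := in_L1_ri hL fX.
have fp : measI_pos (fun x => `|f x|) by split => //; exact: measurableT_comp.
have fE : space_norm (lorentz theta) f = (fine (space_norm (lorentz theta) f))%:E.
  by rewrite fineK// ge0_fin_numE// lorentz_ge0.
rewrite fE; apply: marcinkiewicz_Hop_le => // tau It; rewrite -fE.
have mI : measurable I by exact: measurable_I01.
rewrite -ge0_integralZl_EFin//; first last.
- exact: psi_ge0.
- apply/measurable_EFinP; apply: measurable_funM; first exact: fp.1.
  exact: measI_hardy_kernel.
- by move=> x _; rewrite lee_fin mulr_ge0 ?hardy_kernel_ge0.
apply: le_trans (hardy_littlewood fp hw.1 hw.2).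
apply: le_integral_ge0 => x Ix; rewrite -EFinM lee_fin.
  by rewrite mulr_ge0 ?psi_ge0// mulr_ge0 ?hardy_kernel_ge0.
rewrite mulrCA mulrC ler_wpM2r//; exact: psi_hardy_kernel_le_theta.
Qed.

Lemma lorentz_chi_le t : I t -> (lorentz theta (chi t) <= ((1 + alpha^-1) * (t * theta t))%:E)%E.
Proof.
move=> It; have /I01P[t0 t1] := It.
apply: (le_trans _ (integral_theta_le alpha_gt0 alpha_lt1 beta_gt0 fund_phi It)).
have sub : `]0, t[%classic `<=` I.
  by move=> x /=; rewrite in_itv/= => /andP[x0 xt]; apply/I01P; split => //; exact: lt_trans t1.
rewrite -[X in (_ <= \int[mu]_(_ in X) _)%E](setIidr sub) integral_mkcondr.
have cp := measI_pos_chi t.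
apply: le_integral_ge0 => x Ix.
  by rewrite lee_fin mulr_ge0 ?rearr_ge0// ltW// theta_gt0.
have th0 : 0 <= theta x by rewrite ltW// theta_gt0.
have nic y z : I y -> I z -> y <= z -> chi t z <= chi t y.
  move=> /I01P[y0 _] Iz yz; rewrite /chi !indicE.
  have [/set_mem|//] := boolP (z \in _); rewrite /= in_itv/= => /andP[_ zt].
  by rewrite mem_set//= in_itv/= y0/=; exact: le_lt_trans zt.
have := rearr_le_nonincreasing cp nic Ix; rewrite {2}/chi indicE patchE.
case: (x \in _) => h; rewrite lee_fin; first by rewrite ler_piMr.
by have -> : rearr (chi t) x = 0; [apply/le_anti; rewrite h rearr_ge0|rewrite mulr0].
Qed.

Lemma largest_fundamental rhoX :
  largest_ri (fun rho => bounded_op H rho M) rhoX ->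
  exists c1 c2 : R, [/\ 0 < c1, 0 < c2 & forall t, I t ->
    ((c1 * (t * theta t))%:E <= rhoX (chi t))%E /\
    (rhoX (chi t) <= (c2 * (t * theta t))%:E)%E].
Proof.
move=> [hr hb hL].
have [C C0 hC] := bounded_op_fundamental_ge hr hb.
have [D D0 hD] := ri_embedding_indic hr ri_norm_lorentz_theta
  (hL _ ri_norm_lorentz_theta bounded_op_lorentz).
have a0 : 0 < 1 + alpha^-1 by rewrite addr_gt0// invr_gt0.
exists C^-1, (D * (1 + alpha^-1)); split; [by rewrite invr_gt0|by rewrite mulr_gt0|].
move=> t It; split; first by rewrite EFinM lee_pdivrMl// hC.
apply: (le_trans (hD t It)); rewrite -mulrA (EFinM D).
by apply: lee_wpmul2l; [rewrite lee_fin ltW|exact: lorentz_chi_le].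
Qed.

End largest_space.

(** * Young functions and their complementary functions *)

Section young.
Context {R : realType}.
Local Notation mu := (@lebesgue_measure R).
Local Notation I := (I01 R).
Implicit Types A a : R -> R.

(** The integral representation of a Young function is used only through the two bounds [yd_lb] and [yd_ub]
on its increments, from which the rest follows by real arithmetic. *)
Record young_density A a : Prop := YoungDensity {
  yd_nd : forall s t : R, 0 <= s -> s <= t -> a s <= a t ;
  yd_a0 : a 0 = 0 ;
  yd_gt0 : forall s : R, 0 < s -> 0 < a s ;
  yd_infty : forall N : R, exists2 S : R, 0 < S & forall s, S <= s -> N <= a s ;
  yd_A0 : A 0 = 0 ;
  yd_lb : forall x y : R, 0 <= x -> x <= y -> a x * (y - x) <= A y - A x ;
  yd_ub : forall x y : R, 0 <= x -> x <= y -> A y - A x <= a y * (y - x) }.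

Lemma young_has_density A : young_function A -> exists a, young_density A a.
Proof.
move=> [a [_ nda [a0 agt0] ainf hA]]; exists a.
have age0 s : 0 <= s -> 0 <= a s by move=> s0; rewrite -a0; exact: nda.
have ma (D : set R) : is_interval D -> (forall x, D x -> 0 <= x) -> measurable_fun D a.
  move=> iD D0; rewrite -(opprK a); apply/measurable_funN.
  by apply: nonincreasing_on_measurable => // x y Dx _ xy; rewrite lerN2 nda// D0.
have split_int (x y : R) : 0 <= x -> x <= y ->
    (A y - A x)%:E = (\int[mu]_(s in `]x, y]%classic) (a s)%:E)%E.
  move=> x0 xy.
  have y0 := le_trans x0 xy.
  have U : `[0, y]%classic = `[0, x]%classic `|` `]x, y]%classic :> set R.
    by rewrite -itv_bndbnd_setU ?bnd_simp.
  have : ((A y)%:E = (A x)%:E + \int[mu]_(s in `]x, y]%classic) (a s)%:E)%E.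
    rewrite (hA _ y0) (hA _ x0) U ge0_integral_setU//.
    - rewrite -U; apply/measurable_EFinP; apply: ma; first exact: interval_is_interval.
      by move=> z; rewrite /= in_itv/= => /andP[].
    - by move=> z [|] /=; rewrite in_itv/= => /andP[h _]; rewrite lee_fin age0// (le_trans x0)// ltW.
    - apply/disj_setPS => z [] /=; rewrite !in_itv/= => /andP[_ zx] /andP[xz _].
      by move: (lt_le_trans xz zx); rewrite ltxx.
  by move=> h; rewrite EFinB h [X in (X - _)%E]addeC addeK.
have mui (x y : R) : x <= y -> mu `]x, y]%classic = (y - x)%:E.
  move=> xy; rewrite lebesgue_measure_itv/= lte_fin; case: ltP => h; first by rewrite EFinB.
  by have -> : y = x; [apply/le_anti; rewrite h xy|rewrite subrr].
have mai (x y : R) : 0 <= x -> measurable_fun `]x, y]%classic a.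
  move=> x0; apply: ma; first exact: interval_is_interval.
  by move=> z; rewrite /= in_itv/= => /andP[h _]; rewrite (le_trans x0)// ltW.
split => //.
- move=> N; have := ainf; move=> /cvgryPge /(_ N) [S [_ hS]].
  exists (Num.max (S + 1) 1); first by rewrite lt_max ltr01 orbT.
  by move=> s hs; apply: hS; apply: lt_le_trans hs; rewrite lt_max ltrDl ltr01.
- have := hA 0 (lexx _); rewrite set_itv1 integral_set1 => h; by case: h.
- move=> x y x0 xy; rewrite -lee_fin split_int// EFinM -mui//.
  rewrite -(integral_cst mu (measurable_itv _)); apply: le_integral_ge0 => s; rewrite /= in_itv/= => /andP[xs sy].
    by rewrite lee_fin age0.
  by rewrite lee_fin nda// ltW.
- move=> x y x0 xy; rewrite -lee_fin split_int// EFinM -mui//.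
  rewrite -(integral_cst mu (measurable_itv _)); apply: le_integral_ge0 => s; rewrite /= in_itv/= => /andP[xs sy].
    by rewrite lee_fin age0// (le_trans x0)// ltW.
  by rewrite lee_fin nda// (le_trans x0)// ltW.
Qed.

Context (A a : R -> R) (yA : young_density A a).

Lemma yd_ge0 s : 0 <= s -> 0 <= a s.
Proof. by move=> s0; rewrite -(yd_a0 yA); apply: (yd_nd yA). Qed.

Lemma young_le s t : 0 <= s -> s <= t -> A s <= A t.
Proof.
move=> s0 st; rewrite -subr_ge0; apply: le_trans (yd_lb yA s0 st).
by rewrite mulr_ge0 ?yd_ge0// subr_ge0.
Qed.

Lemma young_ge0 s : 0 <= s -> 0 <= A s.
Proof. by move=> s0; rewrite -(yd_A0 yA); exact: young_le. Qed.

(** This is convexity with [A 0 = 0], in a form free of convex combinations. *)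
Lemma young_scale D x : 1 <= D -> 0 <= x -> D * A x <= A (D * x).
Proof.
move=> D1 x0; have xD : x <= D * x by rewrite ler_peMl.
have h1 := yd_lb yA x0 xD; have h2 := yd_ub yA (lexx 0) x0.
rewrite (yd_A0 yA) !subr0 in h2.
have h3 : (D - 1) * A x <= (D - 1) * (a x * x) by rewrite ler_wpM2l// subr_ge0.
have -> : D * A x = A x + (D - 1) * A x by ring.
have h4 : a x * (D * x - x) = (D - 1) * (a x * x) by ring.
by move: h1 h3; rewrite h4; lra.
Qed.

Lemma young_superlinear N : exists2 S, 0 < S & forall s, S <= s -> N * s <= A s.
Proof.
have [S S0 hS] := yd_infty yA (2 * `|N|); exists (2 * S); first by rewrite mulr_gt0.
move=> s hs; have Ss : S <= s by lra.
have := yd_lb yA (ltW S0) Ss; have := young_ge0 (ltW S0) => AS h.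
have hN := hS S (lexx _).
have h1 : 2 * `|N| * (s / 2) <= a S * (s - S).
  by apply: ler_pM => //; lra.
have h2 : N * s <= `|N| * s by rewrite ler_wpM2r ?ler_norm//; lra.
move: h h1; have : `|N| * s = 2 * `|N| * (s / 2) by field.
lra.
Qed.

Lemma measurable_young (f : R -> R) : measI_pos f -> measI (fun x => A (f x)).
Proof.
move=> [mf f0]; apply: (eq_measurable_fun (fun x => (fun y => A (Num.max y 0)) (f x))).
  by move=> x /set_mem Ix /=; rewrite (max_idPl (f0 x Ix)).
suff mg : measurable_fun setT (fun y : R => A (Num.max y 0)) by exact: measurableT_comp mg mf.
apply: nondecreasing_measurable => // x y xy; apply: young_le.
  by rewrite le_max lexx orbT.
by rewrite ge_max !le_max xy lexx orbT.
Qed.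

Local Notation At := (complementary A).

Lemma complementary_has_ubound t : has_ubound [set s * t - A s | s in [set s : R | 0 < s]].
Proof.
have [S S0 hS] := young_superlinear t.
exists (S * `|t|) => _ [s /= s0 <-].
have As := young_ge0 (ltW s0).
have [sS|Ss] := leP s S.
  have : s * t <= S * `|t|.
    apply: (@le_trans _ _ (s * `|t|)); first by rewrite ler_pM2l// ler_norm.
    by rewrite ler_wpM2r.
  lra.
have := hS s (ltW Ss); rewrite [t * s]mulrC => h.
have : 0 <= S * `|t| by rewrite mulr_ge0// ltW.
lra.
Qed.

Lemma complementary_ub s t : 0 < s -> s * t - A s <= At t.
Proof.
by move=> s0; apply: ub_le_sup; [exact: complementary_has_ubound|exists s].
Qed.

Lemma complementary_le t c : (forall s, 0 < s -> s * t - A s <= c) -> At t <= c.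
Proof.
move=> h; apply: ge_sup; first by exists (1 * t - A 1); exists 1 => //=; exact: ltr01.
by move=> _ [s /= s0 <-]; exact: h.
Qed.

Lemma complementary_ge0 t : 0 <= At t.
Proof.
rewrite leNgt; apply/negP => At0.
pose k := `|t| + a 1 + 1.
have a1 : 0 <= a 1 by rewrite yd_ge0.
have k0 : 0 < k by rewrite /k; have := normr_ge0 t; lra.
pose s := Num.min 1 (- At t / (2 * k)).
have s0 : 0 < s by rewrite lt_min ltr01 divr_gt0 ?oppr_gt0 ?mulr_gt0.
have s1 : s <= 1 by rewrite ge_min lexx.
have := complementary_ub t s0; have := yd_ub yA (lexx 0) (ltW s0).
rewrite (yd_A0 yA) !subr0 => h1 h2.
have h3 : a s * s <= a 1 * s by rewrite ler_pM2r// (yd_nd yA)// ltW.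
have h4 : - (`|t| * s) <= s * t.
  by rewrite mulrC -mulrN ler_pM2l// lerNl -normrN ler_norm.
have h5 : s * k <= - At t / 2.
  have : s <= - At t / (2 * k) by rewrite ge_min lexx orbT.
  by rewrite ler_pdivlMr ?mulr_gt0// => h; lra.
have h6 : s * k = `|t| * s + a 1 * s + s by rewrite /k; ring.
lra.
Qed.

Lemma young_inequality s t : 0 <= s -> s * t <= A s + At t.
Proof.
rewrite le_eqVlt => /orP[/eqP <-|s0].
  by rewrite mul0r (yd_A0 yA) add0r complementary_ge0.
by have := complementary_ub t s0; lra.
Qed.

Lemma complementary_nd s t : s <= t -> At s <= At t.
Proof.
move=> st; apply: complementary_le => u u0; apply: le_trans (complementary_ub t u0).
by rewrite lerD2r ler_pM2l.
Qed.

Lemma complementary_scale D t : 1 <= D -> D * At t <= At (D * t).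
Proof.
move=> D1; have D0 : 0 < D by lra.
rewrite -ler_pdivlMl//; apply: complementary_le => s s0.
rewrite ler_pdivlMl//; apply: le_trans (complementary_ub _ s0).
have : A s <= D * A s by rewrite ler_peMl// young_ge0// ltW.
by rewrite mulrBr mulrCA; lra.
Qed.

(** By superlinearity of [A], for [t <= T] the supremum defining the complement at [t] is a supremum of
affine functions of bounded slope. *)
Lemma complementary_lipschitz T : exists2 S : R, 0 < S &
  forall x y, x <= y -> y <= T -> At y - At x <= S * (y - x).
Proof.
(* beyond S the affine function of slope s is nonpositive at y, and the complement is nonnegative *)
have [S S0 hS] := young_superlinear T; exists S => // x y xy yT.
rewrite lerBlDr; apply: complementary_le => s s0.
have h0 : 0 <= S * (y - x) by rewrite mulr_ge0 ?subr_ge0// ltW.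
have [sS|Ss] := leP s S.
  have := complementary_ub x s0.
  have : s * (y - x) <= S * (y - x) by rewrite ler_wpM2r// subr_ge0.
  lra.
have := hS s (ltW Ss); have := complementary_ge0 x.
have : s * y <= T * s by rewrite mulrC ler_pM2r.
lra.
Qed.

Lemma complementary_continuous : continuous At.
Proof.
move=> x; have [S S0 hS] := complementary_lipschitz (x + 1).
apply/cvgrPdist_le => e e0; apply/nbhs_ballP.
exists (Num.min 1 (e / S)) => /=; first by rewrite lt_min ltr01 divr_gt0.
move=> y; rewrite /ball/= lt_min => /andP[d1 /ltW d].
have y1 : y <= x + 1 by move: d1; rewrite ltr_norml; lra.
have key u v : u <= v -> v <= x + 1 -> `|u - v| <= e / S -> `|At u - At v| <= e.
  move=> uv v1; rewrite !ler0_norm ?subr_le0// ?complementary_nd// !opprB => h.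
  apply: (le_trans (hS _ _ uv v1)); by rewrite mulrC -ler_pdivlMr.
have [xy|/ltW yx] := leP x y; first exact: key.
by rewrite distrC; apply: key => //; [lra|rewrite distrC].
Qed.

(** The right-continuous inverse of the density; it maximizes [s * v - A s] over [s]. *)
Definition young_inverse v := sup [set s | 0 <= s /\ a s <= v].

Lemma young_inverse_has_ub v : has_ubound [set s | 0 <= s /\ a s <= v].
Proof.
have [S S0 hS] := yd_infty yA (v + 1); exists S => s [s0 asv].
rewrite leNgt; apply/negP => /ltW/hS; lra.
Qed.

Lemma young_inverse_ge0 v : 0 <= v -> 0 <= young_inverse v.
Proof.
move=> v0; apply: ub_le_sup; first exact: young_inverse_has_ub.
by split => //; rewrite (yd_a0 yA).
Qed.

Lemma young_inverse_nd u v : 0 <= u -> u <= v -> young_inverse u <= young_inverse v.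
Proof.
move=> u0 uv; apply: ge_sup.
  by exists 0; split => //; rewrite (yd_a0 yA).
move=> s [s0 asu]; apply: ub_le_sup; first exact: young_inverse_has_ub.
by split => //; exact: le_trans uv.
Qed.

(** The density is at most [v] before the inverse and at least [v] beyond it, up to points at arbitrarily
small distance [e]; hence [s * v - A s] increases before it and decreases beyond it. *)
Lemma young_equality v : 0 <= v ->
  A (young_inverse v) + At v <= young_inverse v * v.
Proof.
move=> v0; set g := young_inverse v; have g0 : 0 <= g by exact: young_inverse_ge0.
suff : At v <= g * v - A g by lra.
apply: complementary_le => s s0.
have [sg|gs] := leP s g; last first.
  suff : v * (s - g) <= A s - A g by lra.
  have key e : 0 < e -> e <= s - g -> v * (s - (g + e)) <= A s - A g.
    move=> e0 eg; have ge0' : 0 <= g + e by lra.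
    have ages : g + e <= s by lra.
    have := yd_lb yA ge0' ages; have := young_le g0 (ltac:(lra) : g <= g + e).
    have av : v <= a (g + e).
      rewrite leNgt; apply/negP => h.
      have : g + e <= g.
        apply: ub_le_sup; first exact: young_inverse_has_ub.
        by split => //; exact: ltW.
      lra.
    have : v * (s - (g + e)) <= a (g + e) * (s - (g + e)).
      by rewrite ler_wpM2r// subr_ge0.
    lra.
  apply/ler_addgt0Pr => d d0.
  pose e := Num.min (s - g) (d / (v + 1)).
  have e0 : 0 < e by rewrite lt_min subr_gt0 gs divr_gt0//; lra.
  have es : e <= s - g by rewrite ge_min lexx.
  have := key e e0 es.
  have : e * (v + 1) <= d.
    have : e <= d / (v + 1) by rewrite ge_min lexx orbT.
    by rewrite ler_pdivlMr//; lra.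
  have -> : v * (s - (g + e)) = v * (s - g) - e * (v + 1) + e by ring.
  lra.
have key e : 0 < e -> e <= g - s -> A (g - e) - A s <= v * (g - e - s).
  move=> e0 eg; have h1 : s <= g - e by lra.
  apply: (le_trans (yd_ub yA (ltW s0) h1)); rewrite ler_wpM2r ?subr_ge0//.
  have [z [z0 azv] gz] : exists2 z, 0 <= z /\ a z <= v & g - e < z.
    have : g - e < g by lra.
    move=> /sup_gt; case; first by exists 0; split => //; rewrite (yd_a0 yA).
    by move=> z hz ?; exists z.
  by apply: le_trans azv; apply: (yd_nd yA) => //; lra.
have [->|sg'] := eqVneq s g; first by [].
have slt : s < g by rewrite lt_neqAle sg'.
suff : A g - A s <= v * (g - s) by lra.
apply/ler_addgt0Pr => d d0.
have ag0 := yd_ge0 g0.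
pose e := Num.min (g - s) (d / (a g + v + 1)).
have e0 : 0 < e by rewrite lt_min subr_gt0 slt divr_gt0//; lra.
have es : e <= g - s by rewrite ge_min lexx.
have := key e e0 es.
have ge : 0 <= g - e by lra.
have := yd_ub yA ge (ltac:(lra) : g - e <= g).
have : e * (a g + v + 1) <= d.
  have : e <= d / (a g + v + 1) by rewrite ge_min lexx orbT.
  by rewrite ler_pdivlMr//; lra.
have -> : v * (g - e - s) = v * (g - s) - v * e by ring.
have -> : a g * (g - (g - e)) = a g * e by ring.
have -> : e * (a g + v + 1) = a g * e + v * e + e by ring.
have : 0 <= v * e by rewrite mulr_ge0// ltW.
lra.
Qed.

End young.

(** * Boundedness on an Orlicz space as a modular bound for the kernels *)

Section modular.
Context {R : realType}.
Local Notation mu := (@lebesgue_measure R).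
Local Notation I := (I01 R).
Context (alpha beta : R).
Context (alpha_gt0 : 0 < alpha) (alpha_lt1 : alpha < 1) (beta_gt0 : 0 < beta)
  (alpha_beta : 1 <= alpha + 1 / beta).
Context (phi : R -> R) (fund_phi : concave_fundamental phi).
Context (A a : R -> R) (yA : young_density A a).
Local Notation psi := (psi beta phi).
Local Notation K := (hardy_kernel alpha beta).
Local Notation H := (Hop alpha beta).
Local Notation M := (marcinkiewicz_norm phi).
Local Notation At := (complementary A).

Let phi_ge0 t : I t -> 0 <= phi t. Proof. exact: fund_ge0. Qed.

Definition kernel_modular (C tau : R) : \bar R :=
  (\int[mu]_(s in I) (At (psi tau * K tau s / C))%:E)%E.

Lemma measurable_complementary : measurable_fun setT At.
Proof. by apply: nondecreasing_measurable => // x y; exact: (complementary_nd yA). Qed.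

Lemma measI_complementary (v : R -> R) : measI v -> measI (fun s => At (v s)).
Proof. by move=> mv; apply: measurableT_comp => //; exact: measurable_complementary. Qed.

Lemma measI_scaled_kernel (C tau : R) : measI (fun s => psi tau * K tau s / C).
Proof.
by apply: measurable_funM => //; apply: measurable_funM => //; exact: measI_hardy_kernel.
Qed.

Lemma luxemburg_in_L1 (f : R -> R) (l : R) : measI f -> 0 < l ->
  (\int[mu]_(x in I) (A (`|f x| / l))%:E <= 1)%E -> in_L1 f.
Proof.
move=> mf l0 h; have mI : measurable I by exact: measurable_I01.
have fp : measI_pos (fun x => `|f x| / l).
  split; first by apply: measurable_funM => //; exact: measurableT_comp.
  by move=> x _; rewrite divr_ge0// ltW.
have At1 : 0 <= At 1 := complementary_ge0 yA 1.
have A0 x : 0 <= A (`|f x| / l) by rewrite (young_ge0 yA)// divr_ge0// ltW.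
apply: (@le_lt_trans _ _ (l%:E * \int[mu]_(x in I) ((A (`|f x| / l))%:E + (At 1)%:E))%E).
  rewrite -ge0_integralZl_EFin//; first last.
  - exact: ltW.
  - by apply: emeasurable_funD => //; apply/measurable_EFinP; exact: (measurable_young yA fp).
  - by move=> x _; rewrite -EFinD lee_fin addr_ge0.
  apply: le_integral_ge0 => x Ix; first by rewrite lee_fin.
  rewrite -EFinD -EFinM lee_fin -ler_pdivrMl// mulrC.
  have := young_inequality yA 1 (fp.2 x Ix); by rewrite mulr1.
apply: lte_mul_pinfty => //; first by rewrite lee_fin ltW.
rewrite ge0_integralD//.
- apply: lte_add_pinfty; first exact: le_lt_trans h (ltry _).
  rewrite (integral_cst mu mI); apply: lte_mul_pinfty => //.
  by rewrite (_ : _ I = mu I)// lebesgue_I01 ltry.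
- by move=> x _; rewrite lee_fin.
- by apply/measurable_EFinP; exact: (measurable_young yA fp).
Qed.

(** The Young inequality with one factor of modular at most one and the kernel of modular at most one
bounds the test integrals by [2 * C] times the norm. *)
Lemma modular_bounded (C : R) : 0 < C ->
  (forall tau, I tau -> (kernel_modular C tau <= 1)%E) ->
  bounded_op H (luxemburg_norm A) M.
Proof.
move=> C0 hC; exists (2 * C) => [|f [mf _]]; first by rewrite mulr_gt0.
have mI : measurable I by exact: measurable_I01.
have C20 : 0 < 2 * C by rewrite mulr_gt0.
rewrite -lee_pdivrMl//; apply: le_ereal_inf_tmp => _ [l [l0 hl] <-].
rewrite lee_pdivrMl//.
have hl' : (\int[mu]_(x in I) (A (`|f x| / l))%:E <= 1)%E.
  by move: hl; under eq_integral do rewrite normr_id.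
have f1 := luxemburg_in_L1 mf l0 hl'.
have fp : measI_pos (fun x => `|f x| / l).
  split; first by apply: measurable_funM => //; exact: measurableT_comp.
  by move=> x _; rewrite divr_ge0// ltW.
rewrite -EFinM; apply: marcinkiewicz_Hop_le => // tau It.
have psi0 : 0 <= psi tau by exact: psi_ge0.
rewrite -ge0_integralZl_EFin//; first last.
- apply/measurable_EFinP; apply: measurable_funM; first exact: measurableT_comp.
  exact: measI_hardy_kernel.
- by move=> x _; rewrite lee_fin mulr_ge0 ?hardy_kernel_ge0.
apply: (@le_trans _ _ ((C * l)%:E * \int[mu]_(x in I)
   ((A (`|f x| / l))%:E + (At (psi tau * K tau x / C))%:E))%E).
  rewrite -ge0_integralZl_EFin//; first last.
  - by rewrite mulr_ge0// ltW.
  - apply: emeasurable_funD; apply/measurable_EFinP; first exact: (measurable_young yA fp).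
    by apply: measI_complementary; exact: measI_scaled_kernel.
  - move=> x Ix; rewrite -EFinD lee_fin addr_ge0 ?(complementary_ge0 yA)//.
    by rewrite (young_ge0 yA)// fp.2.
  apply: le_integral_ge0 => x Ix; rewrite -!EFinM -?EFinD lee_fin.
    by rewrite mulr_ge0// mulr_ge0 ?hardy_kernel_ge0.
  have -> : psi tau * (`|f x| * K tau x) = C * l * (`|f x| / l * (psi tau * K tau x / C)).
    by field; rewrite !gt_eqF.
  by rewrite ler_pM2l ?mulr_gt0// (young_inequality yA)// fp.2.
have -> : 2 * C * l = C * l * 2 by ring.
rewrite (EFinM (C * l)); apply: lee_wpmul2l; first by rewrite lee_fin mulr_ge0// ltW.
rewrite ge0_integralD//.
- by rewrite (_ : 2%:E = 1 + 1)%E//; apply: leeD => //; exact: hC.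
- by move=> x Ix; rewrite lee_fin (young_ge0 yA)// fp.2.
- by apply/measurable_EFinP; exact: (measurable_young yA fp).
- by move=> x _; rewrite lee_fin (complementary_ge0 yA).
- by apply/measurable_EFinP; apply: measI_complementary; exact: measI_scaled_kernel.
Qed.

(** Take for [f] the function for which the Young inequality against the kernel is an equality. Boundedness
gives [J + modular <= norm of f <= 1 + J], where [J], the integral of [A] at [f], is finite
because [f] is bounded; subtract [J]. *)
Lemma bounded_modular : bounded_op H (luxemburg_norm A) M ->
  exists2 C : R, 0 < C & forall tau, I tau -> (kernel_modular C tau <= 1)%E.
Proof.
move=> [C C0 hC]; exists C => // tau It; have /I01P[tau0 tau1] := It.
have mI : measurable I by exact: measurable_I01.
have psi0 : 0 <= psi tau by exact: psi_ge0.
pose v s := psi tau * K tau s / C.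
have v0 s : 0 <= v s by rewrite divr_ge0 ?(ltW C0)// mulr_ge0 ?hardy_kernel_ge0.
have mv : measI v by exact: measI_scaled_kernel.
pose g := young_inverse a; pose f s := g (v s).
have gmax_nd x y : x <= y -> g (Num.max x 0) <= g (Num.max y 0).
  move=> xy; apply: (young_inverse_nd yA); first by rewrite le_max lexx orbT.
  by rewrite ge_max !le_max xy lexx orbT.
have fp : measI_pos f.
  split; last by move=> x _; rewrite (young_inverse_ge0 yA).
  apply: (eq_measurable_fun (fun s => (fun y => g (Num.max y 0)) (v s))).
    by move=> x _ /=; rewrite (max_idPl (v0 x)).
  suff mg : measurable_fun setT (fun y : R => g (Num.max y 0)) by exact: measurableT_comp mg mv.
  by apply: nondecreasing_measurable => // x y; exact: gmax_nd.
pose V := psi tau * tau `^ (alpha - 1) / C.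
have vV s : I s -> v s <= V.
  move=> /I01P[s0 s1]; rewrite /v /V ler_wpM2r ?invr_ge0 ?(ltW C0)// ler_wpM2l//.
  have [st|ts] := leP s tau; first exact: hardy_kernel_le.
  apply: (le_trans (hardy_kernel_le_powR _ _ _ _)).
  by apply: ge0_ler_powR_neg => //; [exact: ltW|rewrite subr_le0 ltW].
have fG s : I s -> f s <= g V by move=> Is; apply: (young_inverse_nd yA) => //; exact: vV.
have mAf : measI (fun s => A (f s)) by exact: (measurable_young yA fp).
have Af0 s : I s -> 0 <= A (f s) by move=> Is; rewrite (young_ge0 yA)// fp.2.
pose J := (\int[mu]_(s in I) (A (f s))%:E)%E.
have Jlty : (J < +oo)%E.
  apply: (@le_lt_trans _ _ (\int[mu]_(s in I) (A (g V))%:E)%E).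
    apply: le_integral_ge0 => s Is; rewrite lee_fin ?Af0//.
    by apply: (young_le yA); [exact: fp.2|exact: fG].
  rewrite (integral_cst mu mI); apply: lte_mul_pinfty => //; last first.
    by rewrite (_ : _ I = mu I)// lebesgue_I01 ltry.
  rewrite lee_fin; apply: (young_ge0 yA); apply: (young_inverse_ge0 yA).
  by rewrite divr_ge0 ?(ltW C0)// mulr_ge0 ?powR_ge0.
have J0 : (0 <= J)%E by apply: integral_ge0 => s Is; rewrite lee_fin Af0.
have JE : J = (fine J)%:E by rewrite fineK// ge0_fin_numE.
set j := fine J in JE; have j0 : 0 <= j by rewrite -lee_fin -JE.
(* by convexity, f / m has modular at most j / m, so that m bounds its norm *)
pose m := 1 + j; have m0 : 0 < m by rewrite /m; lra.
have lux : (luxemburg_norm A (fun x => `|f x|%R) <= m%:E)%E.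
  apply: ereal_inf_lbound; exists m => //; split => //.
  apply: (@le_trans _ _ (m^-1%:E * J)%E); last first.
    by rewrite JE -EFinM lee_fin ler_pdivrMl// mulr1 /m; lra.
  rewrite -ge0_integralZl_EFin//; first last.
  - by rewrite invr_ge0 ltW.
  - exact/measurable_EFinP.
  - apply: le_integral_ge0 => s Is; rewrite normr_id (ger0_norm (fp.2 s Is)).
      by rewrite lee_fin (young_ge0 yA)// divr_ge0 ?fp.2// ltW.
    rewrite -EFinM lee_fin ler_pdivlMl//.
    have m1 : 1 <= m by rewrite /m; lra.
    have := young_scale yA m1 (divr_ge0 (fp.2 s Is) (ltW m0)).
    by rewrite mulrCA divff ?gt_eqF// mulr1.
have fX : ri_space (luxemburg_norm A) f.
  by split; [exact: fp.1|rewrite /space_norm (le_lt_trans lux)// ltry].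
have f1 : in_L1 f.
  apply/(in_L1_ge0 fp); apply: (@le_lt_trans _ _ (\int[mu]_(s in I) (g V)%:E)%E).
    by apply: le_integral_ge0 => s Is; rewrite lee_fin ?fp.2 ?fG.
  rewrite (integral_cst mu mI); apply: lte_mul_pinfty => //; last first.
    by rewrite (_ : _ I = mu I)// lebesgue_I01 ltry.
  rewrite lee_fin; apply: (young_inverse_ge0 yA).
  by rewrite divr_ge0 ?(ltW C0)// mulr_ge0 ?powR_ge0.
have h1 : ((psi tau)%:E * \int[mu]_(r in I) (f r * K tau r)%:E <= (C * m)%:E)%E.
  apply: (le_trans (marcinkiewicz_Hop_ge alpha_lt1 beta_gt0 phi_ge0 fp f1 It)).
  apply: (le_trans (hC f fX)); rewrite EFinM; apply: lee_wpmul2l => //.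
  by rewrite lee_fin ltW.
have h2 : (J + kernel_modular C tau <= m%:E)%E.
  have mK : measI (fun r => f r * K tau r).
    by apply: measurable_funM; [exact: fp.1|exact: measI_hardy_kernel].
  have mAt : measI (fun s => At (v s)) by exact: measI_complementary.
  apply: (@le_trans _ _ ((C^-1)%:E * ((psi tau)%:E * \int[mu]_(r in I) (f r * K tau r)%:E))%E); last first.
    by rewrite lee_pdivrMl// -EFinM.
  rewrite -ge0_integralZl_EFin//; first last.
  - exact/measurable_EFinP.
  - by move=> r Ir; rewrite lee_fin mulr_ge0 ?hardy_kernel_ge0// fp.2.
  rewrite -ge0_integralZl_EFin//; first last.
  - by rewrite invr_ge0 ltW.
  - by apply: emeasurable_funM => //; exact/measurable_EFinP.
  - by move=> r Ir; rewrite -EFinM lee_fin mulr_ge0// mulr_ge0 ?hardy_kernel_ge0// fp.2.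
  rewrite /J /kernel_modular -ge0_integralD//; first last.
  - exact/measurable_EFinP.
  - by move=> s _; rewrite lee_fin (complementary_ge0 yA).
  - exact/measurable_EFinP.
  apply: le_integral_ge0 => s Is.
    by rewrite -EFinD lee_fin addr_ge0 ?Af0 ?(complementary_ge0 yA).
  rewrite -EFinD -!EFinM lee_fin; apply: (le_trans (young_equality yA (v0 s))).
  by rewrite /v /f le_eqVlt; apply/orP; left; apply/eqP; rewrite /g /v; field; rewrite gt_eqF.
move: h2; rewrite JE /m EFinD addeC leeD2rE//.
Qed.

End modular.

(** * Fundamental functions of Orlicz spaces *)

Section fundamental_orlicz.
Context {R : realType}.
Local Notation mu := (@lebesgue_measure R).
Local Notation I := (I01 R).
Context (B b : R -> R) (yB : young_density B b).
Local Notation Bt := (complementary B).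

Lemma luxemburg_chi_modular (t l : R) : I t -> 0 < l ->
  (\int[mu]_(x in I) (B (`|chi t x| / l))%:E = (t * B (1 / l))%:E)%E.
Proof.
move=> It l0; have /I01P[t0 t1] := It.
transitivity (\int[mu]_(x in I) ((B (1 / l))%:E * (\1_(`]0%R, t[%classic : set R) x)%:E))%E.
  apply: eq_integral => x _; rewrite -EFinM /chi indicE.
  case: (x \in _); first by rewrite normr1 mulr1.
  by rewrite normr0 mul0r mulr0 (yd_A0 yB).
have mI : measurable I by exact: measurable_I01.
rewrite ge0_integralZl_EFin//; first last.
- by rewrite (young_ge0 yB)// divr_ge0// ltW.
- by apply/measurable_EFinP; exact: measurable_indic.
rewrite integral_indic// setIidl.
  by rewrite [t * _]mulrC EFinM -(lebesgue_itv0 (ltW t0)).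
move=> x /=; rewrite in_itv/= => /andP[x0 xt]; apply/I01P; split => //.
exact: lt_trans t1.
Qed.

Lemma luxemburg_chi_le (t l : R) : I t -> 0 < l ->
  (luxemburg_norm B (chi t) < l%:E)%E -> t * B (1 / l) <= 1.
Proof.
move=> It l0 /ereal_inf_lt[_ [k [k0 hk] <-]]; rewrite lte_fin => kl.
have /I01P[t0 t1] := It.
move: hk; rewrite luxemburg_chi_modular// lee_fin; apply: le_trans.
rewrite ler_pM2l// (young_le yB)//; first by rewrite divr_ge0// ltW.
by rewrite !div1r lef_pV2 ?posrE// ltW.
Qed.

Lemma luxemburg_chi_gt (t l : R) : I t -> 0 < l ->
  (l%:E < luxemburg_norm B (chi t))%E -> 1 < t * B (1 / l).
Proof.
move=> It l0; apply: contraTT; rewrite -leNgt -leNgt => h.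
by apply: ereal_inf_lbound; exists l => //; split => //; rewrite luxemburg_chi_modular// lee_fin.
Qed.

(** Use [s = 1 / l] in the supremum defining the complement, with [l] twice the bound on the norm, so that
[t * B s <= 1] whereas [t * s * (4 * c * z) = 2]. *)
Lemma complementary_fundamental_ge (t z c : R) : I t -> 0 < z -> 0 < c ->
  (luxemburg_norm B (chi t) <= (c * (t * z))%:E)%E -> 1 <= t * Bt (4 * c * z).
Proof.
move=> It z0 c0 h; have /I01P[t0 t1] := It.
have ctz : 0 < c * (t * z) by rewrite !mulr_gt0.
pose l := 2 * (c * (t * z)).
have l0 : 0 < l by rewrite mulr_gt0.
have hl : (luxemburg_norm B (chi t) < l%:E)%E.
  by apply: (le_lt_trans h); rewrite lte_fin /l; lra.
have := luxemburg_chi_le It l0 hl.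
have u0 : 0 < 1 / l by rewrite divr_gt0.
have := complementary_ub yB (4 * c * z) u0.
have E : t * (1 / l * (4 * c * z)) = 2.
  by rewrite /l; field; rewrite !gt_eqF.
move=> h1 h2; have : t * (1 / l * (4 * c * z) - B (1 / l)) <= t * Bt (4 * c * z).
  by rewrite ler_pM2l.
by rewrite mulrBr E; lra.
Qed.

(** With [l] half the bound on the norm, [t * B (1 / l) > 1]. Then [s * (c / 2 * z) - B s] is at most [1 / t]
for [s <= 1 / l], and nonpositive for larger [s] by convexity. *)
Lemma complementary_fundamental_le (t z c : R) : I t -> 0 < z -> 0 < c ->
  ((c * (t * z))%:E <= luxemburg_norm B (chi t))%E -> t * Bt (c / 2 * z) <= 1.
Proof.
move=> It z0 c0 h; have /I01P[t0 t1] := It.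
have ctz : 0 < c * (t * z) by rewrite !mulr_gt0.
pose l := c * (t * z) / 2.
have l0 : 0 < l by rewrite divr_gt0.
have hl : (l%:E < luxemburg_norm B (chi t))%E.
  by apply: lt_le_trans h; rewrite lte_fin /l; lra.
have h1 := luxemburg_chi_gt It l0 hl.
have u0 : 0 < 1 / l by rewrite divr_gt0.
rewrite -ler_pdivlMl// mulr1; apply: complementary_le => u hu.
have E : 1 / l * (c / 2 * z) = t^-1 by rewrite /l; field; rewrite !gt_eqF.
have cz : 0 <= c / 2 * z by rewrite mulr_ge0 ?divr_ge0// ltW.
have Bu := young_ge0 yB (ltW hu).
have [ul|lu] := leP u (1 / l).
  have : u * (c / 2 * z) <= t^-1 by rewrite -E ler_wpM2r.
  lra.
suff : u * (c / 2 * z) <= B u by have := invr_gt0 t; rewrite t0 => ?; lra.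
have D1 : 1 <= u * l by move: lu; rewrite ltr_pdivrMr// => /ltW.
have := young_scale yB D1 (ltW u0); rewrite [u * l * (1 / l)](_ : _ = u); last first.
  by field; rewrite gt_eqF.
apply: le_trans; have Bl : t^-1 <= B (1 / l).
  by rewrite -[leLHS]mulr1 ler_pdivrMl// ltW.
have -> : u * (c / 2 * z) = u * l * t^-1 by rewrite /l; field; rewrite !gt_eqF.
by rewrite ler_wpM2l// mulr_ge0// ltW.
Qed.

End fundamental_orlicz.

(** * From modulars of powers to the Hardy-type integral *)

Section change_of_variables.
Context {R : realType}.
Local Notation mu := (@lebesgue_measure R).
Context (alpha : R) (alpha_lt1 : alpha < 1).
Local Notation p := (1 / (1 - alpha)).

Let a1_gt0 : 0 < 1 - alpha. Proof. by rewrite subr_gt0. Qed.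

Lemma powRK_conj (x : R) : 0 <= x -> (x `^ (1 - alpha)) `^ p = x.
Proof. by move=> x0; rewrite -powRrM mul1r mulfV ?gt_eqF// powRr1. Qed.

(** Substitution [u = T * (tau / s) `^ (1 - alpha)], a decreasing function of [s] taking the value [T] at
[tau]; the continuity of [G] is that of a complementary function in the applications. *)
Lemma hardy_substitution (G : R -> R) (tau b T : R) : 0 < tau -> tau < b -> 0 < T ->
  continuous G -> (forall x, 0 <= G x) ->
  (\int[mu]_(u in `[(T * (tau / b) `^ (1 - alpha))%R, T]%classic) (G u / u `^ (p + 1))%:E =
   ((1 - alpha) / (tau * T `^ p))%:E *
   \int[mu]_(s in `[tau, b]%classic) (G (T * (tau / s) `^ (1 - alpha)))%:E)%E.
Proof.
move=> tau0 tb T0 cG G0; have b0 := lt_trans tau0 tb.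
pose c := T * tau `^ (1 - alpha).
have c0 : 0 < c by rewrite mulr_gt0 ?powR_gt0.
pose F (s : R) := c * s `^ (alpha - 1).
have FE s : 0 < s -> F s = T * (tau / s) `^ (1 - alpha).
  move=> s0; rewrite /F /c -mulrA; congr (_ * _).
  rewrite powRM ?invr_ge0 ?(ltW tau0) ?(ltW s0)//; congr (_ * _).
  by rewrite -(powR_inv1 (ltW s0)) -powRrM mulN1r opprB.
have Ft : F tau = T by rewrite FE// divff ?gt_eqF// powR1 mulr1.
have Fgt0 s : 0 < s -> 0 < F s by move=> s0; rewrite mulr_gt0// powR_gt0.
pose D (s : R) := c * ((alpha - 1) * s `^ (alpha - 1 - 1)).
have dF (s : R) : 0 < s -> is_derive s 1 (F : R -> R^o) (D s).
  by move=> s0; have := is_deriveZ c (is_derive1_powR (alpha - 1) s0).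
have F'E (s : R) : 0 < s -> F^`()%classic s = D s.
  by move=> s0; rewrite derive1E; apply: derive_val; exact: dF.
have cD (x : R) : 0 < x -> F^`()%classic y @[y --> x] --> D x.
  move=> x0.
  have cDx : D y @[y --> x] --> D x.
    by apply: cvgMl_tmp; apply: cvgMl_tmp; exact: powR_continuous_at.
  apply: (@cvg_trans _ (D y @[y --> x])); last exact: cDx.
  by apply: near_eq_cvg; apply: filterS (lt_nbhsr x0) => y y0; rewrite F'E.
have gt0_in x : x \in `[tau, b] -> 0 < x.
  by rewrite in_itv/= => /andP[tx _]; exact: lt_le_trans tx.
pose G1 u := G u / u `^ (p + 1).
rewrite -FE// -[X in `[F b, X]%classic]Ft -/(G1 _).
rewrite (@integration_by_substitution_decreasing _ F G1 tau b); first last.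
- apply: continuous_in_subspaceT => u /set_mem; rewrite /= in_itv/= => /andP[Fbu _].
  have u0 := lt_le_trans (Fgt0 b b0) Fbu.
  rewrite /G1; apply: cvgM; first exact: cG.
  by apply: cvgV; [rewrite gt_eqF// powR_gt0|exact: powR_continuous_at].
- split.
  + move=> x; rewrite in_itv/= => /andP[tx xb].
    by have [] := dF x (lt_trans tau0 tx).
  + apply: cvg_at_right_filter; apply: cvgMl_tmp; exact: powR_continuous_at.
  + apply: cvg_at_left_filter; apply: cvgMl_tmp; exact: powR_continuous_at.
- by apply/cvg_ex; exists (D b); apply: cvg_at_left_filter; exact: cD.
- by apply/cvg_ex; exists (D tau); apply: cvg_at_right_filter; exact: cD.
- move=> x; rewrite in_itv/= => /andP[tx xb]; have x0 := lt_trans tau0 tx.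
  by rewrite /continuous_at F'E//; exact: cD.
- move=> x y /gt0_in x0 /gt0_in y0 xy; rewrite /F ltr_pM2l//.
  rewrite -(opprB 1 alpha) !powRN ltf_pV2 ?posrE ?powR_gt0//.
  by apply: gt0_ltr_powR; rewrite ?nnegrE// ltW.
- exact: ltW.
rewrite -ge0_integralZl_EFin//; first last.
- by rewrite divr_ge0 ?ltW// mulr_gt0// powR_gt0.
- apply/measurable_EFinP.
  have mG : measurable_fun setT G by exact: continuous_measurable_fun.
  apply: (eq_measurable_fun (fun s => G (F s))).
    by move=> s /set_mem/gt0_in s0; rewrite FE.
  apply: (measurableT_comp mG); apply: measurable_funM => //.
  by apply: measurable_funTS; exact: measurable_powR.
- by move=> x _; rewrite lee_fin.
apply: eq_integral => s hs; have s0 := gt0_in _ (set_mem hs).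
rewrite -EFinM; congr EFin; rewrite /= /G1 -FE//.
have Fs0 := Fgt0 s s0.
have DE : D s = (alpha - 1) * F s / s.
  rewrite /D /F powRD; last by apply/implyP => _; rewrite gt_eqF.
  by rewrite (powR_inv1 (ltW s0)); field; rewrite gt_eqF.
have Fp : F s `^ (p + 1) = T `^ p * (tau / s) * F s.
  rewrite powRD; last by apply/implyP => _; rewrite gt_eqF.
  rewrite (powRr1 (ltW Fs0)); congr (_ * _).
  by rewrite FE// powRM ?powR_ge0 ?(ltW T0)// powRK_conj// divr_ge0 ?ltW.
transitivity (G (F s) / F s `^ (p + 1) * - F^`()%classic s); first by [].
rewrite F'E// DE Fp; have Tp : T `^ p != 0 by rewrite gt_eqF// powR_gt0.
move: Tp; set Tp := T `^ p; set g := G _; set Fs := F s in Fs0 * => Tp0.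
by field; rewrite Tp0 !gt_eqF.
Qed.

End change_of_variables.

(** * The modular bound and the integral condition *)

Section integral_condition.
Context {R : realType}.
Local Notation mu := (@lebesgue_measure R).
Local Notation I := (I01 R).
Context (alpha beta : R).
Context (alpha_gt0 : 0 < alpha) (alpha_lt1 : alpha < 1) (beta_gt0 : 0 < beta)
  (alpha_beta : 1 <= alpha + 1 / beta).
Context (phi : R -> R) (fund_phi : concave_fundamental phi).
Context (A a : R -> R) (yA : young_density A a).
Context (B b : R -> R) (yB : young_density B b).
Local Notation psi := (psi beta phi).
Local Notation K := (hardy_kernel alpha beta).
Local Notation theta := (theta alpha beta phi).
Local Notation At := (complementary A).
Local Notation Bt := (complementary B).
Local Notation modular := (kernel_modular alpha beta phi A).
Local Notation p := (1 / (1 - alpha)).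

Lemma subset_integral_ge0 (D E : set R) (f : R -> \bar R) : D `<=` E ->
  (forall x, E x -> 0 <= f x)%E ->
  (\int[mu]_(x in D) f x <= \int[mu]_(x in E) f x)%E.
Proof.
move=> DE f0; rewrite integral_mkcond [leRHS]integral_mkcond.
apply: le_integral_ge0 => x _; rewrite !patchE.
  by case: ifPn => // /set_mem/DE/f0.
case: ifPn => [/set_mem Dx|_]; first by rewrite mem_set//; exact: DE.
by case: ifPn => // /set_mem/f0.
Qed.

Let At0 t : 0 <= At t := complementary_ge0 yA t.
Let p_gt0 : 0 < p. Proof. by rewrite divr_gt0// subr_gt0. Qed.
Let a1_gt0 : 0 < 1 - alpha. Proof. by rewrite subr_gt0. Qed.

Lemma integral_plateau (c s : R) : 0 <= c -> I s ->
  (\int[mu]_(x in I) (if x < s then c else 0)%:E = (s * c)%:E)%E.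
Proof.
move=> c0 Is; have /I01P[s0 s1] := Is.
transitivity (\int[mu]_(x in `]0%R, s[%classic) c%:E)%E.
  rewrite integral_mkcond [RHS]integral_mkcond; apply: eq_integral => x _.
  rewrite !patchE /I01 !mem_setE !in_itv/=.
  case: (ltP 0 x) => x0 //=; case: (ltP x s) => xs //=.
    by rewrite (lt_trans xs s1).
  by rewrite if_same.
transitivity (c%:E * mu `]0%R, s[%classic)%E; first by rewrite -integral_cst.
by rewrite lebesgue_itv0 ?ltW// -EFinM mulrC.
Qed.

(** Choose [sigma >= tau] almost attaining the supremum in [theta tau]. The modular at [sigma] bounds the
integral over [(sigma, 1)] directly; on [(tau, sigma)] the integrand is bounded by its value on the
half interval [(sigma / 2, sigma)], which the modular at [sigma] controls as well. *)
Lemma modular_theta_le (C : R) : 0 < C -> (forall tau, I tau -> (modular C tau <= 1)%E) ->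
  forall L tau, 2 * C / 2^-1 `^ (1 / beta) <= L -> I tau ->
  (\int[mu]_(s in `[tau, 1%R]%classic) (At (theta tau / L * (tau / s) `^ (1 - alpha)))%:E <= 3%:E)%E.
Proof.
move=> C0 hC L tau hL It; have /I01P[tau0 tau1] := It.
set k : R := 2^-1 `^ (1 / beta) in hL.
have k0 : 0 < k by rewrite powR_gt0.
have L0 : 0 < L by apply: lt_le_trans hL; rewrite divr_gt0// mulr_gt0.
have k1 : k <= 1.
  have := @ler_powR_base _ (1 / beta) 2^-1 1; rewrite powR1; apply; first by rewrite divr_ge0// ltW.
    by rewrite invr_ge0.
  by rewrite invf_le1// ler1n.
have mI : measurable I by exact: measurable_I01.
have th0 : 0 < theta tau by exact: theta_gt0.
have [sigma [Is ts] hs] : exists2 sigma, I sigma /\ tau <= sigma &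
    theta tau / 2 <= psi sigma * sigma `^ (alpha - 1).
  apply: contrapT => h; suff : theta tau <= theta tau / 2 by lra.
  apply: theta_le => // s Is ts; rewrite leNgt; apply/negP => /ltW hs.
  by apply: h; exists s.
have /I01P[s0 s1] := Is.
have psi0 : 0 < psi sigma by exact: psi_gt0.
pose m := psi sigma * sigma `^ (alpha - 1) * k / C.
have Lm : theta tau / L <= m.
  rewrite ler_pdivrMr//; apply: (@le_trans _ _ (m * (2 * C / k))); last first.
    by rewrite ler_wpM2l// /m divr_ge0 ?(ltW C0)// mulr_ge0 ?(ltW k0)// mulr_ge0 ?powR_ge0// ltW.
  have -> : m * (2 * C / k) = 2 * (psi sigma * sigma `^ (alpha - 1)).
    by rewrite /m; field; rewrite !gt_eqF.
  by lra.
have m0 : 0 <= m by apply: le_trans Lm; rewrite divr_ge0 ?(ltW L0)// ltW.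
have mA : measurable_fun setT At by exact: (measurable_complementary yA).
have mAK : measI (fun s => At (psi sigma * K sigma s / C)).
  exact: (measI_complementary yA (measI_scaled_kernel _ _ _ _ _)).
(* the modular over the half interval below sigma, where the argument is at least m *)
have plateau : sigma * At m <= 2.
  have : ((At m)%:E * mu `](sigma / 2)%R, sigma[%classic <= 1)%E.
    rewrite -(integral_cst mu (measurable_itv _)).
    apply: le_trans (hC sigma Is); rewrite /kernel_modular.
    apply: (@le_trans _ _ (\int[mu]_(s in `](sigma / 2)%R, sigma[%classic) (At (psi sigma * K sigma s / C))%:E)%E).
      apply: le_integral_ge0 => s; rewrite /= in_itv/= => /andP[h1 h2]; rewrite lee_fin//.
      apply: (complementary_nd yA); rewrite /m ler_pM2r ?invr_gt0// -mulrA ler_pM2l// mulrC.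
      by apply: hardy_kernel_ge => //; exact: ltW.
    apply: subset_integral_ge0 => [s|s _]; last by rewrite lee_fin.
    by rewrite /= in_itv/= => /andP[h1 h2]; apply/I01P; split; lra.
  rewrite lebesgue_measure_itv/= lte_fin.
  have -> : sigma / 2 < sigma by lra.
  rewrite -EFinB -EFinM lee_fin => h; have : At m * (sigma - sigma / 2) = sigma * At m / 2 by field.
  lra.
have pt s : tau <= s -> s < 1 -> At (theta tau / L * (tau / s) `^ (1 - alpha)) <=
    At (psi sigma * K sigma s / C) + (if s < sigma then At m else 0).
  move=> tss ss1; have ss0 := lt_le_trans tau0 tss.
  have q0 : 0 <= tau / s by rewrite divr_ge0// ltW.
  have hm : theta tau / L * (tau / s) `^ (1 - alpha) <= m * (tau / s) `^ (1 - alpha).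
    by rewrite ler_wpM2r// powR_ge0.
  case: ltP => ssig.
    rewrite -[leLHS]add0r; apply: lerD => //; apply: (complementary_nd yA).
    apply: (le_trans hm); rewrite ler_piMr//.
    have := @ler_powR_base _ (1 - alpha) (tau / s) 1; rewrite powR1; apply => //; first exact: ltW.
    by rewrite ler_pdivrMr// mul1r.
  rewrite addr0; apply: (complementary_nd yA); apply: (le_trans hm).
  apply: (@le_trans _ _ (m * (sigma / s) `^ (1 - alpha))).
    rewrite ler_wpM2l//; apply: (@ler_powR_base _) => //; first exact: ltW.
    by rewrite ler_pM2r// invr_gt0.
  rewrite hardy_kernel_eq_powR// /m -!mulrA ler_pM2l//.
  rewrite (powRM (1 - alpha) (ltW s0)) ?invr_ge0 ?(ltW ss0)//.
  rewrite -(powR_inv1 (ltW ss0)) -powRrM mulN1r opprB.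
  rewrite -(opprB 1 alpha) !powRN.
  have sp : sigma `^ (1 - alpha) != 0 by rewrite gt_eqF// powR_gt0.
  have -> : (sigma `^ (1 - alpha))^-1 * (k * (C^-1 * (sigma `^ (1 - alpha) * (s `^ (1 - alpha))^-1))) =
     k * ((s `^ (1 - alpha))^-1 * C^-1).
    by field; rewrite sp !gt_eqF// powR_gt0.
  by rewrite ler_piMl// mulr_ge0 ?invr_ge0 ?powR_ge0// ltW.
rewrite -integral_itv_bndo_bndc; last first.
  apply/measurable_EFinP; apply: nonincreasing_on_measurable; first exact: interval_is_interval.
  move=> x y; rewrite /= !in_itv/= => /andP[tx _] /andP[ty _] xy.
  have x0 := lt_le_trans tau0 tx; have y0 := lt_le_trans tau0 ty.
  apply: (complementary_nd yA); rewrite ler_wpM2l ?divr_ge0 ?(ltW th0) ?(ltW L0)//.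
  apply: ler_powR_base; [exact: ltW|by rewrite divr_ge0 ?(ltW tau0) ?(ltW y0)|].
  by rewrite ler_pM2l// lef_pV2 ?posrE.
apply: (@le_trans _ _ (\int[mu]_(s in I) ((At (psi sigma * K sigma s / C))%:E +
   (if s < sigma then At m else 0)%:E))%E).
  apply: (@le_trans _ _ (\int[mu]_(s in `[tau, 1%R[%classic) ((At (psi sigma * K sigma s / C))%:E +
   (if s < sigma then At m else 0)%:E))%E).
    apply: le_integral_ge0 => s; rewrite /= in_itv/= => /andP[h1 h2]; rewrite lee_fin//.
    exact: pt.
  apply: subset_integral_ge0 => s.
    by rewrite /= in_itv/= => /andP[h1 h2]; apply/I01P; split => //; exact: lt_le_trans h1.
  by move=> _; rewrite -EFinD lee_fin addr_ge0//; case: ifP.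
rewrite ge0_integralD//.
- by rewrite integral_plateau// (_ : 3%:E = 1 + 2%:E)%E; [apply: leeD; [exact: hC|rewrite lee_fin]|rewrite -EFinD; congr EFin; ring].
- by move=> x _; rewrite lee_fin.
- exact/measurable_EFinP.
- by move=> x _; rewrite lee_fin; case: ifP.
- apply/measurable_EFinP; apply: measurable_fun_if => //.
  exact: measurable_fun_ltr.
Qed.

(** For given [t] choose [tau] with [theta tau / L] between [t] and [2 * t], which is possible because [theta]
is unbounded and at most doubles when its argument is halved; then substitute. *)
Lemma hardy_integral_condition (C : R) :
  0 < C -> (forall tau, I tau -> (modular C tau <= 1)%E) ->
  (forall N : R, exists2 tau, I tau & forall s, I s -> s <= tau -> N <= theta s) ->
  forall c3, 0 < c3 -> (forall tau, I tau -> 1 <= tau * Bt (c3 * theta tau)) ->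
  exists C c : R, [/\ 0 < C, 0 < c &
    forall t : R, 2 < t ->
      (\int[mu]_(s in `[1%R, t]%classic) (At s / s `^ (p + 1))%:E
       <= (c * (Bt (C * t) / t `^ p))%:E)%E].
Proof.
move=> C0 hC unb c3 c30 hB.
(* the three bounds make modular_theta_le applicable, the substituted interval start below 1, and theta (1 / 2) / L at most 1 *)
pose L := Num.max (2 * C / 2^-1 `^ (1 / beta)) (Num.max (2 * phi (1 / 2)) (theta (1 / 2))).
have hL1 : 2 * C / 2^-1 `^ (1 / beta) <= L by rewrite le_max lexx.
have hL2 : 2 * phi (1 / 2) <= L by rewrite !le_max lexx orbT.
have hL3 : theta (1 / 2) <= L by rewrite !le_max lexx !orbT.
have L0 : 0 < L by apply: lt_le_trans hL1; rewrite !(divr_gt0, mulr_gt0)// powR_gt0.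
exists (2 * c3 * L), 3; split; rewrite ?mulr_gt0// => t t2.
have t0 : 0 < t by lra.
(* tau is the largest dyadic point at which theta is at least t * L; it is not 1/2 because t > 1 *)
pose tau_ n : R := 2^-1 ^+ n.+1.
have tau_I n : I (tau_ n).
  apply/I01P; rewrite /tau_; split; first by rewrite exprn_gt0.
  by rewrite exprn_ilt1//; lra.
have exn : exists n, t * L <= theta (tau_ n).
  have [z Iz hz] := unb (t * L); have /I01P[z0 z1] := Iz.
  pose n := (Num.truncn z^-1).+1; exists n; apply: hz => //.
  rewrite /tau_ exprVn -[leRHS]invrK lef_pV2 ?posrE ?invr_gt0 ?exprn_gt0//.
  apply: (@le_trans _ _ n%:R); first by apply: ltW; exact: truncnS_gt.
  by rewrite -natrX ler_nat (leq_trans (leqnSn n))// ltnW// ltn_expl.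
case: (ex_minnP exn) => [[|k]] hk mink.
  have E : tau_ 0%N = 1 / 2 by rewrite /tau_ expr1 div1r.
  have Lt : L < t * L by rewrite ltr_pMl//; lra.
  rewrite E in hk; by have := lt_le_trans Lt (le_trans hk hL3); rewrite ltxx.
set tau := tau_ k.+1 in hk; have It : I tau := tau_I _; have /I01P[tau0 tau1] := It.
have th0 : 0 < theta tau by exact: theta_gt0.
have hk2 : theta tau <= 2 * t * L.
  have nk : theta (tau_ k) < t * L.
    by rewrite ltNge; apply/negP => /mink; rewrite ltnn.
  have tE : tau_ k = 2 * tau by rewrite /tau /tau_ [in RHS]exprS; field.
  have tt : tau <= tau_ k by rewrite tE; lra.
  have := mul_theta_nondecreasing alpha_gt0 alpha_lt1 beta_gt0 fund_phi It (tau_I k) tt.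
  rewrite {1}tE -mulrA mulrCA ler_pM2l//; lra.
pose T := theta tau / L.
have T0 : 0 < T by rewrite divr_gt0.
have tT : t <= T by rewrite ler_pdivlMr.
have sub := hardy_substitution alpha_lt1 tau0 tau1 T0 (complementary_continuous yA) At0.
apply: (@le_trans _ _ (\int[mu]_(u in `[(T * (tau / 1) `^ (1 - alpha))%R, T]%classic) (At u / u `^ (p + 1))%:E)%E).
  apply: subset_integral_ge0 => [x|x _]; last by rewrite lee_fin divr_ge0// powR_ge0.
  rewrite /= !in_itv/= => /andP[x1 xt]; rewrite (le_trans xt tT) andbT.
  apply: le_trans x1; rewrite divr1 /T mulrAC ler_pdivrMr// mul1r.
  apply: le_trans hL2; rewrite -ler_pdivlMr ?powR_gt0// -powRN opprB.
  exact: theta_le_powR.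
rewrite sub.
apply: (@le_trans _ _ (((1 - alpha) / (tau * T `^ p))%:E * 3%:E)%E).
  apply: lee_wpmul2l; first by rewrite lee_fin divr_ge0 ?(ltW a1_gt0)// mulr_ge0 ?powR_ge0 ?(ltW tau0).
  exact: modular_theta_le C0 hC L tau hL1 It.
rewrite -EFinM lee_fin mulrC ler_pM2l//.
have hBt : tau^-1 <= Bt (2 * c3 * L * t).
  rewrite -[leLHS]mulr1 ler_pdivrMl//; apply: (le_trans (hB tau It)).
  rewrite ler_pM2l//; apply: (complementary_nd yB).
  have -> : 2 * c3 * L * t = c3 * (2 * t * L) by ring.
  by rewrite ler_pM2l.
have tTp : t `^ p <= T `^ p by apply: ler_powR_base => //; [exact: ltW|exact: ltW].
have tp0 : 0 < t `^ p by rewrite powR_gt0.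
have Tp0 : 0 < T `^ p by rewrite powR_gt0.
rewrite invfM mulrA; apply: ler_pM.
- by rewrite mulr_ge0 ?(ltW a1_gt0)// invr_ge0 ltW.
- by rewrite invr_ge0 ltW.
- apply: le_trans hBt; rewrite ler_piMl ?invr_ge0 ?(ltW tau0)//.
  by rewrite gerBl ltW.
- by rewrite lef_pV2.
Qed.

(** Put [T = theta sigma / L]. If [T <= 2] the integrand of the modular is bounded. Otherwise it is split at
[sigma] and at the point [bb] where [T * (sigma / s) `^ (1 - alpha)] has decreased to [1]: between the two
the condition at [T] applies after substitution, and on [(0, sigma)] the condition at [2 * T]. The
resulting bound [D] is absorbed in the constant by convexity. *)
Lemma modular_of_integral_condition (C c c4 : R) :
  0 < C -> 0 < c -> 0 < c4 ->
  (forall tau, I tau -> tau * Bt (c4 * theta tau) <= 1) ->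
  (forall t : R, 2 < t ->
      (\int[mu]_(s in `[1%R, t]%classic) (At s / s `^ (p + 1))%:E
       <= (c * (Bt (C * t) / t `^ p))%:E)%E) ->
  exists2 C' : R, 0 < C' & forall tau, I tau -> (modular C' tau <= 1)%E.
Proof.
move=> C0 c0 c40 hB cond; have mI : measurable I by exact: measurable_I01.
(* chosen so that 2 * C * T = c4 * theta sigma, where the complement of B is at most 1 / sigma *)
pose L := 2 * C / c4; have L0 : 0 < L by rewrite divr_gt0// mulr_gt0.
pose D := At 2 + At 1 + p * c + 2 * c + 1.
have pc0 : 0 < p * c by rewrite mulr_gt0.
have D1 : 1 <= D by rewrite /D; have := At0 2; have := At0 1; lra.
have D0 : 0 < D by lra.
exists (L * D) => [|sigma Is]; first by rewrite mulr_gt0.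
have /I01P[s0 s1] := Is.
have th0 : 0 < theta sigma by exact: theta_gt0.
have psi0 : 0 <= psi sigma by exact: psi_ge0.
pose T := theta sigma / L; have T0 : 0 < T by rewrite divr_gt0.
have psith : psi sigma * sigma `^ (alpha - 1) <= theta sigma.
  by apply: theta_ub.
have le1 s : I s -> s <= sigma -> psi sigma * K sigma s / L <= T.
  move=> /I01P[ss0 _] ss; rewrite /T ler_pM2r ?invr_gt0//; apply: le_trans psith.
  by rewrite ler_wpM2l// hardy_kernel_le.
have le2 s : I s -> sigma <= s -> psi sigma * K sigma s / L <= T * (sigma / s) `^ (1 - alpha).
  move=> /I01P[ss0 _] ss; rewrite /T [leRHS]mulrAC ler_pM2r ?invr_gt0//.
  rewrite hardy_kernel_eq_powR// powRM ?invr_ge0 ?(ltW s0) ?(ltW ss0)//.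
  rewrite -(powR_inv1 (ltW ss0)) -powRrM mulN1r opprB mulrA.
  rewrite ler_wpM2r ?powR_ge0// -ler_pdivrMr ?powR_gt0// -powRN opprB.
  exact: psith.
have BT : sigma * Bt (2 * C * T) <= 1.
  have -> : 2 * C * T = c4 * theta sigma by rewrite /T /L; field; rewrite !gt_eqF.
  exact: hB.
have mK l : measI (fun s => At (psi sigma * K sigma s / l)).
  exact: (measI_complementary yA (measI_scaled_kernel _ _ _ _ _)).
suff main : (\int[mu]_(s in I) (At (psi sigma * K sigma s / L))%:E <= D%:E)%E.
  rewrite /kernel_modular; apply: (@le_trans _ _ ((D^-1)%:E * \int[mu]_(s in I) (At (psi sigma * K sigma s / L))%:E)%E).
    rewrite -ge0_integralZl_EFin//; first last.
    - by rewrite invr_ge0 ltW.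
    - by apply/measurable_EFinP; exact: mK.
    - by move=> x _; rewrite lee_fin.
    apply: le_integral_ge0 => s _; first by rewrite lee_fin.
    rewrite -EFinM lee_fin ler_pdivlMl//.
    apply: (le_trans (complementary_scale yA _ D1)); rewrite le_eqVlt; apply/orP; left; apply/eqP.
    by congr At; field; rewrite !gt_eqF.
  by rewrite lee_pdivrMl// mule1.
have cstI (r : R) : (\int[mu]_(s in I) r%:E = r%:E)%E.
  transitivity (r%:E * mu I)%E; first by rewrite -integral_cst.
  by rewrite lebesgue_I01 mule1.
have [T2|T2] := leP T 2.
  apply: (@le_trans _ _ (\int[mu]_(s in I) (At 2)%:E)%E).
    apply: le_integral_ge0 => s Is'; rewrite lee_fin//; apply: (complementary_nd yA).
    apply: le_trans T2; have [/ltW ss|ss] := ltP s sigma; first exact: le1.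
    apply: (le_trans (le2 _ Is' ss)); rewrite ler_piMr ?(ltW T0)//.
    have /I01P[ss0 _] := Is'.
    have := @ler_powR_base _ (1 - alpha) (sigma / s) 1; rewrite powR1; apply; first exact: ltW.
      by rewrite divr_ge0 ?(ltW s0) ?(ltW ss0).
    by rewrite ler_pdivrMr// mul1r.
  by rewrite cstI lee_fin /D; have := At0 1; lra.
pose X := At T; pose bb := sigma * T `^ p.
have Tp0 : 0 < T `^ p by rewrite powR_gt0.
have Tp1 : 1 < T `^ p.
  have h : 1 `^ p < T `^ p by apply: gt0_ltr_powR => //; rewrite ?nnegrE ?ler01 ?(ltW T0)//; lra.
  by rewrite powR1 in h.
have sb : sigma < bb by rewrite /bb ltr_pMr.
have bb0 : 0 < bb by exact: lt_trans sb.
have lowE : T * (sigma / bb) `^ (1 - alpha) = 1.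
  have -> : sigma / bb = (T `^ p)^-1 by rewrite /bb; field; rewrite !gt_eqF.
  rewrite -powRN -powRrM.
  have -> : - p * (1 - alpha) = -1 by field; rewrite gt_eqF.
  by rewrite (powR_inv1 (ltW T0)) divff// gt_eqF.
have sub := hardy_substitution alpha_lt1 s0 sb T0 (complementary_continuous yA) At0.
pose Z := (\int[mu]_(s in `[sigma, bb]%classic) (At (T * (sigma / s) `^ (1 - alpha)))%:E)%E.
(* on this interval the modular is the integral of the condition, after substitution *)
have hZ : (Z <= (p * c)%:E)%E.
  have k0 : 0 < (1 - alpha) / (sigma * T `^ p) by rewrite divr_gt0// mulr_gt0.
  rewrite -(@lee_pmul2l _ ((1 - alpha) / (sigma * T `^ p))%:E)//.
  rewrite /Z -sub lowE; apply: (le_trans (cond T T2)).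
  rewrite -EFinM lee_fin.
  have -> : (1 - alpha) / (sigma * T `^ p) * (p * c) = c * (sigma^-1 / T `^ p).
    by field; rewrite !gt_eqF.
  rewrite ler_pM2l// ler_pM2r ?invr_gt0//.
  rewrite -[leRHS]mulr1 ler_pdivlMl//; apply: le_trans BT; rewrite ler_pM2l//.
  by apply: (complementary_nd yB); rewrite ler_pM2r//; lra.
(* monotonicity of the complement on [T, 2 * T] turns the condition into a pointwise bound *)
have hX : sigma * X <= 2 * c.
  have TT : 2 < 2 * T by lra.
  have h := cond (2 * T) TT.
  have T2p0 : 0 < (2 * T) `^ p by rewrite powR_gt0// mulr_gt0.
  have T2p1 : (2 * T) `^ (p + 1) = (2 * T) `^ p * (2 * T).
    rewrite powRD; last by apply/implyP => _; rewrite gt_eqF// mulr_gt0.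
    by rewrite powRr1// mulr_ge0// ltW.
  have h1 : ((X / (2 * T) `^ (p + 1) * T)%:E <= (c * (Bt (C * (2 * T)) / (2 * T) `^ p))%:E)%E.
    apply: le_trans h.
    apply: (@le_trans _ _ (\int[mu]_(s in `[T, (2 * T)%R]%classic) (X / (2 * T) `^ (p + 1))%:E)%E).
      rewrite (integral_cst mu (measurable_itv _)) EFinM; apply: lee_wpmul2l.
        by rewrite lee_fin divr_ge0 ?powR_ge0// /X.
      rewrite (_ : _ `[T, (2 * T)%R]%classic = mu `[T, (2 * T)%R]%classic)//.
      rewrite lebesgue_measure_itv/= lte_fin.
      have -> : T < 2 * T by lra.
      by rewrite -EFinB lee_fin; lra.
    apply: (@le_trans _ _ (\int[mu]_(s in `[T, (2 * T)%R]%classic) (At s / s `^ (p + 1))%:E)%E).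
      apply: le_integral_ge0 => s; rewrite /= in_itv/= => /andP[Ts sT].
        by rewrite lee_fin divr_ge0 ?powR_ge0// /X.
      have ss0 := lt_le_trans T0 Ts.
      rewrite lee_fin; apply: ler_pM.
      - by rewrite /X.
      - by rewrite invr_ge0 powR_ge0.
      - exact: (complementary_nd yA).
      - rewrite lef_pV2 ?posrE ?powR_gt0//; last exact: lt_trans TT.
        by apply: ler_powR_base => //; [rewrite addr_ge0// ltW|exact: ltW].
    apply: subset_integral_ge0 => [s|s _]; last by rewrite lee_fin divr_ge0 ?powR_ge0.
    by rewrite /= !in_itv/= => /andP[Ts ->]; rewrite andbT; lra.
  move: h1; rewrite lee_fin T2p1.
  have -> : X / ((2 * T) `^ p * (2 * T)) * T = X / 2 / (2 * T) `^ p.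
    by field; rewrite !gt_eqF.
  rewrite mulrA ler_pM2r ?invr_gt0//.
  have -> : C * (2 * T) = 2 * C * T by ring.
  move=> h1; have h2 : sigma * (X / 2) <= sigma * (c * Bt (2 * C * T)) by rewrite ler_pM2l.
  have h3 : c * (sigma * Bt (2 * C * T)) <= c * 1 by rewrite ler_pM2l.
  move: h2 h3; rewrite [sigma * (X / 2)]mulrA [sigma * (c * _)]mulrCA; lra.
have mtail : measurable_fun I (fun s => ((fun s => (At (T * (sigma / s) `^ (1 - alpha)))%:E) \_ `[sigma, bb]) s).
  apply: measurable_funTS; apply/(measurable_restrictT _ (measurable_itv _)).
  apply/measurable_EFinP; apply: nonincreasing_on_measurable; first exact: interval_is_interval.
  move=> x y; rewrite /= !in_itv/= => /andP[tx _] /andP[ty _] xy.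
  have x0 := lt_le_trans s0 tx; have y0 := lt_le_trans s0 ty.
  apply: (complementary_nd yA); rewrite ler_wpM2l ?(ltW T0)//.
  apply: ler_powR_base; [exact: ltW|by rewrite divr_ge0 ?(ltW s0) ?(ltW y0)|].
  by rewrite ler_pM2l// lef_pV2 ?posrE.
have tail0 s : (0 <= ((fun s => (At (T * (sigma / s) `^ (1 - alpha)))%:E) \_ `[sigma, bb]) s)%E.
  by rewrite patchE; case: ifP => // _; rewrite lee_fin.
have mX : measurable_fun I (fun s : R => (if s < sigma then X else 0)%:E).
  by apply/measurable_EFinP; apply: measurable_fun_if => //; exact: measurable_fun_ltr.
have X0 s : (0 <= (if s < sigma then X else 0 : R)%:E)%E.
  by rewrite lee_fin; case: ifP => // _; rewrite /X.
apply: (@le_trans _ _ (\int[mu]_(s in I) ((if s < sigma then X else 0)%:E + ((At 1)%:E +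
    ((fun s => (At (T * (sigma / s) `^ (1 - alpha)))%:E) \_ `[sigma, bb]) s)))%E).
  apply: le_integral_ge0 => s Is'; first by rewrite lee_fin.
  have /I01P[ss0 _] := Is'.
  case: ltP => ss.
    apply: (@le_trans _ _ X%:E); first by rewrite lee_fin; apply: (complementary_nd yA); apply: le1 => //; exact: ltW.
    by rewrite leeDl// adde_ge0 ?lee_fin.
  rewrite add0e patchE; case: ifPn => hs.
    apply: (@le_trans _ _ (At (T * (sigma / s) `^ (1 - alpha)))%:E).
      by rewrite lee_fin; apply: (complementary_nd yA); exact: le2.
    by rewrite leeDr// lee_fin.
  have bs : bb < s.
    rewrite ltNge; apply/negP => sbb; case/negP: hs; apply/mem_set.
    by rewrite /= in_itv/= ss.
  rewrite adde0 lee_fin; apply: (complementary_nd yA); apply: (le_trans (le2 _ Is' ss)).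
  rewrite -[leRHS]lowE ler_pM2l//; apply: ler_powR_base; [exact: ltW|by rewrite divr_ge0 ?(ltW s0) ?(ltW ss0)|].
  by rewrite ler_pM2l// lef_pV2 ?posrE// ltW.
rewrite ge0_integralD//; last 2 first.
- by move=> s _; rewrite adde_ge0 ?lee_fin.
- exact: emeasurable_funD.
rewrite ge0_integralD//; last by move=> s _; rewrite lee_fin.
rewrite integral_plateau ?/X// cstI -integral_mkcondr.
apply: (@le_trans _ _ ((2 * c)%:E + ((At 1)%:E + (p * c)%:E))%E).
  apply: leeD; first by rewrite lee_fin.
  apply: leeD => //; apply: le_trans hZ; rewrite /Z.
  by apply: subset_integral_ge0 => [s []//|s _]; rewrite lee_fin.
by rewrite -!EFinD lee_fin /D; have := At0 2; lra.
Qed.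

End integral_condition.

(** * Boundedness of the Hardy operator from an Orlicz space *)

Theorem theoremB (R : realType) (alpha beta : R) (A B phi : R -> R)
    (rhoX : (R -> R) -> \bar R)
  (alpha_gt0 : 0 < alpha) (alpha_lt1 : alpha < 1) (beta_gt0 : 0 < beta)
  (alpha_beta : 1 <= alpha + 1 / beta)
  (youngA : young_function A)
  (fund_phi : concave_fundamental phi)
  (phi_infty :
    ereal_sup [set (phi (t `^ (1 / beta)) * t `^ (alpha - 1))%:E
              | t in I01 R] = +oo%E)
  (largestX :
    largest_ri
      (fun rho => bounded_op (Hop alpha beta) rho (marcinkiewicz_norm phi))
      rhoX)
  (youngB : young_function B)
  (fundB :
    equivalent_on `[0%R, 1%R[%classic
      (fundamental_function (luxemburg_norm B)) (fundamental_function rhoX)) :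
  bounded_op (Hop alpha beta) (luxemburg_norm A) (marcinkiewicz_norm phi)
  <->
  exists C c : R, [/\ 0 < C, 0 < c &
    forall t : R, 2 < t ->
      (\int[@lebesgue_measure R]_(s in `[1%R, t]%classic)
         (complementary A s / s `^ (1 / (1 - alpha) + 1))%:E
       <= (c * (complementary B (C * t) / t `^ (1 / (1 - alpha))))%:E)%E].
Proof.
have [a yA] := young_has_density youngA; have [b yB] := young_has_density youngB.
have [c1 [c2 [c10 c20 hX]]] :=
  largest_fundamental alpha_gt0 alpha_lt1 beta_gt0 alpha_beta fund_phi largestX.
have [[d1 d10 hd1] [d2 d20 hd2]] := fundB.
have fundE (rho : (R -> R) -> \bar R) t : I01 R t -> fundamental_function rho t = rho (chi t).
  by move=> /I01P[t0 _]; rewrite /fundamental_function gt_eqF.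
have I0 t : I01 R t -> `[0%R, 1%R[%classic t by exact: mem_I01_itv0.
have th0 t : I01 R t -> 0 < theta alpha beta phi t by move=> It; exact: theta_gt0.
have up t : I01 R t -> (luxemburg_norm B (chi t) <= (d1 * c2 * (t * theta alpha beta phi t))%:E)%E.
  move=> It; have := hd1 t (I0 t It); rewrite !fundE// => h; apply: (le_trans h).
  rewrite -mulrA (EFinM d1); apply: lee_wpmul2l; first by rewrite lee_fin ltW.
  exact: (hX t It).2.
have lo t : I01 R t -> ((c1 / d2 * (t * theta alpha beta phi t))%:E <= luxemburg_norm B (chi t))%E.
  move=> It; have := hd2 t (I0 t It); rewrite !fundE// => h.
  have := le_trans (hX t It).1 h; rewrite -lee_pdivrMl// -EFinM; apply: le_trans.
  by rewrite lee_fin [leRHS]mulrA [d2^-1 * c1]mulrC.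
split.
- move=> /(bounded_modular alpha_lt1 beta_gt0 alpha_beta fund_phi yA)[C C0 hC].
  have e0 : 0 < d1 * c2 by rewrite mulr_gt0.
  apply: (hardy_integral_condition alpha_gt0 alpha_lt1 beta_gt0 fund_phi yA yB C0 hC
    _ (c3 := 4 * (d1 * c2))).
  + by move=> N; exact: theta_unbounded.
  + by rewrite mulr_gt0.
  + by move=> t It; apply: (complementary_fundamental_ge yB It (th0 t It) e0); exact: up.
- move=> [C [c [C0 c0 cond]]].
  have e0 : 0 < c1 / d2 by rewrite divr_gt0.
  have e20 : 0 < c1 / d2 / 2 by rewrite divr_gt0.
  have hB t : I01 R t -> t * complementary B (c1 / d2 / 2 * theta alpha beta phi t) <= 1.
    by move=> It; apply: (complementary_fundamental_le yB It (th0 t It) e0); exact: lo.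
  have [C' C'0 hC'] := modular_of_integral_condition alpha_lt1 beta_gt0 alpha_beta fund_phi
    yA yB C0 c0 e20 hB cond.
  exact: (modular_bounded alpha_lt1 beta_gt0 fund_phi yA C'0 hC').
Qed.
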